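(* Let $n\in\mathbb{N}$. The determinants of the Laplacian with Dirichlet boundary conditions on the odd- and even-dimensional hemispheres $\mathbb{S}^{2n-1}_+$ and $\mathbb{S}^{2n}_+$ satisfy $$-\log\left[\det\left(\mathbb{S}^{2n-1}_+\right)\right]=\zeta'_{\mathbb{S}^{2n-1}_+}(0)=\frac{1}{(2n-2)!}\sum_{k=0}^{2n-1}\zeta'(-k)\left[s(2n-1,k+1)+(-1)^k s(2n-2,k)\right]-\sum_{i=1}^{n-1}\bar u(n-1,i)\frac{(n-1)^{2i+1}}{2i}\left(\frac{H_{i-1}}{2}-H_{2i-1}\right)$$ and $$-\log\left[\det\left(\mathbb{S}^{2n}_+\right)\right]=\zeta'_{\mathbb{S}^{2n}_+}(0)=\frac{1}{(2n-1)!}\sum_{k=0}^{2n-1}\zeta'(-k)\left[s(2n,k+1)+(-1)^{k+1}s(2n-1,k)\right]+\sum_{i=1}^{n}\bar v(n,i)\frac{(2n-1)^{2i}}{4i}\left(\frac{H_{i-1}}{2}-H_{2i-1}\right).$$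
   Context: $\mathbb{N}=\{1,2,3,\dots\}$, $\zeta$ is the Riemann zeta function with derivative $\zeta'$, $H_m=\sum_{k=1}^m\frac1k$ (with $H_0=0$), and empty sums are $0$. For $N\ge1$, the eigenvalues of the Laplacian with Dirichlet boundary conditions on the $N$-dimensional unit hemisphere $\mathbb{S}^N_+$ are $k(k+N-1)$, $k=1,2,\dots$, with multiplicities $\binom{N+k-2}{k-1}$. The spectral zeta function is $\zeta_{\mathbb{S}^N_+}(s)=\sum_{k=1}^\infty\binom{N+k-2}{k-1}(k(k+N-1))^{-s}$ for $\mathrm{Re}(s)$ large, extended meromorphically to $\mathbb{C}$; it is analytic at $s=0$, and $\det(\mathbb{S}^N_+):=e^{-\zeta'_{\mathbb{S}^N_+}(0)}$. The (signed) Stirling numbers of the first kind $s(n,k)$ are defined by $x(x-1)\cdots(x-n+1)=\sum_{k=0}^n s(n,k)x^k$ (empty product equal to $1$ for $n=0$), with $s(n,k)=0$ for $k>n$. The central factorial numbers are given for $n\ge1$ by $\sum_{k=1}^n u(n,k)x^k=\prod_{i=0}^{n-1}(x-i^2)$ and $\sum_{k=1}^n v(n,k)x^k=x\prod_{i=1}^{n-1}\big(x-(2i-1)^2\big)$; moreover $\bar u(n,k):=\frac{2}{(2n)!}u(n,k)$ and $\bar v(n,k):=\frac{4^{-(n-1)}}{(2n-1)!}v(n,k)$. *)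

(* Defs.v *)
From mathcomp Require Import all_boot ssralg poly.
From Stdlib Require Import Reals ClassicalEpsilon.
From mathcomp Require Import Rstruct.
From Coquelicot Require Import Coquelicot.
From mathcomp Require Import ssrnat binomial.

Section CombinatorialNumbers.
Import GRing.Theory.
Local Open Scope ring_scope.

(* Signed Stirling numbers of the first kind. *)
Definition stirling1 (n k : nat) : R :=
  (\prod_(i < n) ('X - (i%:R)%:P) : {poly R})`_k.

Definition central_u (n k : nat) : R :=
  (\prod_(i < n) ('X - ((i ^ 2)%:R)%:P) : {poly R})`_k.

Definition central_v (n k : nat) : R :=
  ('X * \prod_(1 <= i < n) ('X - (((2 * i - 1) ^ 2)%:R)%:P) : {poly R})`_k.

End CombinatorialNumbers.

Local Open Scope R_scope.

Definition central_ubar (n k : nat) : R :=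
  2 / INR (2 * n)`! * central_u n k.

Definition central_vbar (n k : nat) : R :=
  / 4 ^ (n - 1) / INR (2 * n - 1)`! * central_v n k.

Definition harmonic (m : nat) : R := sum_n_m (fun k => / INR k) 1 m.

Local Open Scope C_scope.

Definition Cexp (z : C) : C :=
  (exp (Re z) * cos (Im z), exp (Re z) * sin (Im z))%R.

(* x ^ s; meaningful for x > 0 only. *)
Definition Rcpow (x : R) (s : C) : C := Cexp (s * ln x).

Definition analytic_at (F : C -> C) (s0 : C) : Prop :=
  exists (a : nat -> C) (r : R), (0 < r)%R /\
    forall s : C, (Cmod (s - s0) < r)%R ->
      @is_pseries C_AbsRing C_NormedModule a (s - s0) (F s).

Definition pole_at (F : C -> C) (s0 : C) : Prop :=
  exists (m : nat) (g : C -> C) (r : R),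
    (0 < m)%N /\ analytic_at g s0 /\ g s0 <> 0 /\ (0 < r)%R /\
    forall s : C, (0 < Cmod (s - s0) < r)%R -> F s = g s / (s - s0) ^ m.

(* Every point is a point of analyticity or a pole, so F has no removable
   singularities: away from its poles, F is determined by its values on any
   half-plane.  The value of the total function F at a pole is arbitrary. *)
Definition meromorphic (F : C -> C) : Prop :=
  forall s0 : C, analytic_at F s0 \/ pole_at F s0.

(* F is a meromorphic continuation of the Dirichlet series
   \sum_(k >= 1) c_k l_k ^ (- s), which converges to F for Re s large. *)
Definition dirichlet_continuation (c l : nat -> R) (F : C -> C) : Prop :=
  meromorphic F /\
  exists sigma : R, forall s : C, (sigma < Re s)%R ->
    @is_series C_AbsRing C_NormedModule
      (fun k => c k.+1 * Rcpow (l k.+1) (- s)) (F s).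

Definition dirichlet_function (c l : nat -> R) : C -> C :=
  epsilon (inhabits (fun _ : C => RtoC 0)) (dirichlet_continuation c l).

Definition riemann_zeta : C -> C := dirichlet_function (fun _ => 1%R) INR.

Definition hemisphere_mult (N k : nat) : R := INR 'C(N + k - 2, k - 1).

Definition hemisphere_eigenvalue (N k : nat) : R := INR (k * (k + N - 1)).

Definition hemisphere_zeta (N : nat) : C -> C :=
  dirichlet_function (hemisphere_mult N) (hemisphere_eigenvalue N).

Definition hemisphere_det (N : nat) : C :=
  Cexp (- C_derive (hemisphere_zeta N) 0).

(* Main.v *)
(** With [a = (N - 1) / 2] and [x = k + a], the eigenvalue [k (k + N - 1)] is
    [(x - a) (x + a)] and the multiplicity is a polynomial [P(x)].  Let [A(s)] and
    [B(s)] be the sums of [P(x) (x - a)^(-s)] and [P(x) (x + a)^(-s)]; expanding [P]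
    with Stirling numbers makes both linear combinations of [zeta(s - m)].  By the
    binomial series, with [(s)_j] the rising factorial, the hemisphere zeta function is
    [(A(2 s) + B(2 s)) / 2] plus the sum over [j >= 1] of
    [((s)_j / j! - (2 s)_(2 j) / (2 j)!) a^(2 j) sum_x P(x) x^(- 2 s - 2 j)].
    The coefficient in parentheses vanishes to second order at [s = 0], so only the
    simple poles of the inner sums contribute to the derivative there: they come from
    the odd coefficients of [P], which are the central factorial numbers.

    The continuations are explicit.  As [zeta] functions are only specified as some
    meromorphic continuation, the values are then transferred by the identity theorem. *)

Require Import Defs.
From mathcomp Require Import all_boot ssralg poly zify.
From Stdlib Require Import Reals Lra Lia ClassicalEpsilon.
From mathcomp Require Import Rstruct.
From mathcomp Require Import ssreflect ssrfun ssrbool.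
From Stdlib Require Import Reals.
From Coquelicot Require Import Coquelicot.
From mathcomp Require Import ssrnat.

Local Open Scope C_scope.

(** * Complex series *)

Set Implicit Arguments.
Unset Strict Implicit.
Unset Printing Implicit Defensive.

(** Both (x^2 - a^2)^(-s) and the half-sum of (x - a)^(-2 s) and (x + a)^(-2 s) equal 1 at s = 0 and
    have the derivative -log (x - a) - log (x + a) there; this is why the coefficients of the
    difference vanish to second order. A simple pole 1 / (2 s) of an inner sum then turns s^2 into s
    / 2, and this 1/2 is all that the sum over x leaves. The obstacle is to justify this for an
    infinite sum over j of functions, finitely many of which have a pole at the origin. Power series
    are therefore normed by their absolute coefficients: a series of functions with summable norms
    is again analytic, so the sum over j is a finite head plus an analytic tail, and the tail,
    multiplied by s^2, does not reach the first derivative. The room for convergence is x >= 1 + a,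
    which gives the powers of (a / (1 + a))^2. The inner sums are Hurwitz zeta functions with
    parameter 1 + a; a single recursion continues them and, for a = 0, the Riemann zeta function as
    well. *)

Definition csum (a : nat -> C) (n : nat) : C := @sum_n C_AbelianMonoid a n.
Definition rsum (a : nat -> R) (n : nat) : R := @sum_n R_AbelianMonoid a n.
Arguments csum : simpl never.
Arguments rsum : simpl never.

(** Total because [Series] is: without convergence the value has no meaning, so it is used together
    with [cseries]. *)
Definition Cseries (a : nat -> C) : C :=
  (Series (fun n => Re (a n)), Series (fun n => Im (a n))).

(** Componentwise, so that facts about real series apply directly; [cseries_is_series] translates to
    the normed-module notion of the definitions. *)
Definition cseries (a : nat -> C) (l : C) : Prop :=
  is_series (fun n => Re (a n)) (Re l) /\ is_series (fun n => Im (a n)) (Im l).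

Lemma csumS (a : nat -> C) n : csum a n.+1 = csum a n + a n.+1.
Proof. exact: (sum_Sn (G := C_AbelianMonoid)). Qed.

Lemma csum0 (a : nat -> C) : csum a 0 = a 0%N.
Proof. exact: sum_O. Qed.

Lemma rsumS (a : nat -> R) n : rsum a n.+1 = (rsum a n + a n.+1)%R.
Proof. exact: (sum_Sn (G := R_AbelianMonoid)). Qed.

Lemma rsum0 (a : nat -> R) : rsum a 0 = a 0%N.
Proof. exact: sum_O. Qed.

Lemma csum_ext (a b : nat -> C) n : (forall i, a i = b i) -> csum a n = csum b n.
Proof. exact: sum_n_ext. Qed.

Lemma csum_mulr (c : C) (a : nat -> C) n : csum (fun i => c * a i) n = c * csum a n.
Proof. by elim: n => [|n IH]; rewrite ?csum0 // !csumS IH; ring. Qed.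

Lemma csum_plus (a b : nat -> C) n : csum (fun i => a i + b i) n = csum a n + csum b n.
Proof. by elim: n => [|n IH]; rewrite ?csum0 // !csumS IH; ring. Qed.

Lemma rsum_mulr (c : R) (a : nat -> R) n : rsum (fun i => c * a i)%R n = (c * rsum a n)%R.
Proof. by elim: n => [|n IH]; rewrite ?rsum0 // !rsumS IH; ring. Qed.

Lemma Re_csum (a : nat -> C) n : Re (csum a n) = rsum (fun i => Re (a i)) n.
Proof. by elim: n => [|n IH]; rewrite ?csum0 ?rsum0 // csumS rsumS -IH. Qed.

Lemma Im_csum (a : nat -> C) n : Im (csum a n) = rsum (fun i => Im (a i)) n.
Proof. by elim: n => [|n IH]; rewrite ?csum0 ?rsum0 // csumS rsumS -IH. Qed.

Lemma im_le_Cmod (z : C) : (Rabs (Im z) <= Cmod z)%R.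
Proof. by apply: Rle_trans (Rmax_r _ _) (Rmax_Cmod z). Qed.

Lemma Cmod_le_ReIm (z : C) : (Cmod z <= Rabs (Re z) + Rabs (Im z))%R.
Proof.
have -> : z = RtoC (Re z) + Ci * RtoC (Im z).
  by case: z => x y; rewrite /RtoC /Cplus /Cmult /=; f_equal; ring.
apply: Rle_trans (Cmod_triangle _ _) _.
rewrite Cmod_mult Cmod_Ci !Cmod_R /=.
by apply: Req_le; f_equal; [f_equal; ring | rewrite Rmult_1_l; f_equal; ring].
Qed.

Lemma Cmod_csum (a : nat -> C) n : (Cmod (csum a n) <= rsum (fun i => Cmod (a i)) n)%R.
Proof.
elim: n => [|n IH]; first by rewrite csum0 rsum0; apply: Rle_refl.
by rewrite csumS rsumS; apply: Rle_trans (Cmod_triangle _ _) _; lra.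
Qed.

Lemma rseries_eps (a : nat -> R) (l : R) :
  is_series a l <-> forall eps : R, (0 < eps)%R ->
    exists N : nat, forall n, (N <= n)%N -> (Rabs (rsum a n - l) < eps)%R.
Proof.
split.
  move=> H eps He.
  have [N HN] := proj1 (filterlim_locally _ _) H (mkposreal eps He).
  by exists N => n Hn; apply: HN; lia.
move=> H; apply: (proj2 (filterlim_locally _ _)) => eps.
have [N HN] := H eps (cond_pos eps).
by exists N => n Hn; apply: HN; lia.
Qed.

Lemma cseries_eps (a : nat -> C) (l : C) :
  cseries a l <-> forall eps : R, (0 < eps)%R ->
    exists N : nat, forall n, (N <= n)%N -> (Cmod (csum a n - l) < eps)%R.
Proof.
split.
  move=> [/rseries_eps H1 /rseries_eps H2] eps He.
  have [N1 HN1] := H1 (eps / 2)%R ltac:(lra).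
  have [N2 HN2] := H2 (eps / 2)%R ltac:(lra).
  exists (N1 + N2)%N => n Hn.
  apply: Rle_lt_trans (Cmod_le_ReIm _) _.
  have := HN1 n ltac:(lia); have := HN2 n ltac:(lia).
  rewrite -Re_csum -Im_csum => h2 h1.
  rewrite (_ : Re (_ - _) = Re (csum a n) - Re l)%R // (_ : Im (_ - _) = Im (csum a n) - Im l)%R //.
  lra.
move=> H; split; apply/rseries_eps => eps /H [N HN]; exists N => n /HN;
  apply: Rle_lt_trans; [rewrite -Re_csum; exact: (re_le_Cmod (_ - _)) |
  rewrite -Im_csum; exact: (im_le_Cmod (_ - _))].
Qed.

Lemma cseries_is_series (a : nat -> C) (l : C) :
  cseries a l <-> @is_series C_AbsRing C_NormedModule a l.
Proof.
rewrite cseries_eps; split.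
  move=> H.
  apply: (proj2 (filterlim_locally_ball_norm (K := C_AbsRing) (U := C_NormedModule) _ _)) => eps.
  have [N HN] := H eps (cond_pos eps).
  by exists N => n Hn; apply: HN; lia.
move=> H eps He.
have [N HN] := proj1 (filterlim_locally_ball_norm (K := C_AbsRing) (U := C_NormedModule) _ _) H (mkposreal eps He).
by exists N => n Hn; apply: HN; lia.
Qed.

Lemma Cseries_unique (a : nat -> C) (l : C) : cseries a l -> Cseries a = l.
Proof.
by case => /is_series_unique h1 /is_series_unique h2;
  apply: injective_projections.
Qed.

Lemma Cseries_ext (a b : nat -> C) : (forall n, a n = b n) -> Cseries a = Cseries b.
Proof.
by move=> H; rewrite /Cseries; f_equal; apply: Series_ext => n; rewrite H.
Qed.

Lemma cseries_ext (a b : nat -> C) (l : C) : (forall n, a n = b n) -> cseries a l -> cseries b l.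
Proof. by move=> H [H1 H2]; split; [apply: is_series_ext H1 | apply: is_series_ext H2] => n; rewrite H. Qed.

Lemma cseries_lim_unique (a : nat -> C) (l1 l2 : C) : cseries a l1 -> cseries a l2 -> l1 = l2.
Proof. by move=> /Cseries_unique <- /Cseries_unique <-. Qed.

Lemma cseries_plus (a b : nat -> C) (la lb : C) :
  cseries a la -> cseries b lb -> cseries (fun n => a n + b n) (la + lb).
Proof. by move=> [? ?] [? ?]; split; apply: is_series_plus. Qed.

Lemma cseries_scal (c : C) (a : nat -> C) (l : C) :
  cseries a l -> cseries (fun n => c * a n) (c * l).
Proof.
move=> /cseries_is_series H; apply/cseries_is_series.
exact: is_series_scal H.
Qed.

Lemma cseries_minus (a b : nat -> C) (la lb : C) :
  cseries a la -> cseries b lb -> cseries (fun n => a n - b n) (la - lb).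
Proof.
move=> Ha Hb; have := cseries_plus Ha (cseries_scal (RtoC (-1)) Hb).
rewrite (_ : la + RtoC (-1) * lb = la - lb); last by ring.
by apply: cseries_ext => n; ring.
Qed.

Lemma cseries_csum (a : nat -> nat -> C) (l : nat -> C) K :
  (forall k, cseries (fun n => a n k) (l k)) ->
  cseries (fun n => csum (a n) K) (csum l K).
Proof.
move=> H; elim: K => [|K IH].
  by rewrite csum0; apply: cseries_ext (H 0%N) => n; rewrite csum0.
rewrite csumS; apply: cseries_ext (cseries_plus IH (H K.+1)) => n.
by rewrite csumS.
Qed.

Lemma cseries0 : cseries (fun _ => RtoC 0) (RtoC 0).
Proof.
apply/cseries_eps => eps He; exists 0%N => n _.
rewrite (_ : csum _ n = 0); last by elim: n => [|n IH]; rewrite ?csum0 // csumS IH; ring.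
by rewrite (_ : 0 - 0 = 0) ?Cmod_0 //; ring.
Qed.

Lemma cseries_terms0 (a : nat -> C) (l : C) : cseries a l ->
  exists B : R, forall n, (Cmod (a n) <= B)%R.
Proof.
move=> /cseries_eps H; have [N HN] := H 1%R Rlt_0_1.
have [B0 HB0] : exists B, forall n, (n <= N)%N -> (Cmod (a n) <= B)%R.
  clear HN; elim: N => [|N [B HB]].
    by exists (Cmod (a 0%N)) => n; rewrite leqn0 => /eqP ->; lra.
  exists (Rmax B (Cmod (a N.+1))) => n Hn.
  have [->|Hn'] : n = N.+1 \/ (n <= N)%N by lia.
    exact: Rmax_r.
  by apply: Rle_trans (HB n Hn') (Rmax_l _ _).
(* Past [N] a term is a difference of consecutive partial sums, each within 1 of the limit, hence
   the 2; [B0] covers the earlier terms. *)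
exists (Rmax B0 2) => n.
have [Hn|Hn] : (n <= N)%N \/ (N <= n.-1)%N /\ n = n.-1.+1 by lia.
  by apply: Rle_trans (HB0 n Hn) (Rmax_l _ _).
apply: Rle_trans (Rmax_r _ _).
case: Hn => Hn En; rewrite En.
have -> : a n.-1.+1 = (csum a n.-1.+1 - l) - (csum a n.-1 - l) by rewrite csumS; ring.
apply: Rle_trans (Cmod_triangle _ _) _; rewrite Cmod_opp.
have := HN n.-1 ltac:(lia); have := HN n.-1.+1 ltac:(lia); lra.
Qed.

Lemma ex_series_nonneg_bound (u : nat -> R) (B : R) :
  (forall n, 0 <= u n)%R -> (forall K, rsum u K <= B)%R ->
  ex_series u /\ (Series u <= B)%R.
Proof.
move=> Hu HB.
have Hincr n : (rsum u n <= rsum u n.+1)%R by rewrite rsumS; have := Hu n.+1; lra.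
have [l Hl] := ex_finite_lim_seq_incr _ B Hincr HB.
have Hs : is_series u l by [].
split; first by exists l.
rewrite (is_series_unique _ _ Hs).
exact: (is_lim_seq_le _ _ _ _ HB Hl (is_lim_seq_const B)).
Qed.

Lemma rsum_le_Series (u : nat -> R) K :
  (forall n, 0 <= u n)%R -> ex_series u -> (rsum u K <= Series u)%R.
Proof.
move=> Hu /Series_correct Hs.
have Hincr n : (rsum u n <= rsum u n.+1)%R by rewrite rsumS; have := Hu n.+1; lra.
exact: (is_lim_seq_incr_compare _ _ Hs Hincr).
Qed.

Lemma rsum_le (u v : nat -> R) n : (forall i, u i <= v i)%R -> (rsum u n <= rsum v n)%R.
Proof.
move=> H; elim: n => [|n IH]; first by rewrite !rsum0.
by rewrite !rsumS; have := H n.+1; lra.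
Qed.

Lemma rsum_ge0 (u : nat -> R) n : (forall i, 0 <= u i)%R -> (0 <= rsum u n)%R.
Proof.
move=> H; elim: n => [|n IH]; first by rewrite rsum0.
by rewrite rsumS; have := H n.+1; lra.
Qed.

Lemma rsum_ext (u v : nat -> R) n : (forall i, u i = v i) -> rsum u n = rsum v n.
Proof. exact: sum_n_ext. Qed.

(** Absolute convergence in quantitative form: the [B] that bounds the partial sums of moduli also
    bounds the sum, which is how norm estimates pass to limits. *)
Lemma cseries_abs (a : nat -> C) (B : R) :
  (forall K, rsum (fun n => Cmod (a n)) K <= B)%R ->
  cseries a (Cseries a) /\ (Cmod (Cseries a) <= B)%R.
Proof.
move=> HB.
have [Hex _] := ex_series_nonneg_bound (fun n => Cmod_ge_0 (a n)) HB.
have [l Hs] : exists l : C, cseries a l.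
  have [l Hl] : @ex_series C_AbsRing C_NormedModule a.
    apply: (ex_series_le (V := C_CompleteNormedModule) _ (fun n => Cmod (a n))) => // n.
    exact: Rle_refl.
  by exists l; apply/cseries_is_series.
rewrite (Cseries_unique Hs); split => //.
apply: Rnot_lt_le => Hlt.
have [N HN] := proj1 (cseries_eps _ _) Hs (Cmod l - B)%R ltac:(lra).
have := HN N (leqnn N).
have : (Cmod l <= Cmod (csum a N - l) + Cmod (csum a N))%R.
  rewrite -(Cmod_opp (_ - _)).
  by apply: Rle_trans (Cmod_triangle _ _); apply: Req_le; f_equal; ring.
have := Cmod_csum a N; have := HB N; lra.
Qed.

(** Tannery's theorem, dominated convergence for series: past an index [N] the tail of [M] is below
    [eps / 2] uniformly in [K], and the finitely many remaining terms tend to 0. *)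
Lemma Series_dominated0 (u : nat -> nat -> R) (M : nat -> R) :
  ex_series M -> (forall K n, 0 <= u K n <= M n)%R ->
  (forall n (eps : R), (0 < eps)%R -> exists K0, forall K, (K0 <= K)%N -> (u K n < eps)%R) ->
  forall eps : R, (0 < eps)%R ->
  exists K0, forall K, (K0 <= K)%N -> (Series (u K) < eps)%R.
Proof.
move=> HM Hu Hlim eps He.
have [N HN] := proj1 (rseries_eps _ _) (Series_correct _ HM) (eps / 2)%R ltac:(lra).
have {HN} := HN N (leqnn N) => HN.
have Hfin : forall n (e : R), (0 < e)%R ->
    exists K0, forall K, (K0 <= K)%N -> (rsum (u K) n < e)%R.
  elim=> [|n IH] e He'.
    by have [K0 HK0] := Hlim 0%N e He'; exists K0 => K HK; rewrite rsum0; apply: HK0.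
  have [K1 H1] := IH (e / 2)%R ltac:(lra).
  have [K2 H2] := Hlim n.+1 (e / 2)%R ltac:(lra).
  exists (K1 + K2)%N => K HK; rewrite rsumS.
  by have := H1 K ltac:(lia); have := H2 K ltac:(lia); lra.
have [K0 HK0] := Hfin N (eps / 2)%R ltac:(lra).
exists K0 => K HK; have {HK} HK := HK0 K HK.
have HuK : ex_series (u K).
  apply: (ex_series_le (V := R_CompleteNormedModule) _ M) => // n.
  by rewrite /norm /= /abs /= Rabs_pos_eq; have := Hu K n; lra.
have E (v : nat -> R) : ex_series v ->
    Series v = (rsum v N + Series (fun k => v (N.+1 + k)%coq_nat))%R.
  by move=> Hv; rewrite (Series_incr_n v N.+1) //; [rewrite -sum_n_Reals | lia].
rewrite E //.
have : (Series (fun k => u K (N.+1 + k)%coq_nat) <= Series (fun k => M (N.+1 + k)%coq_nat))%R.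
  apply: Series_le => [n|]; first exact: Hu.
  exact: (proj1 (ex_series_incr_n M N.+1) HM).
move: HN; rewrite (E _ HM) => /Rabs_def2; lra.
Qed.

(** The rows truncated at [K] differ from the full rows by at most [2 * M n], and for each [n] this
    difference tends to 0; [Series_dominated0] lets the sum over [n] commute with the limit in
    [K]. *)
Lemma cseries_Fubini (a : nat -> nat -> C) (M : nat -> R) :
  (forall n K, rsum (fun k => Cmod (a n k)) K <= M n)%R -> ex_series M ->
  cseries (fun k => Cseries (fun n => a n k)) (Cseries (fun n => Cseries (a n))) /\
  cseries (fun n => Cseries (a n)) (Cseries (fun n => Cseries (a n))) /\
  (forall k, cseries (fun n => a n k) (Cseries (fun n => a n k))).
Proof.
move=> HM exM.
have M0 n : (0 <= M n)%R.
  by apply: Rle_trans (HM n 0%N); rewrite rsum0; apply: Cmod_ge_0.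
have Ha n k : (Cmod (a n k) <= M n)%R.
  apply: Rle_trans (HM n k); case: k => [|k]; first by rewrite rsum0; lra.
  have := rsum_ge0 k (fun i => Cmod_ge_0 (a n i)); rewrite rsumS; lra.
have Hdom (b : nat -> C) : (forall n, Cmod (b n) <= M n)%R -> cseries b (Cseries b).
  move=> Hb; apply: (proj1 (cseries_abs (B := Series M) _)) => K.
  exact: Rle_trans (rsum_le _ Hb) (rsum_le_Series _ M0 exM).
have HS n : (Cmod (Cseries (a n)) <= M n)%R by exact: (proj2 (cseries_abs (HM n))).
have Hcol k : cseries (fun n => a n k) (Cseries (fun n => a n k)) by apply: Hdom => n; apply: Ha.
split; last by split; [apply: Hdom |].
apply/cseries_eps => eps He.
pose u K n := Cmod (csum (a n) K - Cseries (a n)).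
have Hu K n : (0 <= u K n <= 2 * M n)%R.
  split; first exact: Cmod_ge_0.
  apply: Rle_trans (Cmod_triangle _ _) _; rewrite Cmod_opp.
  by have := Rle_trans _ _ _ (Cmod_csum (a n) K) (HM n K); have := HS n; lra.
have [K0 HK0] : exists K0, forall K, (K0 <= K)%N -> (Series (u K) < eps)%R.
  apply: (Series_dominated0 (M := fun n => (2 * M n)%R)) => //.
    exact: (ex_series_scal_l (K := R_AbsRing) (V := R_NormedModule) 2%R).
  move=> n e He'.
  exact: (proj1 (cseries_eps _ _) (proj1 (cseries_abs (HM n)))).
exists K0 => K HK.
have H1 := cseries_minus (cseries_csum K Hcol) (Hdom _ HS).
rewrite -(Cseries_unique H1).
apply: Rle_lt_trans (HK0 K HK).
apply: (proj2 (cseries_abs _)) => J.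
apply: rsum_le_Series => [n|]; first exact: Cmod_ge_0.
apply: (ex_series_le (V := R_CompleteNormedModule) _ (fun n => 2 * M n)%R) => [n|].
  by rewrite /norm /= /abs /= Rabs_pos_eq; have := Hu K n; rewrite /u; lra.
exact: (ex_series_scal_l (K := R_AbsRing) (V := R_NormedModule) 2%R).
Qed.

(** * Power series with absolutely summable coefficients *)

Lemma rsum_swap (a : nat -> nat -> R) n m :
  rsum (fun i => rsum (fun j => a i j) m) n = rsum (fun j => rsum (fun i => a i j) n) m.
Proof.
elim: n => [|n IH]; first by rewrite rsum0; apply: rsum_ext => i; rewrite rsum0.
rewrite rsumS IH; elim: m {IH} => [|m IH]; first by rewrite !rsum0 rsumS.
by rewrite !rsumS -IH; ring.
Qed.

Lemma Cmod_RtoC_pos (x : R) : (0 <= x)%R -> Cmod (RtoC x) = x.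
Proof. by move=> Hx; rewrite Cmod_R Rabs_pos_eq. Qed.

Lemma RtoC_pow_nat (x : R) n : RtoC (x ^ n) = RtoC x ^ n.
Proof. exact: RtoC_pow. Qed.

Lemma Rpow_ge0 (x : R) n : (0 <= x)%R -> (0 <= x ^ n)%R.
Proof. exact: pow_le. Qed.

(* [f] is given on the closed disc of radius [r] about [s0] by a power series
   whose absolute coefficient sum, weighted by the powers of [r], is at most [B].
   These weighted sums are Banach algebra norms, which makes locally uniform limits
   tractable without Cauchy's integral formula. *)
Definition majorized (s0 : C) (r B : R) (f : C -> C) : Prop :=
  exists a : nat -> C, (forall K, rsum (fun n => Cmod (a n) * r ^ n)%R K <= B)%R /\
    forall s, (Cmod (s - s0) <= r)%R -> cseries (fun n => a n * (s - s0) ^ n) (f s).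

Lemma majorized_ext s0 r B f g :
  (forall s, (Cmod (s - s0) <= r)%R -> f s = g s) ->
  majorized s0 r B f -> majorized s0 r B g.
Proof.
move=> H [a [Ha Hs]]; exists a; split => // s Hr.
by rewrite -H //; apply: Hs.
Qed.

Lemma majorized_le s0 r B B' f :
  (B <= B')%R -> majorized s0 r B f -> majorized s0 r B' f.
Proof.
by move=> H [a [Ha Hs]]; exists a; split => // K; apply: Rle_trans (Ha K) H.
Qed.

Lemma majorized_radius s0 r r' B f :
  (0 <= r' <= r)%R -> majorized s0 r B f -> majorized s0 r' B f.
Proof.
move=> Hr [a [Ha Hs]]; exists a; split => [K|s Hsr]; last by apply: Hs; lra.
apply: Rle_trans (rsum_le _ _) (Ha K) => n.
by apply: Rmult_le_compat_l; [apply: Cmod_ge_0 | apply: pow_incr].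
Qed.

Lemma cseries_single (m : nat) (c : C) : cseries (fun n => if n == m then c else 0) c.
Proof.
apply/cseries_eps => eps He; exists m => n Hn.
have -> : csum (fun n => if n == m then c else 0) n = c; last first.
  by rewrite (_ : c - c = 0) ?Cmod_0 //; ring.
have H k : (k < m)%N -> csum (fun n => if n == m then c else 0) k = 0.
  elim: k => [|k IH] Hk; first by rewrite csum0; case: eqP => //; lia.
  by rewrite csumS IH; last lia; case: eqP => [|_]; [lia | ring].
elim: n Hn => [|n IH] Hn.
  by rewrite csum0; have -> : m = 0%N by lia.
rewrite csumS; have [E|E] : m = n.+1 \/ (m <= n)%N by lia.
  by rewrite H; [rewrite E eqxx; ring | lia].
by rewrite IH //; case: eqP => [|_]; [lia | ring].
Qed.

Lemma majorized_const s0 r (c : C) : majorized s0 r (Cmod c) (fun _ => c).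
Proof.
exists (fun n => if n == 0%N then c else 0); split.
  elim=> [|K IH]; first by rewrite rsum0 /=; lra.
  by rewrite rsumS /= Cmod_0; lra.
move=> s _; apply: cseries_ext (cseries_single 0 c) => n.
by case: eqP => [->|_] /=; ring.
Qed.

Lemma cseries_shift (a : nat -> C) (l : C) m : cseries a l ->
  cseries (fun n => if (n < m)%N then RtoC 0 else a (n - m)%N) l.
Proof.
move=> /cseries_eps H; apply/cseries_eps => eps He.
have [N HN] := H eps He; exists (N + m)%N => n Hn.
have E k : csum (fun n => if (n < m)%N then RtoC 0 else a (n - m)%N) (k + m) = csum a k.
  elim: k => [|k IH].
    rewrite add0n csum0; case: m {Hn} => [|m]; first by rewrite csum0.
    have H0 j : (j <= m)%N -> csum (fun n => if (n < m.+1)%N then RtoC 0 else a (n - m.+1)%N) j = 0.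
      elim: j => [|j IH] Hj; first by rewrite csum0.
      by rewrite csumS IH; last lia; case: ltnP => Hlt; [ring | lia].
    rewrite csumS H0; last lia.
    by case: ltnP => Hlt; [lia | rewrite subnn; ring].
  rewrite addSn csumS IH csumS; case: ltnP => Hlt; first lia.
  by rewrite -addSn addnK.
have -> : n = ((n - m) + m)%N by lia.
by rewrite E; apply: HN; lia.
Qed.

Lemma majorized_monomial s0 r B m f : (0 <= r)%R ->
  majorized s0 r B f -> majorized s0 r (r ^ m * B) (fun s => (s - s0) ^ m * f s).
Proof.
move=> Hr [a [Ha Hs]].
exists (fun n => if (n < m)%N then RtoC 0 else a (n - m)%N); split.
  move=> K.
  have H0 k : (k < m)%N ->
    rsum (fun n => Cmod (if (n < m)%N then RtoC 0 else a (n - m)%N) * r ^ n)%R k = 0%R.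
    elim: k => [|k IH] Hk; first by rewrite rsum0; case: ltnP => [_|]; [rewrite Cmod_0; ring | lia].
    by rewrite rsumS IH; last lia; case: ltnP => [_|]; [rewrite Cmod_0; ring | lia].
  have HB : (0 <= B)%R.
    apply: Rle_trans (Ha 0%N); rewrite rsum0.
    by apply: Rmult_le_pos (Cmod_ge_0 _) (Rpow_ge0 _ Hr).
  have [Hk|Hk] : (K < m)%N \/ K = ((K - m) + m)%N by lia.
    by rewrite H0 //; apply: Rmult_le_pos (Rpow_ge0 _ Hr) HB.
  rewrite Hk; move: (K - m)%N => k {K Hk}.
  apply: Rle_trans (Rmult_le_compat_l _ _ _ (Rpow_ge0 m Hr) (Ha k)).
  apply: Req_le; elim: k => [|k IH].
    rewrite add0n rsum0; case: m H0 => [|m] H0; first by rewrite rsum0 subn0 /=; ring.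
    rewrite rsumS H0; last lia.
    by case: ltnP => [|_]; [lia | rewrite subnn /=; ring].
  rewrite addSn rsumS IH rsumS; case: ltnP => [|_]; first lia.
  by rewrite -addSn addnK pow_add; ring.
move=> s Hsr.
apply: cseries_ext (cseries_scal ((s - s0) ^ m) (cseries_shift m (Hs s Hsr))) => n.
case: ltnP => Hn; first ring.
have -> : (s - s0) ^ n = (s - s0) ^ m * (s - s0) ^ (n - m).
  by rewrite -Cpow_add_r; f_equal; lia.
ring.
Qed.

Lemma majorized_bound s0 r B f s :
  majorized s0 r B f -> (Cmod (s - s0) <= r)%R -> (Cmod (f s) <= B)%R.
Proof.
move=> [a [Ha Hs]] Hsr; rewrite -(Cseries_unique (Hs s Hsr)).
apply: (proj2 (cseries_abs _)) => K; apply: Rle_trans (rsum_le _ _) (Ha K) => n.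
rewrite Cmod_mult Cmod_pow; apply: Rmult_le_compat_l; first exact: Cmod_ge_0.
by apply: pow_incr; split; first exact: Cmod_ge_0.
Qed.

Lemma majorized_ge0 s0 r B f : (0 <= r)%R -> majorized s0 r B f -> (0 <= B)%R.
Proof.
move=> Hr H; apply: Rle_trans (majorized_bound (s := s0) H _); first exact: Cmod_ge_0.
by rewrite (_ : s0 - s0 = 0) ?Cmod_0 //; ring.
Qed.

(** Completeness of the norm: the coefficients of the sum are the column sums of the coefficients,
    and Fubini re-sums them at each point of the disc. *)
Lemma majorized_series s0 r (B : nat -> R) (f : nat -> C -> C) : (0 < r)%R ->
  (forall k, majorized s0 r (B k) (f k)) -> ex_series B ->
  majorized s0 r (Series B) (fun s => Cseries (fun k => f k s)) /\
  forall s, (Cmod (s - s0) <= r)%R -> cseries (fun k => f k s) (Cseries (fun k => f k s)).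
Proof.
move=> Hr Hf exB.
have B0 k : (0 <= B k)%R by apply: majorized_ge0 (Hf k); lra.
have [a Ha] : exists a : nat -> nat -> C, forall k,
   (forall K, rsum (fun n => Cmod (a k n) * r ^ n)%R K <= B k)%R /\
    forall s, (Cmod (s - s0) <= r)%R -> cseries (fun n => a k n * (s - s0) ^ n) (f k s).
  exists (fun k => proj1_sig (constructive_indefinite_description _ (Hf k))) => k.
  exact: (proj2_sig (constructive_indefinite_description _ (Hf k))).
have Hterm k n : (Cmod (a k n) * r ^ n <= B k)%R.
  have Hp i : (0 <= Cmod (a k i) * r ^ i)%R.
    by apply: Rmult_le_pos; [apply: Cmod_ge_0 | apply: Rpow_ge0; lra].
  apply: Rle_trans (proj1 (Ha k) n); case: n => [|n]; first by rewrite rsum0; lra.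
  by rewrite rsumS; have := rsum_ge0 n Hp; lra.
have Hcol n : cseries (fun k => a k n) (Cseries (fun k => a k n)).
  have rn : (0 < r ^ n)%R by apply: pow_lt.
  apply: (proj1 (cseries_abs (B := Series (fun k => / r ^ n * B k)%R) _)) => K.
  have Hle k : (Cmod (a k n) <= / r ^ n * B k)%R.
    apply: (Rmult_le_reg_l (r ^ n)) => //.
    by rewrite -Rmult_assoc Rinv_r; [have := Hterm k n; lra | lra].
  apply: Rle_trans (rsum_le _ Hle) (rsum_le_Series _ _ _).
    by move=> k; apply: Rle_trans (Hle k); apply: Cmod_ge_0.
  exact: (ex_series_scal_l (K := R_AbsRing) (V := R_NormedModule)).
have Hs s : (Cmod (s - s0) <= r)%R ->
    cseries (fun n => Cseries (fun k => a k n) * (s - s0) ^ n) (Cseries (fun k => f k s)) /\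
    cseries (fun k => f k s) (Cseries (fun k => f k s)).
  move=> Hsr.
  have HM k K : (rsum (fun n => Cmod (a k n * (s - s0) ^ n)) K <= B k)%R.
    apply: Rle_trans (rsum_le _ _) (proj1 (Ha k) K) => n.
    rewrite Cmod_mult Cmod_pow; apply: Rmult_le_compat_l; first exact: Cmod_ge_0.
    by apply: pow_incr; split; first exact: Cmod_ge_0.
  have [F1 [F2 F3]] := cseries_Fubini HM exB.
  have E : Cseries (fun k => Cseries (fun n => a k n * (s - s0) ^ n)) = Cseries (fun k => f k s).
    by apply: Cseries_ext => k; apply: Cseries_unique; apply: (proj2 (Ha k)).
  rewrite E in F1 F2; split.
    apply: cseries_ext F1 => n; apply: Cseries_unique.
    rewrite Cmult_comm; apply: cseries_ext (cseries_scal ((s - s0) ^ n) (Hcol n)) => k.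
    exact: Cmult_comm.
  by apply: cseries_ext F2 => k; apply: Cseries_unique; apply: (proj2 (Ha k)).
split; last by move=> s /Hs [].
exists (fun n => Cseries (fun k => a k n)); split; last by move=> s /Hs [].
move=> K.
pose t k := rsum (fun n => Cmod (a k n) * r ^ n)%R K.
have t0 k : (0 <= t k <= B k)%R.
  split; last exact: (proj1 (Ha k)).
  by apply: rsum_ge0 => n; apply: Rmult_le_pos; [apply: Cmod_ge_0 | apply: Rpow_ge0; lra].
apply: (Rle_trans _ (Series t)); last exact: Series_le.
have ext : ex_series t.
  apply: (ex_series_le (V := R_CompleteNormedModule) _ B) => // k.
  by rewrite /norm /= /abs /= Rabs_pos_eq; have := t0 k; lra.
have Hlim := fun n => proj1 (cseries_eps _ _) (Hcol n).
(* The norm bound is a semicontinuity argument: an excess [d] in the limit coefficients would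
   already show in the partial sum over [k <= J] for a suitable [J], whose truncated norm is at most
   [Series t]. *)
apply: Rnot_lt_le => Hlt.
pose d := (rsum (fun n => Cmod (Cseries (fun k => a k n)) * r ^ n) K - Series t)%R.
have Hd : (0 < d)%R by rewrite /d; lra.
have [J HJ] : exists J, (rsum (fun n => Cmod (Cseries (fun k => a k n)) * r ^ n)%R K
    < rsum (fun n => Cmod (csum (fun k => a k n) J) * r ^ n)%R K + d)%R.
  have H2 : forall L (e : R), (0 < e)%R -> exists J0, forall J, (J0 <= J)%N ->
     (rsum (fun n => Cmod (Cseries (fun k => a k n)) * r ^ n)%R L
    < rsum (fun n => Cmod (csum (fun k => a k n) J) * r ^ n)%R L + e)%R.
    have H3 n (e : R) : (0 < e)%R -> exists J0, forall J, (J0 <= J)%N ->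
      (Cmod (Cseries (fun k => a k n)) * r ^ n < Cmod (csum (fun k => a k n) J) * r ^ n + e)%R.
      move=> He; have rn : (0 < r ^ n)%R by apply: pow_lt.
      have [J0 HJ0] := Hlim n (e / r ^ n)%R ltac:(by apply: Rdiv_lt_0_compat).
      exists J0 => J /HJ0 HJ.
      have Ht : (Cmod (Cseries (fun k => a k n)) <= Cmod (csum (fun k => a k n) J) +
         Cmod (csum (fun k => a k n) J - Cseries (fun k => a k n)))%R.
        rewrite -(Cmod_opp (_ - _)).
        by apply: Rle_trans (Cmod_triangle _ _); apply: Req_le; f_equal; ring.
      have : (e / r ^ n * r ^ n = e)%R by field; lra.
      nra.
    elim=> [|L IH] e He.
      by have [J0 HJ0] := H3 0%N e He; exists J0 => J /HJ0; rewrite !rsum0.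
    have [J1 HJ1] := IH (e / 2)%R ltac:(lra).
    have [J2 HJ2] := H3 L.+1 (e / 2)%R ltac:(lra).
    exists (J1 + J2)%N => J HJ; rewrite !rsumS.
    by have := HJ1 J ltac:(lia); have := HJ2 J ltac:(lia); lra.
  by have [J0 HJ0] := H2 K d Hd; exists J0; apply: HJ0.
have : (rsum (fun n => Cmod (csum (fun k => a k n) J) * r ^ n)%R K <= Series t)%R.
  apply: (Rle_trans _ (rsum t J)); last by apply: rsum_le_Series => // k; apply: (proj1 (t0 k)).
  rewrite /t rsum_swap; apply: rsum_le => n.
  rewrite (rsum_ext (v := fun i => r ^ n * Cmod (a i n))%R); last by move=> i; ring.
  rewrite rsum_mulr Rmult_comm; apply: Rmult_le_compat_l; first by apply: Rpow_ge0; lra.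
  exact: Cmod_csum.
rewrite /d in HJ; lra.
Qed.

Lemma majorized_plus s0 r B1 B2 f g :
  (0 <= r)%R -> majorized s0 r B1 f -> majorized s0 r B2 g ->
  majorized s0 r (B1 + B2) (fun s => f s + g s).
Proof.
move=> Hr [a [Ha Hsa]] [b [Hb Hsb]]; exists (fun n => a n + b n); split.
  move=> K; have := Ha K; have := Hb K.
  have : (rsum (fun n => Cmod (a n + b n) * r ^ n) K <=
     rsum (fun n => Cmod (a n) * r ^ n) K + rsum (fun n => Cmod (b n) * r ^ n) K)%R.
    elim: K => [|K IH]; first by rewrite !rsum0 /=; have := Cmod_triangle (a 0%N) (b 0%N); lra.
    rewrite !rsumS; have := Cmod_triangle (a K.+1) (b K.+1).
    by have := Rpow_ge0 K.+1 Hr; nra.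
  lra.
move=> s Hs; apply: cseries_ext (cseries_plus (Hsa s Hs) (Hsb s Hs)) => n; ring.
Qed.

Lemma majorized_scal s0 r B f (c : C) :
  majorized s0 r B f -> majorized s0 r (Cmod c * B) (fun s => c * f s).
Proof.
move=> [a [Ha Hsa]]; exists (fun n => c * a n); split.
  move=> K; rewrite (rsum_ext (v := fun n => Cmod c * (Cmod (a n) * r ^ n))%R).
    by rewrite rsum_mulr; apply: Rmult_le_compat_l (Cmod_ge_0 _) (Ha K).
  by move=> n; rewrite Cmod_mult; ring.
move=> s Hs; apply: cseries_ext (cseries_scal c (Hsa s Hs)) => n; ring.
Qed.

(** The product is the series of the functions [a n * ((s - s0) ^ n * g s)], each a shifted multiple
    of [g]; submultiplicativity follows without rearranging a Cauchy product. *)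
Lemma majorized_mult s0 r B1 B2 f g : (0 < r)%R ->
  majorized s0 r B1 f -> majorized s0 r B2 g ->
  majorized s0 r (B1 * B2) (fun s => f s * g s).
Proof.
move=> Hr [a [Ha Hsa]] Hg.
have B20 : (0 <= B2)%R by apply: majorized_ge0 Hg; lra.
have Hpos n : (0 <= Cmod (a n) * r ^ n)%R.
  by apply: Rmult_le_pos; [apply: Cmod_ge_0 | apply: Rpow_ge0; lra].
have [Hex Hle] := ex_series_nonneg_bound Hpos Ha.
have HB : ex_series (fun n => B2 * (Cmod (a n) * r ^ n))%R.
  exact: (ex_series_scal_l (K := R_AbsRing) (V := R_NormedModule)).
have Hn n : majorized s0 r (B2 * (Cmod (a n) * r ^ n)) (fun s => a n * ((s - s0) ^ n * g s)).
  apply: majorized_le (majorized_scal (a n) (majorized_monomial n (Rlt_le _ _ Hr) Hg)).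
  by apply: Req_le; ring.
have [H1 H2] := majorized_series Hr Hn HB.
apply: majorized_le; last first.
  apply: majorized_ext H1 => s Hs.
  apply: Cseries_unique; rewrite Cmult_comm.
  by apply: cseries_ext (cseries_scal (g s) (Hsa s Hs)) => n; ring.
rewrite Series_scal_l Rmult_comm; exact: Rmult_le_compat_r.
Qed.

Lemma majorized_id s0 r : (0 < r)%R -> majorized s0 r (Cmod s0 + r) (fun s => s).
Proof.
move=> Hr.
have H0 : (0 <= r)%R by lra.
have := majorized_plus H0 (majorized_const s0 r s0)
  (majorized_monomial 1 H0 (majorized_const s0 r 1)).
rewrite Cmod_1 Rmult_1_r pow_1; apply: majorized_ext => s _ /=; ring.
Qed.

Lemma majorized_affine s0 r B f (c d : C) :
  majorized (c * s0 + d) (Cmod c * r) B f -> majorized s0 r B (fun s => f (c * s + d)).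
Proof.
move=> [a [Ha Hs]]; exists (fun n => a n * c ^ n); split.
  move=> K; apply: Rle_trans (Ha K); apply: Req_le; apply: rsum_ext => n.
  by rewrite Cmod_mult Cmod_pow Rpow_mult_distr; ring.
move=> s Hsr.
have E : c * s + d - (c * s0 + d) = c * (s - s0) by ring.
have := Hs (c * s + d); rewrite E Cmod_mult => H.
apply: cseries_ext (H _) => [n|]; first by rewrite Cpow_mult_l; ring.
by apply: Rmult_le_compat_l (Cmod_ge_0 _) Hsr.
Qed.

Lemma majorized_pow s0 r B f n : (0 < r)%R ->
  majorized s0 r B f -> majorized s0 r (B ^ n) (fun s => f s ^ n).
Proof.
move=> Hr Hf; elim: n => [|n IH] /=.
  by have := majorized_const s0 r 1; rewrite Cmod_1.
exact: majorized_mult.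
Qed.

Lemma majorized_recenter s0 s1 r r1 B f :
  (0 < r1)%R -> (Cmod (s1 - s0) + r1 <= r)%R ->
  majorized s0 r B f -> majorized s1 r1 B f.
Proof.
move=> Hr1 Hr [a [Ha Hs]].
have Hr0 : (0 <= r)%R by have := Cmod_ge_0 (s1 - s0); lra.
have Hlin : majorized s1 r1 r (fun s => s - s0).
  have H1 := Rlt_le _ _ Hr1.
  have := majorized_plus H1 (majorized_const s1 r1 (s1 - s0))
    (majorized_monomial 1 H1 (majorized_const s1 r1 1)).
  rewrite Cmod_1 Rmult_1_r pow_1 => Hm.
  apply: majorized_le Hr _; apply: majorized_ext Hm => s _ /=; ring.
have Hpos n : (0 <= Cmod (a n) * r ^ n)%R.
  by apply: Rmult_le_pos; [apply: Cmod_ge_0 | apply: Rpow_ge0].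
have [Hex Hle] := ex_series_nonneg_bound Hpos Ha.
have [H1 _] := majorized_series Hr1
  (fun n => majorized_scal (a n) (majorized_pow n Hr1 Hlin)) Hex.
apply: majorized_le Hle _; apply: majorized_ext H1 => s Hsr.
apply: Cseries_unique; apply: Hs.
have -> : s - s0 = (s1 - s0) + (s - s1) by ring.
apply: Rle_trans (Cmod_triangle _ _) _; lra.
Qed.

Lemma pow_n_Cpow (z : C) n : @pow_n C_Ring z n = z ^ n.
Proof. by elim: n => [|n IH] //=; rewrite IH. Qed.

Lemma Cpseries_cseries (a : nat -> C) z l :
  @is_pseries C_AbsRing C_NormedModule a z l <-> cseries (fun n => a n * z ^ n) l.
Proof.
rewrite cseries_is_series /is_pseries; split; apply: is_series_ext => n;
  rewrite pow_n_Cpow; exact: Cmult_comm.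
Qed.

Lemma geom_partial_bound (q : R) K : (0 <= q < 1)%R -> (rsum (fun n => q ^ n) K <= / (1 - q))%R.
Proof.
move=> Hq; have H : is_series (fun n => q ^ n)%R (/ (1 - q))%R.
  by apply: is_series_geom; rewrite Rabs_pos_eq; lra.
rewrite -(is_series_unique _ _ H); apply: rsum_le_Series; last by exists (/ (1 - q))%R.
by move=> n; apply: Rpow_ge0; lra.
Qed.

Lemma analytic_at_majorized F s0 :
  analytic_at F s0 <-> exists r B, (0 < r)%R /\ majorized s0 r B F.
Proof.
split; last first.
  move=> [r [B [Hr [a [Ha Hs]]]]]; exists a, r; split => // s Hsr.
  by apply/Cpseries_cseries; apply: Hs; lra.
move=> [a [r [Hr Hs]]].
have {Hs} Hs s : (Cmod (s - s0) < r)%R -> cseries (fun n => a n * (s - s0) ^ n) (F s).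
  by move=> /Hs /Cpseries_cseries.
(* Convergence at distance [r / 2] bounds the terms by some [B]; at distance [r / 4] they are then
   at most [B / 2 ^ n], so the norm is at most [2 * B]. *)
pose r2 := (r / 2)%R; pose r4 := (r / 4)%R.
have [B HB] : exists B, forall n, (Cmod (a n * (RtoC r2) ^ n) <= B)%R.
  have := Hs (s0 + RtoC r2).
  rewrite (_ : s0 + r2 - s0 = r2); last ring.
  rewrite Cmod_RtoC_pos /r2; last lra.
  by move=> H; apply: cseries_terms0 (H _); lra.
have HB' n : (Cmod (a n) * r4 ^ n <= B * (/2) ^ n)%R.
  have := HB n; rewrite Cmod_mult Cmod_pow Cmod_RtoC_pos /r2; last lra.
  rewrite /r4 (_ : r / 4 = r / 2 * / 2)%R; last lra.
  rewrite Rpow_mult_distr -Rmult_assoc => H.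
  by apply: Rmult_le_compat_r H; apply: Rpow_ge0; lra.
exists r4, (B * / (1 - / 2))%R; split; first by rewrite /r4; lra.
exists a; split; last by move=> s Hsr; apply: Hs; rewrite /r4 in Hsr; lra.
move=> K; apply: Rle_trans (rsum_le _ HB') _; rewrite rsum_mulr.
apply: Rmult_le_compat_l; last by apply: geom_partial_bound; lra.
by apply: Rle_trans (HB 0%N); apply: Cmod_ge_0.
Qed.

Lemma analytic_at_ext F G s0 (r : R) : (0 < r)%R ->
  (forall s, (Cmod (s - s0) < r)%R -> F s = G s) -> analytic_at F s0 -> analytic_at G s0.
Proof.
move=> Hr H [a [r1 [Hr1 Hs]]]; exists a, (Rmin r r1); split; first exact: Rmin_pos.
move=> s Hsr; have := Rmin_l r r1; have := Rmin_r r r1 => H1 H2.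
by rewrite -H; [apply: Hs |]; lra.
Qed.

Lemma analytic_at_common F G s0 : analytic_at F s0 -> analytic_at G s0 ->
  exists r B, (0 < r)%R /\ majorized s0 r B F /\ majorized s0 r B G.
Proof.
move=> /analytic_at_majorized [r1 [B1 [H1 M1]]] /analytic_at_majorized [r2 [B2 [H2 M2]]].
exists (Rmin r1 r2), (Rmax B1 B2); split; first exact: Rmin_pos.
have Hp := Rmin_pos _ _ H1 H2.
by split; [apply: majorized_le (Rmax_l _ _) _; apply: majorized_radius M1 |
  apply: majorized_le (Rmax_r _ _) _; apply: majorized_radius M2];
  split; try lra; [apply: Rmin_l | apply: Rmin_r].
Qed.

Lemma analytic_at_const (c : C) s0 : analytic_at (fun _ => c) s0.
Proof.
by apply/analytic_at_majorized; exists 1%R, (Cmod c); split; [lra | apply: majorized_const].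
Qed.

Lemma analytic_at_id s0 : analytic_at (fun s => s) s0.
Proof.
apply/analytic_at_majorized; exists 1%R, (Cmod s0 + 1)%R.
by split; [lra | apply: majorized_id; lra].
Qed.

Lemma analytic_at_plus F G s0 : analytic_at F s0 -> analytic_at G s0 ->
  analytic_at (fun s => F s + G s) s0.
Proof.
move=> HF HG; have [r [B [Hr [M1 M2]]]] := analytic_at_common HF HG.
apply/analytic_at_majorized; exists r, (B + B)%R; split => //.
by apply: majorized_plus => //; lra.
Qed.

Lemma analytic_at_mult F G s0 : analytic_at F s0 -> analytic_at G s0 ->
  analytic_at (fun s => F s * G s) s0.
Proof.
move=> HF HG; have [r [B [Hr [M1 M2]]]] := analytic_at_common HF HG.
by apply/analytic_at_majorized; exists r, (B * B)%R; split => //; apply: majorized_mult.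
Qed.

Lemma analytic_at_opp F s0 : analytic_at F s0 -> analytic_at (fun s => - F s) s0.
Proof.
move=> HF; apply: (analytic_at_ext (r := 1%R)
  (F := fun s => RtoC (-1) * F s)); [lra | by move=> s _; ring |].
by apply: analytic_at_mult => //; apply: analytic_at_const.
Qed.

Lemma analytic_at_minus F G s0 : analytic_at F s0 -> analytic_at G s0 ->
  analytic_at (fun s => F s - G s) s0.
Proof. by move=> HF HG; apply: analytic_at_plus => //; apply: analytic_at_opp. Qed.

Lemma analytic_at_pow F s0 n : analytic_at F s0 -> analytic_at (fun s => F s ^ n) s0.
Proof.
move=> HF; elim: n => [|n IH] /=; first exact: analytic_at_const.
exact: analytic_at_mult.
Qed.

Lemma analytic_at_csum (F : nat -> C -> C) s0 n :
  (forall i, (i <= n)%N -> analytic_at (F i) s0) ->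
  analytic_at (fun s => csum (fun i => F i s) n) s0.
Proof.
elim: n => [|n IH] H.
  apply: (analytic_at_ext (r := 1%R) (F := F 0%N)); [lra | by move=> s _; rewrite csum0 | exact: H].
apply: (analytic_at_ext (r := 1%R) (F := fun s => csum (fun i => F i s) n + F n.+1 s)); first lra.
  by move=> s _; rewrite csumS.
apply: analytic_at_plus; last exact: H.
by apply: IH => i Hi; apply: H; lia.
Qed.

Lemma analytic_at_affine F (c d s0 : C) : c <> 0 ->
  analytic_at F (c * s0 + d) -> analytic_at (fun s => F (c * s + d)) s0.
Proof.
move=> Hc /analytic_at_majorized [r [B [Hr M]]].
have Hp := proj1 (Cmod_gt_0 c) Hc.
apply/analytic_at_majorized; exists (r / Cmod c)%R, B.
split; first exact: Rdiv_lt_0_compat.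
apply: majorized_affine.
by rewrite (_ : Cmod c * (r / Cmod c) = r)%R //; field; lra.
Qed.

Lemma analytic_at_open F s0 : analytic_at F s0 ->
  exists r, (0 < r)%R /\ forall s1, (Cmod (s1 - s0) < r)%R -> analytic_at F s1.
Proof.
move=> /analytic_at_majorized [r [B [Hr M]]]; exists r; split => // s1 Hs1.
apply/analytic_at_majorized; exists (r - Cmod (s1 - s0))%R, B; split; first lra.
by apply: majorized_recenter M; lra.
Qed.

Lemma Cpow_1l n : (RtoC 1) ^ n = 1.
Proof. by elim: n => //= n ->; ring. Qed.

Lemma cseries_geom (z : C) : (Cmod z < 1)%R -> cseries (fun n => z ^ n) (/ (1 - z)).
Proof.
move=> Hz.
have Hnz : 1 - z <> 0.
  move=> E; have : z = 1 by rewrite -(Cplus_0_r z) -E; ring.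
  by move=> Ez; move: Hz; rewrite Ez Cmod_1; lra.
have Hp := proj1 (Cmod_gt_0 _) Hnz.
have E n : csum (fun n => z ^ n) n - / (1 - z) = - (z ^ n.+1 / (1 - z)).
  elim: n => [|n IH]; first by rewrite csum0 /=; field.
  have -> : csum (fun n => z ^ n) n.+1 - / (1 - z) = (csum (fun n => z ^ n) n - / (1 - z)) + z ^ n.+1.
    by rewrite csumS; ring.
  by rewrite IH /=; field.
apply/cseries_eps => eps He.
have [N HN] := pow_lt_1_zero (Cmod z) ltac:(by rewrite Rabs_pos_eq //; apply: Cmod_ge_0)
  (eps * Cmod (1 - z))%R ltac:(by apply: Rmult_lt_0_compat).
exists N => n Hn; rewrite E Cmod_opp Cmod_div // Cmod_pow.
have := HN n.+1 ltac:(lia); rewrite Rabs_pos_eq; last by apply: Rpow_ge0; apply: Cmod_ge_0.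
move=> H; apply: (Rmult_lt_reg_r (Cmod (1 - z))) => //.
by rewrite /Rdiv Rmult_assoc Rinv_l; lra.
Qed.

Lemma analytic_at_inv (c s0 : C) : s0 <> c -> analytic_at (fun s => / (s - c)) s0.
Proof.
move=> Hne.
have Hnz : c - s0 <> 0.
  by move=> E; apply: Hne; rewrite -(Cplus_0_r s0) -E; ring.
have Hp := proj1 (Cmod_gt_0 _) Hnz.
exists (fun n => - / (c - s0) ^ n.+1), (Cmod (c - s0)); split => // s Hs.
apply/Cpseries_cseries.
have Hz : (Cmod ((s - s0) / (c - s0)) < 1)%R.
  rewrite Cmod_div //; apply: (Rmult_lt_reg_r (Cmod (c - s0))) => //.
  by rewrite /Rdiv Rmult_assoc Rinv_l; lra.
have Hsc : s - c <> 0.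
  move=> E; have E2 : s - s0 = c - s0 by rewrite -(Cplus_0_r (c - s0)) -E; ring.
  by move: Hs; rewrite E2; lra.
have := cseries_scal (- / (c - s0)) (cseries_geom Hz).
have -> : - / (c - s0) * / (1 - (s - s0) / (c - s0)) = / (s - c).
  field; split => //.
  split => // E; apply: Hsc.
  have -> : s - c = - (c - s0 - (s - s0)) by ring.
  by rewrite E; ring.
apply: cseries_ext => n.
by rewrite /Cdiv Cpow_mult_l /= Cpow_inv //; field; split => //; apply: Cpow_nz.
Qed.

(** * Zeros and meromorphic continuation *)

(** Exposes the coefficients that [majorized] hides, because dividing out a zero at [s0] is a shift
    of the coefficient sequence. *)
Definition has_coefs (s0 : C) (r : R) (a : nat -> C) (f : C -> C) : Prop :=
  (exists B, forall K, (rsum (fun n => Cmod (a n) * r ^ n) K <= B)%R) /\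
  forall s, (Cmod (s - s0) <= r)%R -> cseries (fun n => a n * (s - s0) ^ n) (f s).

Lemma has_coefs_shift s0 r a f : (0 < r)%R -> has_coefs s0 r a f ->
  exists g, has_coefs s0 r (fun n => a n.+1) g /\
    forall s, (Cmod (s - s0) <= r)%R -> f s = a 0%N + (s - s0) * g s.
Proof.
move=> Hr [[B HB] Hs].
pose g s := Cseries (fun n => a n.+1 * (s - s0) ^ n).
have HB' K : (rsum (fun n => Cmod (a n.+1) * r ^ n) K <= B / r)%R.
  apply: (Rmult_le_reg_l r) => //.
  rewrite -rsum_mulr (_ : r * (B / r) = B)%R; last by field; lra.
  apply: Rle_trans (HB K.+1).
  have : (rsum (fun i => r * (Cmod (a i.+1) * r ^ i)) K + Cmod (a 0%N) =
     rsum (fun n => Cmod (a n) * r ^ n) K.+1)%R.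
    elim: K => [|K IH]; first by rewrite rsumS !rsum0 /=; ring.
    rewrite rsumS [RHS]rsumS -IH /=; ring.
  by have := Cmod_ge_0 (a 0%N); lra.
have Hg : has_coefs s0 r (fun n => a n.+1) g.
  split; first by exists (B / r)%R.
  move=> s Hsr; apply: (proj1 (cseries_abs (B := (B / r)%R) _)) => K.
  apply: Rle_trans (rsum_le _ _) (HB' K) => n.
  rewrite Cmod_mult Cmod_pow; apply: Rmult_le_compat_l (Cmod_ge_0 _) _.
  by apply: pow_incr; split => //; apply: Cmod_ge_0.
exists g; split => // s Hsr.
apply: cseries_lim_unique (Hs s Hsr) _.
have := cseries_plus (cseries_single 0 (a 0%N))
  (cseries_shift 1 (cseries_scal (s - s0) (proj2 Hg s Hsr))).
apply: cseries_ext => -[|n] /=; first by rewrite /=; ring.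
by rewrite subn1 /=; ring.
Qed.

Lemma has_coefs_analytic s0 r a f : (0 < r)%R -> has_coefs s0 r a f -> analytic_at f s0.
Proof. by move=> Hr [[B HB] Hs]; apply/analytic_at_majorized; exists r, B; split => //; exists a. Qed.

Lemma analytic_has_coefs f s0 : analytic_at f s0 ->
  exists r a, (0 < r)%R /\ has_coefs s0 r a f.
Proof.
move=> /analytic_at_majorized [r [B [Hr [a [Ha Hs]]]]].
by exists r, a; split => //; split => //; exists B.
Qed.

Lemma has_coefs_at0 s0 r a f : (0 < r)%R -> has_coefs s0 r a f -> f s0 = a 0%N.
Proof.
move=> Hr /(has_coefs_shift Hr) [g [_ H]]; rewrite H; first ring.
by rewrite (_ : s0 - s0 = 0) ?Cmod_0; [lra | ring].
Qed.

Lemma analytic_divide f s0 : analytic_at f s0 ->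
  exists g r, analytic_at g s0 /\ (0 < r)%R /\
    forall s, (Cmod (s - s0) <= r)%R -> f s = f s0 + (s - s0) * g s.
Proof.
move=> /analytic_has_coefs [r [a [Hr Ha]]].
have [g [Hg E]] := has_coefs_shift Hr Ha.
exists g, r; split; first exact: has_coefs_analytic Hg.
by split => // s Hs; rewrite (has_coefs_at0 Hr Ha); apply: E.
Qed.

Lemma analytic_locally_bounded f s0 : analytic_at f s0 ->
  exists B r, (0 < r)%R /\ (0 <= B)%R /\ forall s, (Cmod (s - s0) <= r)%R -> (Cmod (f s) <= B)%R.
Proof.
move=> /analytic_at_majorized [r [B [Hr M]]]; exists B, r; split => //.
split; first by apply: majorized_ge0 M; lra.
by move=> s Hs; apply: majorized_bound M Hs.
Qed.

Lemma analytic_continuous f s0 (eps : R) : analytic_at f s0 -> (0 < eps)%R ->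
  exists r, (0 < r)%R /\ forall s, (Cmod (s - s0) < r)%R -> (Cmod (f s - f s0) < eps)%R.
Proof.
move=> /analytic_divide [g [r [/analytic_locally_bounded [B [r' [Hr' [HB Hg]]]] [Hr E]]]] He.
have Hd : (0 < eps / (B + 1))%R by apply: Rdiv_lt_0_compat; lra.
exists (Rmin (eps / (B + 1)) (Rmin r r')); split; first by repeat apply: Rmin_pos.
move=> s Hs.
have := Rmin_l (eps / (B + 1)) (Rmin r r'); have := Rmin_r (eps / (B + 1)) (Rmin r r').
have := Rmin_l r r'; have := Rmin_r r r' => h1 h2 h3 h4.
rewrite E; last lra.
have -> : f s0 + (s - s0) * g s - f s0 = (s - s0) * g s by ring.
rewrite Cmod_mult.
have Hb := Hg s ltac:(lra); have Hp := Cmod_ge_0 (s - s0); have Hp' := Cmod_ge_0 (g s).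
have : (eps / (B + 1) * (B + 1) = eps)%R by field; lra.
nra.
Qed.

Lemma analytic_nonzero_near f s0 : analytic_at f s0 -> f s0 <> 0 ->
  exists r, (0 < r)%R /\ forall s, (Cmod (s - s0) < r)%R -> f s <> 0.
Proof.
move=> Hf Hn; have Hp := proj1 (Cmod_gt_0 _) Hn.
have [r [Hr H]] := analytic_continuous Hf Hp.
exists r; split => // s /H; move=> Hlt E; move: Hlt; rewrite E.
by rewrite (_ : 0 - f s0 = - f s0) ?Cmod_opp; [lra | ring].
Qed.

(** Induction on the index of a nonzero coefficient: as long as the constant coefficient vanishes,
    one factor [s - s0] is split off. *)
Lemma analytic_zero_or_factor f s0 : analytic_at f s0 ->
  (exists r, (0 < r)%R /\ forall s, (Cmod (s - s0) < r)%R -> f s = 0) \/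
  (exists p g r, analytic_at g s0 /\ g s0 <> 0 /\ (0 < r)%R /\
     forall s, (Cmod (s - s0) < r)%R -> f s = (s - s0) ^ p * g s).
Proof.
move=> /analytic_has_coefs [r [a [Hr Ha]]].
have [Hz|[p Hp]] : (forall n, a n = 0) \/ exists p, a p <> 0.
  have [E|E] := excluded_middle_informative (exists p, a p <> 0); first by right.
  by left => n; have [//|En] := excluded_middle_informative (a n = 0); case: E; exists n.
  left; exists r; split => // s Hs.
  apply: cseries_lim_unique (proj2 Ha s (Rlt_le _ _ Hs)) _.
  by apply: cseries_ext cseries0 => n; rewrite Hz; ring.
right; elim: p f a Ha Hp => [|p IH] f a Ha Hp.
  exists 0%N, f, r; split; first exact: has_coefs_analytic Ha.
  by rewrite (has_coefs_at0 Hr Ha); split => //; split => // s _ /=; ring.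
have [E0|N0] := excluded_middle_informative (a 0%N = 0); last first.
  exists 0%N, f, r; split; first exact: has_coefs_analytic Ha.
  by rewrite (has_coefs_at0 Hr Ha); split => //; split => // s _ /=; ring.
have [g [Hg E]] := has_coefs_shift Hr Ha.
have [q [g' [r' [Hg' [Hn [Hr' E']]]]]] := IH g _ Hg Hp.
exists q.+1, g', (Rmin r r'); split => //; split => //; split; first exact: Rmin_pos.
move=> s Hs; have := Rmin_l r r'; have := Rmin_r r r' => h1 h2.
by rewrite E ?E' ?E0 /=; [ring | lra | lra].
Qed.

Lemma Csub_neq0 (s s0 : C) : (0 < Cmod (s - s0))%R -> s - s0 <> 0.
Proof. by move=> H E; move: H; rewrite E Cmod_0; lra. Qed.

Lemma analytic_zeros_limit_point f s0 : analytic_at f s0 ->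
  (forall d, (0 < d)%R -> exists s, (0 < Cmod (s - s0) < d)%R /\ f s = 0) ->
  exists r, (0 < r)%R /\ forall s, (Cmod (s - s0) < r)%R -> f s = 0.
Proof.
move=> /analytic_zero_or_factor [//|[p [g [r [Hg [Hn [Hr E]]]]]]] Hacc.
have [r' [Hr' Hnz]] := analytic_nonzero_near Hg Hn.
have [s [[Hs1 Hs2] Hs3]] := Hacc (Rmin r r') (Rmin_pos _ _ Hr Hr').
have := Rmin_l r r'; have := Rmin_r r r' => h1 h2.
have H1 := E s ltac:(lra); rewrite Hs3 in H1.
have H2 : (s - s0) ^ p * g s <> 0.
  by apply: Cmult_neq_0; [apply: Cpow_nz; apply: Csub_neq0 | apply: Hnz; lra].
by case: H2.
Qed.

(* A punctured-disc version of "analytic or pole" that, unlike [meromorphic],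
   tolerates wrong values at removable singularities. *)
Definition weakly_meromorphic_at (F : C -> C) (s0 : C) : Prop :=
  exists m K r, analytic_at K s0 /\ (0 < r)%R /\
    forall s, (0 < Cmod (s - s0) < r)%R -> F s * (s - s0) ^ m = K s.

Definition agree_near (F G : C -> C) (s0 : C) : Prop :=
  exists r, (0 < r)%R /\ forall s, (0 < Cmod (s - s0) < r)%R -> F s = G s.

Lemma analytic_weakly_meromorphic F s0 : analytic_at F s0 -> weakly_meromorphic_at F s0.
Proof. by move=> H; exists 0%N, F, 1%R; split => //; split; [lra | move=> s _ /=; ring]. Qed.

Lemma meromorphic_weakly F s0 : meromorphic F -> weakly_meromorphic_at F s0.
Proof.
move=> /(_ s0) [H|[m [g [r [_ [Hg [_ [Hr E]]]]]]]]; first exact: analytic_weakly_meromorphic.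
exists m, g, r; split => //; split => // s Hs.
by rewrite E //; field; apply: Cpow_nz; apply: Csub_neq0; lra.
Qed.

Lemma weakly_meromorphic_ext F G s0 : agree_near F G s0 ->
  weakly_meromorphic_at F s0 -> weakly_meromorphic_at G s0.
Proof.
move=> [r [Hr E]] [m [K [r' [HK [Hr' E']]]]].
exists m, K, (Rmin r r'); split => //; split; first exact: Rmin_pos.
move=> s Hs; have := Rmin_l r r'; have := Rmin_r r r' => h1 h2.
by rewrite -E ?E' //; lra.
Qed.

Lemma weakly_meromorphic_plus F G s0 : weakly_meromorphic_at F s0 ->
  weakly_meromorphic_at G s0 -> weakly_meromorphic_at (fun s => F s + G s) s0.
Proof.
move=> [m [K [r [HK [Hr E]]]]] [m' [K' [r' [HK' [Hr' E']]]]].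
have Hid : forall n, analytic_at (fun s => (s - s0) ^ n) s0.
  by move=> n; apply: analytic_at_pow; apply: analytic_at_minus;
    [apply: analytic_at_id | apply: analytic_at_const].
exists (m + m')%N, (fun s => K s * (s - s0) ^ m' + K' s * (s - s0) ^ m), (Rmin r r').
split; first by apply: analytic_at_plus; apply: analytic_at_mult.
split; first exact: Rmin_pos.
move=> s Hs; have := Rmin_l r r'; have := Rmin_r r r' => h1 h2.
by rewrite Cpow_add_r -E -?E'; [ring | lra | lra].
Qed.

Lemma weakly_meromorphic_mult F G s0 : analytic_at F s0 ->
  weakly_meromorphic_at G s0 -> weakly_meromorphic_at (fun s => F s * G s) s0.
Proof.
move=> HF [m [K [r [HK [Hr E]]]]]; exists m, (fun s => F s * K s), r.
split; first exact: analytic_at_mult.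
by split => // s Hs; rewrite -E //; ring.
Qed.

Lemma weakly_meromorphic_csum (F : nat -> C -> C) s0 n :
  (forall i, (i <= n)%N -> weakly_meromorphic_at (F i) s0) ->
  weakly_meromorphic_at (fun s => csum (fun i => F i s) n) s0.
Proof.
elim: n => [|n IH] H.
  apply: (weakly_meromorphic_ext (F := F 0%N)); last exact: H.
  by exists 1%R; split; [lra | move=> s _; rewrite csum0].
apply: (weakly_meromorphic_ext (F := fun s => csum (fun i => F i s) n + F n.+1 s)).
  by exists 1%R; split; [lra | move=> s _; rewrite csumS].
apply: weakly_meromorphic_plus; last exact: H.
by apply: IH => i Hi; apply: H; lia.
Qed.

Lemma weakly_meromorphic_affine F (c d s0 : C) : c <> 0 ->
  weakly_meromorphic_at F (c * s0 + d) -> weakly_meromorphic_at (fun s => F (c * s + d)) s0.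
Proof.
move=> Hc [m [K [r [HK [Hr E]]]]].
have Hp := proj1 (Cmod_gt_0 c) Hc.
exists m, (fun s => (/ c) ^ m * K (c * s + d)), (r / Cmod c)%R; split.
  by apply: analytic_at_mult; [apply: analytic_at_const | apply: analytic_at_affine].
split; first exact: Rdiv_lt_0_compat.
move=> s Hs.
have Ed : c * s + d - (c * s0 + d) = c * (s - s0) by ring.
rewrite -E Ed.
  by rewrite Cpow_mult_l Cpow_inv //; field; apply: Cpow_nz.
rewrite Cmod_mult; split; first by apply: Rmult_lt_0_compat; lra.
have : (r / Cmod c * Cmod c = r)%R by field; lra.
nra.
Qed.

(** Multiplied by both denominators, the difference of [F] and [G] becomes a function analytic at
    [s0] whose zeros accumulate there, hence zero nearby. *)
Lemma weakly_meromorphic_agree F G s0 :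
  weakly_meromorphic_at F s0 -> weakly_meromorphic_at G s0 ->
  (forall d, (0 < d)%R -> exists s, (0 < Cmod (s - s0) < d)%R /\ F s = G s) ->
  agree_near F G s0.
Proof.
move=> [m [K [r [HK [Hr E]]]]] [m' [K' [r' [HK' [Hr' E']]]]] Hacc.
have Hid : forall n, analytic_at (fun s => (s - s0) ^ n) s0.
  by move=> n; apply: analytic_at_pow; apply: analytic_at_minus;
    [apply: analytic_at_id | apply: analytic_at_const].
pose D s := K s * (s - s0) ^ m' - K' s * (s - s0) ^ m.
have HD : analytic_at D s0 by apply: analytic_at_minus; apply: analytic_at_mult.
have Hrr := Rmin_pos _ _ Hr Hr'.
have h1 := Rmin_l r r'; have h2 := Rmin_r r r'.
have ED s : (0 < Cmod (s - s0) < Rmin r r')%R -> D s = (F s - G s) * (s - s0) ^ (m + m').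
  by move=> Hs; rewrite /D -E -?E' ?Cpow_add_r; [ring | lra | lra].
have [|r2 [Hr2 Hz]] := analytic_zeros_limit_point HD.
  move=> d Hd; have [s [Hs Es]] := Hacc (Rmin d (Rmin r r')) (Rmin_pos _ _ Hd Hrr).
  have := Rmin_l d (Rmin r r'); have := Rmin_r d (Rmin r r') => h3 h4.
  by exists s; split; [lra | rewrite ED ?Es; [ring | lra]].
exists (Rmin r2 (Rmin r r')); split; first exact: Rmin_pos.
move=> s Hs; have := Rmin_l r2 (Rmin r r'); have := Rmin_r r2 (Rmin r r') => h3 h4.
have Hnz : (s - s0) ^ (m + m') <> 0 by apply: Cpow_nz; apply: Csub_neq0; lra.
apply/Ceq_minus.
have H := ED s ltac:(lra); rewrite Hz in H; last lra.
have -> : F s - G s = (F s - G s) * (s - s0) ^ (m + m') / (s - s0) ^ (m + m') by field.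
by rewrite -H; field.
Qed.

Lemma agree_near_open F G s0 : agree_near F G s0 ->
  exists r, (0 < r)%R /\ forall s, (Cmod (s - s0) < r)%R -> agree_near F G s.
Proof.
move=> [r [Hr E]]; exists r; split => // s1 Hs1.
have [E1|N1] := excluded_middle_informative (s1 = s0); first by rewrite E1; exists r.
have Hd : (0 < Cmod (s1 - s0))%R.
  by apply: (proj1 (Cmod_gt_0 _)) => E0; apply: N1; apply/Ceq_minus.
have Hm : (0 < Rmin (Cmod (s1 - s0)) (r - Cmod (s1 - s0)))%R by apply: Rmin_pos; lra.
exists (Rmin (Cmod (s1 - s0)) (r - Cmod (s1 - s0))); split => // s Hs.
have := Rmin_l (Cmod (s1 - s0)) (r - Cmod (s1 - s0)).
have := Rmin_r (Cmod (s1 - s0)) (r - Cmod (s1 - s0)) => h1 h2.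
apply: E; split.
  have : (Cmod (s1 - s0) <= Cmod (s - s0) + Cmod (s - s1))%R.
    rewrite -(Cmod_opp (s - s1)); apply: Rle_trans (Cmod_triangle _ _).
    by apply: Req_le; f_equal; ring.
  lra.
have : (Cmod (s - s0) <= Cmod (s - s1) + Cmod (s1 - s0))%R.
  by apply: Rle_trans (Cmod_triangle _ _); apply: Req_le; f_equal; ring.
lra.
Qed.

(* Continuation along the horizontal ray from [s0] to the right. *)
Lemma weakly_meromorphic_identity F G (sigma : R) :
  (forall s, weakly_meromorphic_at F s) -> (forall s, weakly_meromorphic_at G s) ->
  (forall s, (sigma < Re s)%R -> F s = G s) ->
  forall s0, agree_near F G s0.
Proof.
move=> HF HG HFG s0.
pose P t := agree_near F G (s0 + RtoC t).
pose S t := (0 <= t)%R /\ forall u, (t <= u)%R -> P u.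
have Hdist (t u : R) : Cmod (s0 + RtoC t - (s0 + RtoC u)) = Rabs (t - u).
  by rewrite -Cmod_R; f_equal; rewrite RtoC_minus; ring.
have HS0 : S (Rmax 0 (sigma - Re s0 + 1)).
  split; first exact: Rmax_l.
  move=> u Hu; have := Rmax_r 0 (sigma - Re s0 + 1) => h.
  exists 1%R; split; first lra.
  move=> s [_ Hs]; apply: HFG.
  have := re_le_Cmod (s - (s0 + RtoC u)).
  rewrite (_ : Re (s - (s0 + RtoC u)) = Re s - (Re s0 + u))%R // => /Rabs_le_between; lra.
(* Completeness provides suprema, so the parameter enters with its sign reversed: [- m] is the
   infimum of [S]. *)
have [m Hm] : {m | is_lub (fun x => S (- x)%R) m}.
  apply: completeness; first by exists 0%R => x [Hx _]; lra.
  by exists (- Rmax 0 (sigma - Re s0 + 1))%R; rewrite Ropp_involutive.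
case: Hm => Hub Hlub.
have Hm0 : (m <= 0)%R by apply: Hlub => x [Hx _]; lra.
have Habove t : (- m < t)%R -> P t.
  move=> Ht; have [//|Hn] := excluded_middle_informative (P t).
  have : (m <= - t)%R; last lra.
  apply: Hlub => x [Hx0 Hx]; apply: Rnot_lt_le => Hlt.
  by apply: Hn; apply: Hx; lra.
have HPm : P (- m)%R.
  apply: weakly_meromorphic_agree => // d Hd.
  have [r [Hr E]] := Habove (- m + d / 2)%R ltac:(lra).
  have Hmin := Rmin_pos _ _ Hr Hd.
  have h1 := Rmin_l r d; have h2 := Rmin_r r d.
  exists (s0 + RtoC (- m + d / 2 + Rmin r d / 4)%R); rewrite Hdist; split.
    by rewrite Rabs_pos_eq; lra.
  by apply: E; rewrite Hdist Rabs_pos_eq; lra.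
have [Em|Nm] := Req_dec m 0.
  by move: HPm; rewrite /P Em Ropp_0 (_ : s0 + 0 = s0) //; ring.
(* With [- m] positive, agreement persists on a disc around the point of parameter [- m] and pushes
   the infimum further left, a contradiction. *)
have [r [Hr Hop]] := agree_near_open HPm.
pose e := Rmin (r / 2) (- m).
have He : (0 < e)%R by apply: Rmin_pos; lra.
have h1 := Rmin_l (r / 2) (- m); have h2 := Rmin_r (r / 2) (- m).
have : (m + e <= m)%R; last lra.
apply: Hub; split; first by rewrite /e; lra.
move=> u Hu; have [Hle|Hlt] := Rle_lt_dec u (- m); last exact: Habove.
by apply: Hop; rewrite Hdist Rabs_left1 /e in Hu *; lra.
Qed.

Lemma agree_near_analytic F G s0 : analytic_at F s0 -> analytic_at G s0 ->
  agree_near F G s0 -> exists r, (0 < r)%R /\ forall s, (Cmod (s - s0) < r)%R -> F s = G s.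
Proof.
move=> HF HG [r [Hr E]].
have [|r' [Hr' Hz]] := analytic_zeros_limit_point (analytic_at_minus HF HG).
  move=> d Hd; have Hm := Rmin_pos _ _ Hr Hd.
  have h1 := Rmin_l r d; have h2 := Rmin_r r d.
  exists (s0 + RtoC (Rmin r d / 2)%R).
  have Ec : Cmod (s0 + RtoC (Rmin r d / 2)%R - s0) = (Rmin r d / 2)%R.
    rewrite (_ : _ - s0 = RtoC (Rmin r d / 2)%R); last ring.
    by rewrite Cmod_RtoC_pos; lra.
  by split; rewrite ?Ec; [lra | rewrite E ?Ec; [ring | lra]].
by exists r'; split => // s /Hz H; apply/Ceq_minus.
Qed.

(** At a pole of order [m > 0] the numerator [g] would agree near [s0] with [G s * (s - s0) ^ m],
    which vanishes at [s0], against [g s0 <> 0]. So [F] is analytic there and the agreement includes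
    the centre. *)
Lemma meromorphic_agree_analytic F G s0 : meromorphic F -> analytic_at G s0 ->
  agree_near F G s0 -> exists r, (0 < r)%R /\ forall s, (Cmod (s - s0) < r)%R -> F s = G s.
Proof.
move=> /(_ s0) [HF HG|[m [g [r [Hm [Hg [Hn [Hr E]]]]]]] HG [r' [Hr' E']]].
  exact: agree_near_analytic.
have Hid : analytic_at (fun s => G s * (s - s0) ^ m) s0.
  by apply: analytic_at_mult => //; apply: analytic_at_pow; apply: analytic_at_minus;
    [apply: analytic_at_id | apply: analytic_at_const].
have [|r2 [Hr2 E2]] := agree_near_analytic Hg Hid.
  exists (Rmin r r'); split; first exact: Rmin_pos.
  move=> s Hs; have := Rmin_l r r'; have := Rmin_r r r' => h1 h2.
  by rewrite -E' ?E; [field; apply: Cpow_nz; apply: Csub_neq0 | |]; lra.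
case: Hn; rewrite E2; last by rewrite (_ : s0 - s0 = 0) ?Cmod_0 //; ring.
by case: m Hm {E Hid E2} => // m _ /=; ring.
Qed.

Lemma weakly_meromorphic_analytic_near F s0 : weakly_meromorphic_at F s0 ->
  exists r, (0 < r)%R /\ forall s, (0 < Cmod (s - s0) < r)%R -> analytic_at F s.
Proof.
move=> [m [K [r [HK [Hr E]]]]].
have [r' [Hr' HK']] := analytic_at_open HK.
exists (Rmin r r'); split; first exact: Rmin_pos.
move=> s1 Hs1; have := Rmin_l r r'; have := Rmin_r r r' => h1 h2.
pose d := Rmin (Cmod (s1 - s0)) (r - Cmod (s1 - s0)).
have Hd : (0 < d)%R by apply: Rmin_pos; lra.
have h3 := Rmin_l (Cmod (s1 - s0)) (r - Cmod (s1 - s0)).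
have h4 := Rmin_r (Cmod (s1 - s0)) (r - Cmod (s1 - s0)).
apply: (analytic_at_ext Hd (F := fun s => K s * (/ (s - s0)) ^ m)).
  move=> s Hs.
  have Hs0 : (0 < Cmod (s - s0) < r)%R.
    rewrite /d in Hs; split.
      have : (Cmod (s1 - s0) <= Cmod (s - s0) + Cmod (s - s1))%R.
        rewrite -(Cmod_opp (s - s1)); apply: Rle_trans (Cmod_triangle _ _).
        by apply: Req_le; f_equal; ring.
      lra.
    have : (Cmod (s - s0) <= Cmod (s - s1) + Cmod (s1 - s0))%R.
      by apply: Rle_trans (Cmod_triangle _ _); apply: Req_le; f_equal; ring.
    lra.
  have Hnz := Csub_neq0 (proj1 Hs0).
  by rewrite -E // Cpow_inv //; field; apply: Cpow_nz.
apply: analytic_at_mult; first by apply: HK'; lra.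
apply: analytic_at_pow; apply: analytic_at_inv => E0.
by move: Hs1; rewrite E0 (_ : s0 - s0 = 0) ?Cmod_0; [lra | ring].
Qed.

Lemma agree_near_sym F G s0 : agree_near F G s0 -> agree_near G F s0.
Proof. by move=> [r [Hr E]]; exists r; split => // s Hs; rewrite E. Qed.

Lemma agree_near_trans F G H s0 : agree_near F G s0 -> agree_near G H s0 -> agree_near F H s0.
Proof.
move=> [r [Hr E]] [r' [Hr' E']]; exists (Rmin r r'); split; first exact: Rmin_pos.
move=> s Hs; have := Rmin_l r r'; have := Rmin_r r r' => h1 h2.
by rewrite E ?E' //; lra.
Qed.

Definition removable_value (G : C -> C) (s0 v : C) : Prop :=
  exists K, analytic_at K s0 /\ agree_near K G s0 /\ K s0 = v.

Lemma Cmod_subxx (s0 : C) : Cmod (s0 - s0) = 0%R.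
Proof. by rewrite (_ : s0 - s0 = 0) ?Cmod_0 //; ring. Qed.

(** Repairs the values at removable singularities, which turns an explicit continuation into a
    witness for [dirichlet_continuation]. *)
Lemma weakly_meromorphic_fill G : (forall s, weakly_meromorphic_at G s) ->
  exists F, meromorphic F /\ forall s, analytic_at G s -> F s = G s.
Proof.
move=> HG.
pose F s := epsilon (inhabits (RtoC 0)) (removable_value G s).
have HF K s : analytic_at K s -> agree_near K G s -> F s = K s.
  move=> HK HKG.
  have [K' [HK' [HKG' <-]]] : removable_value G s (F s).
    by apply: epsilon_spec; exists (K s), K.
  have [r [Hr E]] := agree_near_analytic HK' HK (agree_near_trans HKG' (agree_near_sym HKG)).
  by apply: E; rewrite Cmod_subxx.
have Hrefl s : agree_near G G s by exists 1%R; split; [lra |].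
have HFG s0 : agree_near F G s0.
  have [r [Hr Ha]] := weakly_meromorphic_analytic_near (HG s0).
  by exists r; split => // s Hs; apply: HF => //; apply: Ha.
exists F; split; last by move=> s Hs; apply: HF.
move=> s0.
have Hfill K : analytic_at K s0 -> agree_near K G s0 -> analytic_at F s0.
  move=> HK HKG; have [r [Hr E]] := agree_near_trans HKG (agree_near_sym (HFG s0)).
  apply: (analytic_at_ext Hr (F := K)) => // s Hs.
  have [->|Ns] := excluded_middle_informative (s = s0); first by rewrite (HF K).
  apply: E; split => //; apply: (proj1 (Cmod_gt_0 _)) => E0; apply: Ns; exact/Ceq_minus.
have [m [K [r [HK [Hr E]]]]] := HG s0.
(* Either [K] vanishes near [s0], or it has a zero of order [p]: then the singularity is removable
   for [m <= p] and a pole of order [m - p] otherwise. *)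
have [[r' [Hr' Hz]]|[p [g [r' [Hg [Hn [Hr' E']]]]]]] := analytic_zero_or_factor HK.
  left; apply: (Hfill (fun _ => RtoC 0)); first exact: analytic_at_const.
  exists (Rmin r r'); split; first exact: Rmin_pos.
  move=> s Hs; have := Rmin_l r r'; have := Rmin_r r r' => h1 h2.
  have Hnz := Cpow_nz _ m (Csub_neq0 (proj1 Hs)).
  have -> : G s = G s * (s - s0) ^ m / (s - s0) ^ m by field.
  by rewrite E ?Hz; [field | lra | lra].
have EG s : (0 < Cmod (s - s0) < Rmin r r')%R -> G s * (s - s0) ^ m = (s - s0) ^ p * g s.
  move=> Hs; have := Rmin_l r r'; have := Rmin_r r r' => h1 h2.
  by rewrite E ?E' //; lra.
have [Hmp|Hmp] := leqP m p.
  left; apply: (Hfill (fun s => (s - s0) ^ (p - m) * g s)).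
    by apply: analytic_at_mult => //; apply: analytic_at_pow; apply: analytic_at_minus;
    [apply: analytic_at_id | apply: analytic_at_const].
  exists (Rmin r r'); split; first exact: Rmin_pos.
  move=> s Hs.
  have Hnz := Cpow_nz _ m (Csub_neq0 (proj1 Hs)).
  have -> : G s = G s * (s - s0) ^ m / (s - s0) ^ m by field.
  rewrite EG // (_ : (s - s0) ^ p = (s - s0) ^ (p - m) * (s - s0) ^ m); first by field.
  by rewrite -Cpow_add_r; f_equal; lia.
right.
have [r2 [Hr2 E2]] := HFG s0.
have Hrr := Rmin_pos _ _ Hr Hr'.
exists (m - p)%N, g, (Rmin r2 (Rmin r r')).
split; first lia.
do 2 split => //; split; first exact: Rmin_pos.
move=> s Hs; have := Rmin_l r2 (Rmin r r'); have := Rmin_r r2 (Rmin r r') => h1 h2.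
have Hnz k := Cpow_nz _ k (Csub_neq0 (proj1 Hs)).
rewrite E2; last lra.
have -> : G s = G s * (s - s0) ^ m / (s - s0) ^ m by field.
rewrite EG; last lra.
rewrite (_ : (s - s0) ^ m = (s - s0) ^ p * (s - s0) ^ (m - p)); first by field.
by rewrite -Cpow_add_r; f_equal; lia.
Qed.

(** The choice in [dirichlet_function] is meaningful once one continuation is exhibited; whichever
    is chosen agrees with [G] by the identity theorem. Values at poles are arbitrary, so equality is
    claimed only near points where [G] is analytic. *)
Lemma dirichlet_function_eq (c l : nat -> R) (G : C -> C) (sigma : R) :
  (forall s, weakly_meromorphic_at G s) ->
  (forall s, (sigma < Re s)%R -> analytic_at G s) ->
  (forall s, (sigma < Re s)%R -> cseries (fun k => c k.+1 * Rcpow (l k.+1) (- s)) (G s)) ->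
  forall s0, analytic_at G s0 ->
  exists r, (0 < r)%R /\ forall s, (Cmod (s - s0) < r)%R -> dirichlet_function c l s = G s.
Proof.
move=> HG Hana Hser s0 Hs0.
have [F [HF HFG]] := weakly_meromorphic_fill HG.
have [Hmer [sigma' Hsig]] : dirichlet_continuation c l (dirichlet_function c l).
  apply: epsilon_spec; exists F; split => //; exists sigma => s Hs.
  by apply/cseries_is_series; rewrite HFG; [apply: Hser | apply: Hana].
apply: meromorphic_agree_analytic => //.
apply: (weakly_meromorphic_identity (sigma := Rmax sigma sigma')) => // [s|s Hs].
  exact: meromorphic_weakly.
have := Rmax_l sigma sigma'; have := Rmax_r sigma sigma' => h1 h2.
have H1 := Hsig s ltac:(lra); have H2 := Hser s ltac:(lra).
by apply: cseries_lim_unique H2; apply/cseries_is_series.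
Qed.

(** * Exponential and binomial series *)

(** The rising factorial of [s] divided by n!, which is the coefficient of u^n in (1 - u)^(-s). *)
Definition rising (s : C) : nat -> C :=
  fix q n := match n with 0 => RtoC 1 | m.+1 => q m * (s + INR m) / INR m.+1 end.

Definition rising_bound (rho : R) : nat -> R :=
  fix q n := match n with 0 => 1%R | m.+1 => (q m * (rho + INR m) / INR m.+1)%R end.

Lemma risingS s n : rising s n.+1 = rising s n * (s + INR n) / INR n.+1.
Proof. by []. Qed.

Lemma rising_boundS rho n :
  rising_bound rho n.+1 = (rising_bound rho n * (rho + INR n) / INR n.+1)%R.
Proof. by []. Qed.

Lemma INRS_pos n : (0 < INR n.+1)%R.
Proof. by apply: lt_0_INR; lia. Qed.

Lemma INRS_neq0 n : RtoC (INR n.+1) <> 0.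
Proof. by move=> /RtoC_inj; have := INRS_pos n; lra. Qed.

Lemma rising_bound_ge0 rho n : (0 <= rho)%R -> (0 <= rising_bound rho n)%R.
Proof.
move=> H; elim: n => [|n IH]; first by simpl; lra.
rewrite rising_boundS; apply: Rle_mult_inv_pos (INRS_pos n).
by apply: Rmult_le_pos => //; have := pos_INR n; lra.
Qed.

Lemma Cmod_rising s rho n : (Cmod s <= rho)%R -> (Cmod (rising s n) <= rising_bound rho n)%R.
Proof.
move=> Hs; have Hr : (0 <= rho)%R by have := Cmod_ge_0 s; lra.
elim: n => [|n IH]; first by rewrite /= Cmod_1; lra.
rewrite risingS rising_boundS Cmod_div; last exact: INRS_neq0.
have Hp := INRS_pos n; have Hp' := pos_INR n.
rewrite Cmod_mult (Cmod_RtoC_pos (x := INR n.+1)); last lra.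
apply: Rmult_le_compat_r; first by apply: Rlt_le; apply: Rinv_0_lt_compat.
apply: Rmult_le_compat => //; try exact: Cmod_ge_0.
by apply: Rle_trans (Cmod_triangle _ _) _; rewrite Cmod_RtoC_pos; lra.
Qed.

Lemma eventually_decreasing_bound (u : nat -> R) N :
  (forall n, 0 <= u n)%R -> (forall n, (N <= n)%N -> u n.+1 <= u n)%R ->
  exists C0, (0 <= C0)%R /\ forall n, (u n <= C0)%R.
Proof.
move=> Hu Hd.
exists (rsum u N); split; first exact: rsum_ge0.
have Hle k n : (k <= n)%N -> (u k <= rsum u n)%R.
  elim: n => [|n IH] Hk; first by rewrite rsum0 (_ : k = 0%N); [lra | lia].
  rewrite rsumS; have [E|E] : k = n.+1 \/ (k <= n)%N by lia.
    by rewrite E; have := rsum_ge0 n Hu; lra.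
  by have := IH E; have := Hu n.+1; lra.
move=> n; have [Hn|Hn] : (n <= N)%N \/ (N <= n)%N by lia.
  exact: Hle.
have -> : n = (n - N + N)%N by lia.
elim: (n - N)%N => [|k IH]; first exact: Hle.
by apply: Rle_trans IH; rewrite addSn; apply: Hd; lia.
Qed.

(** The ratio (rho + n) / (n + 1) of consecutive terms tends to 1, so the growth is slower than any
    geometric one; from [N] on the ratio is at most 1 / v. *)
Lemma rising_bound_subexp rho v : (0 <= rho)%R -> (0 < v < 1)%R ->
  exists C0, (0 <= C0)%R /\ forall n, (rising_bound rho n <= C0 * (/ v) ^ n)%R.
Proof.
move=> Hr Hv.
have [N HN0] := INR_unbounded (rho / (1 - v)).
have HN n : (N <= n)%N -> ((rho + INR n) * v <= INR n.+1)%R.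
  move=> Hn.
  have h1 : (rho / (1 - v) < INR n)%R.
    by apply: (Rlt_le_trans _ (INR N)) => //; apply: le_INR; lia.
  have : (rho / (1 - v) * (1 - v) = rho)%R by field; lra.
  rewrite S_INR; nra.
pose u n := (rising_bound rho n * v ^ n)%R.
have Hu n : (0 <= u n)%R.
  by apply: Rmult_le_pos; [apply: rising_bound_ge0 | apply: Rpow_ge0; lra].
have Hd n : (N <= n)%N -> (u n.+1 <= u n)%R.
  move=> Hn; have Hp := INRS_pos n; have H1 := HN n Hn.
  have -> : u n.+1 = (u n * (((rho + INR n) * v) / INR n.+1))%R.
    by rewrite /u rising_boundS -tech_pow_Rmult; field; lra.
  rewrite -[X in (_ <= X)%R]Rmult_1_r; apply: Rmult_le_compat_l => //.
  by apply: (Rmult_le_reg_r (INR n.+1)) => //; rewrite /Rdiv Rmult_assoc Rinv_l; lra.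
have [C0 [H0 HC0]] := eventually_decreasing_bound Hu Hd.
exists C0; split => // n; have := HC0 n.
have Hvn : (0 < v ^ n)%R by apply: pow_lt; lra.
rewrite /u => H; apply: (Rmult_le_reg_r (v ^ n)) => //.
by rewrite Rmult_assoc -Rpow_mult_distr Rinv_l; [rewrite pow1; lra | lra].
Qed.

Lemma Cexp_plus z w : Cexp (z + w) = Cexp z * Cexp w.
Proof.
case: z => a b; case: w => c d; rewrite /Cexp /Cplus /Cmult /=.
by rewrite exp_plus cos_plus sin_plus; f_equal; ring.
Qed.

Lemma Cexp_0 : Cexp 0 = 1.
Proof. by rewrite /Cexp /= exp_0 cos_0 sin_0 Rmult_1_r Rmult_0_r. Qed.

Lemma Cmod_Cexp z : Cmod (Cexp z) = exp (Re z).
Proof.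
rewrite /Cexp /Cmod /=.
rewrite (_ : _ + _ = (exp (Re z))²)%R; first by apply: sqrt_Rsqr; apply: Rlt_le; apply: exp_pos.
by have := sin2_cos2 (Im z); rewrite /Rsqr; nra.
Qed.

(* [F = X + i Y] solves [F' = alpha' F] on [0, 1], so [F exp (- alpha)] is constant. *)
Lemma linear_ode (X Y dX dY al be dal dbe : R -> R) :
  (forall t, 0 <= t <= 1 -> is_derive X t (dX t))%R ->
  (forall t, 0 <= t <= 1 -> is_derive Y t (dY t))%R ->
  (forall t, 0 <= t <= 1 -> is_derive al t (dal t))%R ->
  (forall t, 0 <= t <= 1 -> is_derive be t (dbe t))%R ->
  (forall t, 0 <= t <= 1 -> dX t = dal t * X t - dbe t * Y t)%R ->
  (forall t, 0 <= t <= 1 -> dY t = dal t * Y t + dbe t * X t)%R ->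
  X 0%R = 1%R -> Y 0%R = 0%R -> al 0%R = 0%R -> be 0%R = 0%R ->
  (X 1%R, Y 1%R) = Cexp (al 1%R, be 1%R).
Proof.
move=> HX HY Ha Hb EX EY X0 Y0 a0 b0.
pose G1 t := (exp (- al t) * (X t * cos (be t) + Y t * sin (be t)))%R.
pose G2 t := (exp (- al t) * (Y t * cos (be t) - X t * sin (be t)))%R.
have H1 : G1 0%R = G1 1%R.
  apply: eq_is_derive; last lra.
  move=> t Ht; rewrite /G1.
  have h1 := HX t Ht; have h2 := HY t Ht; have h3 := Ha t Ht; have h4 := Hb t Ht.
  auto_derive.
    by repeat split; [exists (dal t) | exists (dX t) | exists (dbe t) | exists (dY t) | exists (dbe t)].
  rewrite !(is_derive_unique (fun x : R => X x) _ _ h1) !(is_derive_unique (fun x : R => Y x) _ _ h2)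
    !(is_derive_unique (fun x : R => al x) _ _ h3) !(is_derive_unique (fun x : R => be x) _ _ h4) EX // EY //.
  rewrite /zero /=; ring.
have H2 : G2 0%R = G2 1%R.
  apply: eq_is_derive; last lra.
  move=> t Ht; rewrite /G2.
  have h1 := HX t Ht; have h2 := HY t Ht; have h3 := Ha t Ht; have h4 := Hb t Ht.
  auto_derive.
    by repeat split; [exists (dal t) | exists (dY t) | exists (dbe t) | exists (dX t) | exists (dbe t)].
  rewrite !(is_derive_unique (fun x : R => X x) _ _ h1) !(is_derive_unique (fun x : R => Y x) _ _ h2)
    !(is_derive_unique (fun x : R => al x) _ _ h3) !(is_derive_unique (fun x : R => be x) _ _ h4) EX // EY //.
  rewrite /zero /=; ring.
move: H1 H2; rewrite /G1 /G2 X0 Y0 a0 b0 cos_0 sin_0 Ropp_0 exp_0.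
set x := X 1%R; set y := Y 1%R; set a := al 1%R; set b := be 1%R => H1 H2.
have He : (exp a * exp (- a) = 1)%R by rewrite -exp_plus Rplus_opp_r exp_0.
have Hsc := sin2_cos2 b; rewrite /Rsqr in Hsc.
rewrite /Cexp /=; f_equal.
  have -> : x = (exp a * exp (- a) * (sin b * sin b + cos b * cos b) * x)%R by rewrite He Hsc; ring.
  have -> : (exp a * exp (- a) * (sin b * sin b + cos b * cos b) * x =
    exp a * (cos b * (exp (- a) * (x * cos b + y * sin b)) - sin b * (exp (- a) * (y * cos b - x * sin b))))%R by ring.
  by rewrite -H1 -H2; ring.
have -> : y = (exp a * exp (- a) * (sin b * sin b + cos b * cos b) * y)%R by rewrite He Hsc; ring.
have -> : (exp a * exp (- a) * (sin b * sin b + cos b * cos b) * y =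
  exp a * (sin b * (exp (- a) * (x * cos b + y * sin b)) + cos b * (exp (- a) * (y * cos b - x * sin b))))%R by ring.
by rewrite -H1 -H2; ring.
Qed.

Lemma CpowS (z : C) n : z ^ n.+1 = z * z ^ n.
Proof. by []. Qed.

Lemma CV_radius_gt1 (a : nat -> R) (C0 theta : R) : (0 < theta < 1)%R ->
  (forall n, Rabs (a n) <= C0 * theta ^ n)%R ->
  forall t, (0 <= t <= 1)%R -> Rbar_lt (Rabs t) (CV_radius a).
Proof.
move=> Hth Ha t Ht.
have H1 : (1 < / theta)%R by rewrite -Rinv_1; apply: Rinv_lt_contravar; lra.
apply: (Rbar_lt_le_trans _ (Finite (/ theta))); first by rewrite Rabs_pos_eq /=; lra.
apply: (proj1 (CV_radius_bounded a)); exists C0 => n.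
rewrite Rabs_mult -RPow_abs (Rabs_pos_eq (/ theta)); last lra.
have Hp : (0 <= (/ theta) ^ n)%R by apply: Rpow_ge0; lra.
apply: Rle_trans (Rmult_le_compat_r _ _ _ Hp (Ha n)) _.
by rewrite Rmult_assoc -Rpow_mult_distr Rinv_r; [rewrite pow1; lra | lra].
Qed.

Lemma cseries_PSeries (c : nat -> C) (t : R) :
  Rbar_lt (Rabs t) (CV_radius (fun n => Re (c n))) ->
  Rbar_lt (Rabs t) (CV_radius (fun n => Im (c n))) ->
  cseries (fun n => c n * RtoC t ^ n)
    (PSeries (fun n => Re (c n)) t, PSeries (fun n => Im (c n)) t).
Proof.
move=> /CV_radius_inside /PSeries_correct /is_pseries_R H1.
move=> /CV_radius_inside /PSeries_correct /is_pseries_R H2.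
split; [apply: is_series_ext H1 | apply: is_series_ext H2] => n;
  by rewrite -RtoC_pow_nat ?re_scal_r ?im_scal_r.
Qed.

(** Evaluates a power series at 1 by following it along the real segment from 0 to 1, where a linear
    differential equation determines it. The decay with [theta < 1] puts t = 1 strictly inside the
    disc of convergence. *)
Lemma cseries_ode (c : nat -> C) (C0 theta : R) (al be dal dbe : R -> R) :
  (0 < theta < 1)%R -> (forall n, Cmod (c n) <= C0 * theta ^ n)%R -> c 0%N = 1 ->
  (forall t, 0 <= t <= 1 -> is_derive al t (dal t))%R ->
  (forall t, 0 <= t <= 1 -> is_derive be t (dbe t))%R ->
  al 0%R = 0%R -> be 0%R = 0%R ->
  (forall (t : R) (F dF : C), (0 <= t <= 1)%R -> cseries (fun n => c n * RtoC t ^ n) F ->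
     cseries (fun n => INR n.+1 * c n.+1 * RtoC t ^ n) dF -> dF = (dal t, dbe t) * F) ->
  cseries c (Cexp (al 1%R, be 1%R)).
Proof.
move=> Hth Hc c0 Hal Hbe al0 be0 Hode.
pose cr n := Re (c n); pose ci n := Im (c n).
have Hr := CV_radius_gt1 (a := cr) Hth (fun n => Rle_trans _ _ _ (re_le_Cmod _) (Hc n)).
have Hi := CV_radius_gt1 (a := ci) Hth (fun n => Rle_trans _ _ _ (im_le_Cmod _) (Hc n)).
have Hdr t : (0 <= t <= 1)%R -> Rbar_lt (Rabs t) (CV_radius (PS_derive cr)).
  by move=> Ht; rewrite CV_radius_derive; apply: Hr.
have Hdi t : (0 <= t <= 1)%R -> Rbar_lt (Rabs t) (CV_radius (PS_derive ci)).
  by move=> Ht; rewrite CV_radius_derive; apply: Hi.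
have Eode t : (0 <= t <= 1)%R -> (PSeries (PS_derive cr) t, PSeries (PS_derive ci) t)
    = (dal t, dbe t) * (PSeries cr t, PSeries ci t).
  move=> Ht; apply: Hode => //; first by apply: cseries_PSeries; [apply: Hr | apply: Hi].
  have := cseries_PSeries (c := fun n => (PS_derive cr n, PS_derive ci n)) (Hdr t Ht) (Hdi t Ht).
  apply: cseries_ext => n; f_equal.
  rewrite /PS_derive /cr /ci; case: (c n.+1) => x y.
  by rewrite /Cmult /RtoC /=; f_equal; ring.
rewrite -(linear_ode (X := PSeries cr) (Y := PSeries ci) (dX := PSeries (PS_derive cr))
  (dY := PSeries (PS_derive ci)) _ _ Hal Hbe) //.
- have := cseries_PSeries (Hr 1%R ltac:(lra)) (Hi 1%R ltac:(lra)).
  by apply: cseries_ext => n; rewrite Cpow_1l; ring.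
- by move=> t Ht; apply: is_derive_PSeries; apply: Hr.
- by move=> t Ht; apply: is_derive_PSeries; apply: Hi.
- by move=> t Ht; have := Eode t Ht => -[-> _].
- by move=> t Ht; have := Eode t Ht => -[_ ->]; ring.
- by rewrite PSeries_0 /cr c0.
- by rewrite PSeries_0 /ci c0.
Qed.

Lemma INR_fact_neq0 n : RtoC (INR (Factorial.fact n)) <> 0.
Proof. by move=> /RtoC_inj; apply: INR_fact_neq_0. Qed.

Lemma exp_partial_bound (x : R) K : (0 <= x)%R ->
  (rsum (fun n => x ^ n / INR (Factorial.fact n)) K <= exp x)%R.
Proof.
move=> Hx; have /is_pseries_R H := is_exp_Reals x.
rewrite -(is_series_unique _ _ H).
rewrite (rsum_ext (v := fun n => / INR (Factorial.fact n) * x ^ n)%R); last by move=> n; rewrite /Rdiv Rmult_comm.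
apply: rsum_le_Series; last by exists (exp x).
move=> n; apply: Rmult_le_pos; last exact: Rpow_ge0.
by apply: Rlt_le; apply: Rinv_0_lt_compat; apply: INR_fact_lt_0.
Qed.

Lemma rsum_term_le (u : nat -> R) n : (forall i, 0 <= u i)%R -> (u n <= rsum u n)%R.
Proof.
move=> Hu; case: n => [|n]; first by rewrite rsum0; lra.
by rewrite rsumS; have := rsum_ge0 n Hu; lra.
Qed.

Lemma cseries_exp (w : C) : cseries (fun n => w ^ n / INR (Factorial.fact n)) (Cexp w).
Proof.
have -> : Cexp w = Cexp (Re w * 1, Im w * 1)%R by rewrite !Rmult_1_r; case: w.
(* A single term of the series for exp (2 |w|) is at most its sum, so |w|^n / n! <= exp (2 |w|) /
   2^n. *)
apply: (cseries_ode (C0 := exp (2 * Cmod w)) (theta := (/ 2)%R)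
  (al := fun t => (Re w * t)%R) (be := fun t => (Im w * t)%R)
  (dal := fun _ => Re w) (dbe := fun _ => Im w)) => //; try lra.
- move=> n; rewrite Cmod_div; last exact: INR_fact_neq0.
  rewrite Cmod_pow Cmod_RtoC_pos; last exact: pos_INR.
  have Hp : (0 <= 2 * Cmod w)%R by have := Cmod_ge_0 w; lra.
  have := rsum_term_le (u := fun n => ((2 * Cmod w) ^ n / INR (Factorial.fact n))%R) n _.
  have Hpos i : (0 <= (2 * Cmod w) ^ i / INR (Factorial.fact i))%R.
    by apply: Rle_mult_inv_pos; [apply: Rpow_ge0 | apply: INR_fact_lt_0].
  move=> /(_ Hpos) H; have {H} H := Rle_trans _ _ _ H (exp_partial_bound n Hp).
  have H2 : (0 < 2 ^ n)%R by apply: pow_lt; lra.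
  rewrite pow_inv; apply: (Rmult_le_reg_r (2 ^ n)) => //.
  rewrite Rmult_assoc Rinv_l; last lra.
  by move: H; rewrite Rpow_mult_distr; lra.
- by rewrite /=; field.
- by move=> t _; auto_derive => //; ring.
- by move=> t _; auto_derive => //; ring.
move=> t F dF _ HF HdF.
rewrite (_ : (Re w, Im w) = w); last by case: w {HF HdF}.
apply: cseries_lim_unique HdF _.
apply: cseries_ext (cseries_scal w HF) => n.
rewrite fact_simpl mult_INR RtoC_mult CpowS.
by field; split; [exact: INR_fact_neq0 | exact: INRS_neq0].
Qed.

Lemma cseries_binomial (s : C) (u : R) : (Rabs u < 1)%R ->
  cseries (fun n => rising s n * RtoC u ^ n) (Rcpow (1 - u) (- s)).
Proof.
move=> Hu.
have Hu' := proj1 (Rabs_lt_between _ _) Hu.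
(* Since [v] lies strictly between |u| and 1, the terms are O((|u| / v)^n). The midpoint of |u| / v
   and 1 serves as [theta], because |u| / v is 0 when u is. *)
pose v := ((1 + Rabs u) / 2)%R.
have Hau := Rabs_pos u.
have Hv : (0 < v < 1)%R by rewrite /v; lra.
have [C0 [H0 HC0]] := rising_bound_subexp (Cmod_ge_0 s) Hv.
have Hth : (0 < (1 + Rabs u / v) / 2 < 1)%R.
  have : (Rabs u / v < 1)%R.
    by apply: (Rmult_lt_reg_r v); [lra | rewrite /Rdiv Rmult_assoc Rinv_l /v; lra].
  have : (0 <= Rabs u / v)%R by apply: Rle_mult_inv_pos; lra.
  lra.
have -> : Rcpow (1 - u) (- s) = Cexp (- Re s * ln (1 - u * 1), - Im s * ln (1 - u * 1))%R.
  rewrite /Rcpow Rmult_1_r; f_equal; case: s {HC0} => a b.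
  by rewrite /Cmult /RtoC /=; f_equal; ring.
have Hden t : (0 <= t <= 1)%R -> (0 < 1 - u * t)%R by move=> Ht; nra.
apply: (cseries_ode (C0 := C0) Hth
  (al := fun t => (- Re s * ln (1 - u * t))%R) (be := fun t => (- Im s * ln (1 - u * t))%R)
  (dal := fun t => (Re s * u / (1 - u * t))%R) (dbe := fun t => (Im s * u / (1 - u * t))%R)) => //.
- move=> n; rewrite Cmod_mult Cmod_pow Cmod_R.
  have Hp : (0 <= Rabs u ^ n)%R by apply: Rpow_ge0.
  apply: Rle_trans (Rmult_le_compat_r _ _ _ Hp (Rle_trans _ _ _ (Cmod_rising n (Rle_refl _)) (HC0 n))) _.
  rewrite Rmult_assoc -Rpow_mult_distr; apply: Rmult_le_compat_l => //.
  apply: pow_incr; split; first by rewrite Rmult_comm; apply: Rle_mult_inv_pos; lra.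
  rewrite Rmult_comm; rewrite -/(Rdiv (Rabs u) v).
  have : (Rabs u / v < 1)%R.
    by apply: (Rmult_lt_reg_r v); [lra | rewrite /Rdiv Rmult_assoc Rinv_l /v; lra].
  lra.
- by rewrite /=; ring.
- by move=> t Ht; have := Hden t Ht => h; auto_derive; [lra | field; lra].
- by move=> t Ht; have := Hden t Ht => h; auto_derive; [lra | field; lra].
- by rewrite /= Rmult_0_r Rminus_0_r ln_1; ring.
- by rewrite /= Rmult_0_r Rminus_0_r ln_1; ring.
move=> t F dF Ht HF HdF; have Hd := Hden t Ht.
have Hdc : 1 - RtoC u * RtoC t <> 0.
  by rewrite -RtoC_mult -RtoC_minus => /RtoC_inj; lra.
(* Coefficientwise, the recurrence defining [rising] is the equation (1 - u t) F' = s u F;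
   multiplication by u t is a shift of the series. *)
have E : (1 - RtoC u * RtoC t) * dF = s * u * F.
  have Hsh := cseries_minus HdF (cseries_shift 1 (cseries_scal (RtoC u * RtoC t) HdF)).
  have -> : (1 - RtoC u * RtoC t) * dF = dF - RtoC u * RtoC t * dF by ring.
  apply: cseries_lim_unique Hsh _.
  apply: cseries_ext (cseries_scal (s * u) HF) => -[|n].
    by rewrite /=; field; apply: RtoC_inj.
  rewrite (_ : (n.+1 < 1)%N = false) // (_ : (n.+1 - 1)%N = n) ?subn1 // (risingS s n.+1).
  rewrite (CpowS u n.+1) (CpowS t n).
  rewrite (S_INR n) RtoC_plus.
  by field; exact: INRS_neq0.
have -> : ((Re s * u / (1 - u * t))%R, (Im s * u / (1 - u * t))%R) = s * u / (1 - RtoC u * RtoC t).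
  rewrite -RtoC_mult -RtoC_minus /Cdiv -RtoC_inv; last lra.
  case: s {HC0 HF HdF E} => a b; rewrite /Cmult /RtoC /=; f_equal; field; lra.
have -> : dF = (1 - RtoC u * RtoC t) * dF / (1 - RtoC u * RtoC t) by field.
by rewrite E; field.
Qed.

(** * Hurwitz zeta functions *)

Lemma Rcpow_plus x s t : Rcpow x (s + t) = Rcpow x s * Rcpow x t.
Proof. by rewrite /Rcpow -Cexp_plus; f_equal; ring. Qed.

Lemma Rcpow_mult x y s : (0 < x)%R -> (0 < y)%R -> Rcpow (x * y) s = Rcpow x s * Rcpow y s.
Proof. by move=> Hx Hy; rewrite /Rcpow -Cexp_plus ln_mult // RtoC_plus; f_equal; ring. Qed.

Lemma Rcpow_RtoC x (y : R) : (0 < x)%R -> Rcpow x y = RtoC (Rpower x y).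
Proof.
move=> Hx; rewrite /Rcpow /Cexp /Rpower -RtoC_mult /= sin_0 cos_0 /RtoC.
by f_equal; ring.
Qed.

Lemma Rcpow_0 x : Rcpow x 0 = 1.
Proof. by rewrite /Rcpow Cmult_0_l Cexp_0. Qed.

Lemma Rcpow_INR x n : (0 < x)%R -> Rcpow x (INR n) = RtoC x ^ n.
Proof. by move=> Hx; rewrite Rcpow_RtoC // Rpower_pow // RtoC_pow_nat. Qed.

Lemma Rcpow_opp_INR x n : (0 < x)%R -> Rcpow x (- INR n) = RtoC (/ x) ^ n.
Proof.
move=> Hx.
have H : Rcpow x (- INR n) * Rcpow x (INR n) = 1.
  by rewrite -Rcpow_plus (_ : - INR n + INR n = 0) ?Rcpow_0 //; ring.
have Hnz : RtoC x <> 0 by move=> /RtoC_inj; lra.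
rewrite Rcpow_INR // in H.
rewrite RtoC_inv; last lra.
rewrite Cpow_inv // -[Rcpow _ _]Cmult_1_r -(Cinv_r (RtoC x ^ n)); last exact: Cpow_nz.
by rewrite Cmult_assoc H; ring.
Qed.

Lemma Cmod_Rcpow x s : Cmod (Rcpow x s) = Rpower x (Re s).
Proof. by rewrite /Rcpow Cmod_Cexp re_scal_r. Qed.

Lemma majorized_exp s0 r (c : C) : (0 <= r)%R ->
  majorized s0 r (exp (Re (c * s0)) * exp (Cmod c * r)) (fun s => Cexp (c * s)).
Proof.
move=> Hr; exists (fun n => Cexp (c * s0) * (c ^ n / INR (Factorial.fact n))); split.
  move=> K.
  have Hp : (0 <= Cmod c * r)%R by apply: Rmult_le_pos (Cmod_ge_0 _) Hr.
  apply: Rle_trans (Rmult_le_compat_l _ _ _ (Rlt_le _ _ (exp_pos _)) (exp_partial_bound K Hp)).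
  apply: Req_le; rewrite -rsum_mulr; apply: rsum_ext => n.
  rewrite Cmod_mult Cmod_div; last exact: INR_fact_neq0.
  rewrite Cmod_Cexp Cmod_pow Cmod_RtoC_pos; last exact: pos_INR.
  by rewrite Rpow_mult_distr; field; apply: INR_fact_neq_0.
move=> s _.
have -> : c * s = c * s0 + c * (s - s0) by ring.
rewrite Cexp_plus.
apply: cseries_ext (cseries_scal (Cexp (c * s0)) (cseries_exp (c * (s - s0)))) => n.
by rewrite Cpow_mult_l; field; apply: INR_fact_neq0.
Qed.

Lemma majorized_Rcpow s0 r x : (0 <= r)%R -> (1 <= x)%R ->
  majorized s0 r (Rpower x (- Re s0 + r)) (fun s => Rcpow x (- s)).
Proof.
move=> Hr Hx.
have Hl : (0 <= ln x)%R.
  by rewrite -ln_1; have [E|E] := Req_dec x 1; [rewrite E; lra | apply: Rlt_le; apply: ln_increasing; lra].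
have := majorized_exp s0 (- RtoC (ln x)) Hr.
rewrite Cmod_opp Cmod_RtoC_pos // -exp_plus.
rewrite (_ : Re (- RtoC (ln x) * s0) + ln x * r = (- Re s0 + r) * ln x)%R; last first.
  by rewrite -RtoC_opp re_scal_l; ring.
by apply: majorized_ext => s _; rewrite /Rcpow; f_equal; ring.
Qed.

Lemma analytic_at_Rcpow x s0 : analytic_at (fun s => Rcpow x s) s0.
Proof.
apply/analytic_at_majorized.
have := majorized_exp s0 (RtoC (ln x)) Rle_0_1 => H.
exists 1%R; eexists; split; first lra.
by apply: majorized_ext H => s _; rewrite /Rcpow; f_equal; ring.
Qed.

Lemma majorized_rising s0 r rho f n : (0 < r)%R ->
  majorized s0 r rho f -> majorized s0 r (rising_bound rho n) (fun s => rising (f s) n).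
Proof.
move=> Hr Hf; elim: n => [|n IH].
  by have := majorized_const s0 r 1; rewrite Cmod_1.
have := majorized_mult Hr IH (majorized_scal (/ RtoC (INR n.+1))
  (majorized_plus (Rlt_le _ _ Hr) Hf (majorized_const s0 r (INR n)))).
rewrite Cmod_inv; last exact: INRS_neq0.
have Hp := INRS_pos n.
rewrite !Cmod_RtoC_pos; try exact: pos_INR.
rewrite rising_boundS => H.
rewrite (_ : _ / _ = rising_bound rho n * (/ INR n.+1 * (rho + INR n)))%R; last by field; lra.
by apply: majorized_ext H => s _; rewrite risingS; field; apply: INRS_neq0.
Qed.

Lemma analytic_at_rising f s0 n : analytic_at f s0 -> analytic_at (fun s => rising (f s) n) s0.
Proof.
move=> /analytic_at_majorized [r [B [Hr M]]]; apply/analytic_at_majorized.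
by exists r, (rising_bound B n); split => //; apply: majorized_rising.
Qed.

Lemma inv_square_partial K : (rsum (fun k => / (INR k.+1) ^ 2) K <= 2)%R.
Proof.
suff : (rsum (fun k => / (INR k.+1) ^ 2) K <= 2 - / INR K.+1)%R.
  by have := Rinv_0_lt_compat _ (INRS_pos K); lra.
elim: K => [|K IH]; first by rewrite rsum0 /=; lra.
rewrite rsumS; have Hp := INRS_pos K.
suff : (/ INR K.+2 ^ 2 <= / INR K.+1 - / INR K.+2)%R by lra.
rewrite (S_INR K.+1); set x := INR K.+1 in Hp *.
have -> : (/ x - / (x + 1) = / (x * (x + 1)))%R by field; lra.
by apply: Rinv_le_contravar; nra.
Qed.

Definition shifted (a : R) (k : nat) : R := (INR k.+1 + a)%R.

(** The Hurwitz zeta function with parameter 1 + a, as a series; a = 0 gives the Riemann zeta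
    function. *)
Definition hseries (a : R) (z : C) : C := Cseries (fun k => Rcpow (shifted a k) (- z)).

Lemma shifted_ge a k : (0 <= a)%R -> (1 + a <= shifted a k)%R /\ (INR k.+1 <= shifted a k)%R /\
  (1 <= shifted a k)%R.
Proof. by move=> Ha; rewrite /shifted S_INR; have := pos_INR k; lra. Qed.

Lemma Rpower_le_exponent x y z : (1 <= x)%R -> (y <= z)%R -> (Rpower x y <= Rpower x z)%R.
Proof. by move=> Hx Hy; apply: Rle_Rpower. Qed.

Lemma Rpower_opp_decr x x' y : (0 <= y)%R -> (0 < x <= x')%R -> (Rpower x' (- y) <= Rpower x (- y))%R.
Proof.
move=> Hy Hx; rewrite !Rpower_Ropp; apply: Rinv_le_contravar; first exact: exp_pos.
exact: Rle_Rpower_l.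
Qed.

(** Two units of the exponent pay for summability over [k]; the surplus [y] becomes (1 + a)^(-y),
    the decay that later outweighs the powers of [a]. *)
Lemma Rpower_shifted a k y : (0 <= a)%R -> (0 <= y)%R ->
  (Rpower (shifted a k) (- (2 + y)) <= Rpower (1 + a) (- y) * / (INR k.+1) ^ 2)%R.
Proof.
move=> Ha Hy; have [h1 [h2 h3]] := shifted_ge k Ha.
rewrite (_ : - (2 + y) = - y + Ropp 2)%R; last ring.
rewrite Rpower_plus; apply: Rmult_le_compat; try (apply: Rlt_le; apply: exp_pos).
  by apply: Rpower_opp_decr; lra.
rewrite Rpower_Ropp; apply: Rinv_le_contravar.
  by apply: pow_lt; apply: INRS_pos.
have -> : 2%R = INR 2 by [].
rewrite Rpower_pow; last lra.
by apply: pow_incr; have := INRS_pos k; lra.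
Qed.

Lemma ex_inv_square : ex_series (fun k => / (INR k.+1) ^ 2)%R /\
  (Series (fun k => / (INR k.+1) ^ 2) <= 2)%R.
Proof.
apply: ex_series_nonneg_bound inv_square_partial => n.
by apply: Rlt_le; apply: Rinv_0_lt_compat; apply: pow_lt; apply: INRS_pos.
Qed.

Lemma majorized_hseries a s0 r y : (0 <= a)%R -> (0 < r)%R -> (0 <= y)%R ->
  (2 + y <= Re s0 - r)%R ->
  majorized s0 r (2 * Rpower (1 + a) (- y)) (hseries a) /\
  forall s, (Cmod (s - s0) <= r)%R ->
    cseries (fun k => Rcpow (shifted a k) (- s)) (hseries a s).
Proof.
move=> Ha Hr Hy Hre.
have [Hex Hle] := ex_inv_square.
have Hex' : ex_series (fun k => Rpower (1 + a) (- y) * / (INR k.+1) ^ 2)%R.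
  exact: (ex_series_scal_l (K := R_AbsRing) (V := R_NormedModule)).
have Hk k : majorized s0 r (Rpower (1 + a) (- y) * / (INR k.+1) ^ 2)
    (fun s => Rcpow (shifted a k) (- s)).
  have [h1 [h2 h3]] := shifted_ge k Ha.
  apply: majorized_le (majorized_Rcpow s0 (Rlt_le _ _ Hr) h3).
  apply: Rle_trans (Rpower_shifted k Ha Hy).
  by apply: Rpower_le_exponent; lra.
have [H1 H2] := majorized_series Hr Hk Hex'.
split => //; apply: majorized_le H1.
rewrite Series_scal_l Rmult_comm; apply: Rmult_le_compat_r => //.
by apply: Rlt_le; apply: exp_pos.
Qed.

Lemma hseries_cseries a z : (0 <= a)%R -> (2 <= Re z)%R ->
  cseries (fun k => Rcpow (shifted a k) (- z)) (hseries a z).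
Proof.
move=> Ha Hz.
have [|_ H] := majorized_hseries (s0 := z + 1) (y := 0%R) Ha Rlt_0_1 (Rle_refl _).
  by rewrite (_ : Re (z + 1) = Re z + 1)%R //; lra.
apply: H; rewrite (_ : z - (z + 1) = - (1)); last ring.
by rewrite Cmod_m1; lra.
Qed.

Lemma hseries_abs a z K : (0 <= a)%R -> (2 <= Re z)%R ->
  (rsum (fun k => Cmod (Rcpow (shifted a k) (- z))) K <= 2)%R.
Proof.
move=> Ha Hz; apply: Rle_trans (inv_square_partial K); apply: rsum_le => k.
rewrite Cmod_Rcpow; have [h1 [h2 h3]] := shifted_ge k Ha.
have := Rpower_shifted k Ha (Rle_refl 0); rewrite Ropp_0 Rpower_O; last lra.
rewrite Rmult_1_l; apply: Rle_trans; apply: Rpower_le_exponent => //.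
by rewrite (_ : Re (- z) = - Re z)%R //; lra.
Qed.

Lemma csum_trunc (b : nat -> C) I n : (I <= n)%N ->
  csum (fun i => if (i < I)%N then b i else RtoC 0) n =
  csum (fun i => if (i < I)%N then b i else RtoC 0) I.
Proof.
elim: n => [|n IH] Hn; first by have -> : I = 0%N by lia.
have [->//|Hn'] : I = n.+1 \/ (I <= n)%N by lia.
by rewrite csumS IH //; case: ltnP => [|_]; [lia | ring].
Qed.

Lemma cseries_trunc (b : nat -> C) I :
  cseries (fun i => if (i < I)%N then b i else RtoC 0)
    (csum (fun i => if (i < I)%N then b i else RtoC 0) I).
Proof.
apply/cseries_eps => eps He; exists I => n Hn.
by rewrite csum_trunc // Cmod_subxx.
Qed.

(** Meant for series whose first terms may have poles: only the terms from [I] on are majorized, and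
    their sum is the analytic [T]. *)
Lemma cseries_split_tail (f : nat -> C -> C) s0 I K q : (0 <= K)%R -> (0 <= q < 1)%R ->
  (forall i, (I <= i)%N -> majorized s0 1 (K * q ^ i) (f i)) ->
  exists T, analytic_at T s0 /\ forall s, (Cmod (s - s0) <= 1)%R ->
    cseries (fun i => f i s) (csum (fun i => if (i < I)%N then f i s else RtoC 0) I + T s).
Proof.
move=> HK Hq Hf.
pose f2 i s := if (i < I)%N then RtoC 0 else f i s.
have H2 i : majorized s0 1 (K * q ^ i) (f2 i).
  rewrite /f2; case: ltnP => Hi; last exact: Hf.
  apply: majorized_le (majorized_const s0 1 0); rewrite Cmod_0.
  by apply: Rmult_le_pos => //; apply: Rpow_ge0; lra.
have Hex : ex_series (fun i => K * q ^ i)%R.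
  apply: (ex_series_scal_l (K := R_AbsRing) (V := R_NormedModule)).
  by apply: ex_series_geom; rewrite Rabs_pos_eq; lra.
have [H3 H4] := majorized_series Rlt_0_1 H2 Hex.
exists (fun s => Cseries (fun i => f2 i s)); split.
  by apply/analytic_at_majorized; exists 1%R; eexists; split; [lra | exact: H3].
move=> s Hs; apply: cseries_ext (cseries_plus (cseries_trunc (f^~ s) I) (H4 s Hs)) => i.
by rewrite /f2; case: ltnP => _; ring.
Qed.

Lemma cseries_behead (a : nat -> C) (l : C) :
  cseries a l -> cseries (fun n => a n.+1) (l - a 0%N).
Proof.
move=> /cseries_eps H; apply/cseries_eps => eps /H [N HN]; exists N => n Hn.
have -> : csum (fun n => a n.+1) n - (l - a 0%N) = csum a n.+1 - l; last by apply: HN; lia.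
have -> : csum a n.+1 = a 0%N + csum (fun n => a n.+1) n; last ring.
elim: n {Hn} => [|n IH]; first by rewrite csumS !csum0.
by rewrite csumS IH [in RHS]csumS; ring.
Qed.

Lemma cseries_pair (t : nat -> C) (l : C) : cseries t l ->
  cseries (fun i => t i.*2 + t i.*2.+1) l.
Proof.
move=> /cseries_eps H; apply/cseries_eps => eps /H [N HN]; exists N => n Hn.
have -> : csum (fun i => t i.*2 + t i.*2.+1) n = csum t n.*2.+1; last by apply: HN; lia.
elim: n {Hn} => [|n IH]; first by rewrite csumS !csum0.
by rewrite csumS IH doubleS !csumS; ring.
Qed.

Lemma cseries_binomial_odd (s : C) (u : R) : (Rabs u < 1)%R ->
  cseries (fun i => 2 * rising s i.*2.+1 * RtoC u ^ i.*2.+1)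
    (Rcpow (1 - u) (- s) - Rcpow (1 + u) (- s)).
Proof.
move=> Hu; have H2 := cseries_binomial s (u := (- u)%R); rewrite Rabs_Ropp in H2.
have := cseries_pair (cseries_minus (cseries_binomial s Hu) (H2 Hu)).
rewrite (_ : 1 - - u = 1 + u)%R; last ring.
apply: cseries_ext => i.
rewrite RtoC_opp (_ : (- RtoC u) ^ i.*2 = RtoC u ^ i.*2) ?CpowS; last first.
  elim: i => [|i IH] //; rewrite doubleS !CpowS IH; ring.
rewrite (_ : (- RtoC u) ^ i.*2 = RtoC u ^ i.*2); first by ring.
by elim: i => [|i IH] //; rewrite doubleS !CpowS IH; ring.
Qed.

Lemma cseries_binomial_even (s : C) (u : R) : (Rabs u < 1)%R ->
  cseries (fun i => 2 * rising s i.*2 * RtoC u ^ i.*2)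
    (Rcpow (1 - u) (- s) + Rcpow (1 + u) (- s)).
Proof.
move=> Hu; have H2 := cseries_binomial s (u := (- u)%R); rewrite Rabs_Ropp in H2.
have := cseries_pair (cseries_plus (cseries_binomial s Hu) (H2 Hu)).
rewrite (_ : 1 - - u = 1 + u)%R; last ring.
apply: cseries_ext => i.
rewrite RtoC_opp !(CpowS _ i.*2) (_ : (- RtoC u) ^ i.*2 = RtoC u ^ i.*2); first by ring.
by elim: i => [|i IH] //; rewrite doubleS !CpowS IH; ring.
Qed.

(** In the telescoped expansion the zeta value at z + 2 i + 2 carries the rising factorial of z - 1
    of order 2 i + 3, divided by (2 i + 3)! 4^(i + 1). Its last factor z + 2 i + 1 is absorbed into
    [G], since [G w] stands for w - 1 times the zeta value at w. *)
Definition gcoef (i : nat) (z : C) : C :=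
  rising (z - 1) i.+1.*2 * RtoC (/ (4 ^ i.+1 * INR i.+1.*2.+1))%R.

(* Expanding [(x - 1/2)^(1 - z) - (x + 1/2)^(1 - z)] in powers of [1 / (2 x)] and
   summing over [x = k + a] telescopes the left side; solving for the leading term
   expresses the zeta function at [z] by its values at [z + 2], [z + 4], ... *)
Definition gstep (a : R) (G : C -> C) (z : C) : C :=
  Rcpow (a + / 2) (1 - z) -
  Cseries (fun i => gcoef i z * G (z + RtoC (INR i.+1.*2))).

(* [gapprox a M] is [(z - 1) sum_k (k + a)^(-z)] continued to [2 - 2 M < Re z]. *)
Fixpoint gapprox (a : R) (M : nat) : C -> C :=
  match M with
  | 0 => fun z => (z - 1) * hseries a z
  | M'.+1 => gstep a (gapprox a M')
  end.

Lemma gapprox0 a z : gapprox a 0 z = (z - 1) * hseries a z.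
Proof. by []. Qed.

Lemma gapproxS a M z : gapprox a M.+1 z = gstep a (gapprox a M) z.
Proof. by []. Qed.

Lemma rising_bound_geom rho : (0 <= rho)%R -> exists C0, (0 <= C0)%R /\
  forall n, (rising_bound rho n <= C0 * (4 / 3) ^ n)%R.
Proof.
move=> Hr; have [C0 [H0 H]] := rising_bound_subexp Hr (v := (3/4)%R) ltac:(lra).
exists C0; split => // n; apply: Rle_trans (H n) _; apply: Req_le; do 2 f_equal; lra.
Qed.

Lemma pow_double (x : R) i : (x ^ i.*2 = (x * x) ^ i)%R.
Proof. by elim: i => [|i IH] //; rewrite doubleS /= IH; ring. Qed.

Lemma Re_plus_INR z n : Re (z + RtoC (INR n)) = (Re z + INR n)%R.
Proof. by []. Qed.

Lemma INR_double i : INR i.*2 = (2 * INR i)%R.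
Proof. by rewrite -addnn plus_INR; lra. Qed.

Lemma telescoped_term (z : C) (x : R) i : (/ 2 < x)%R ->
  Rcpow x (- (z - 1)) * (2 * rising (z - 1) i.*2.+1 * RtoC (/ (2 * x)) ^ i.*2.+1) =
  rising (z - 1) i.*2.+1 * RtoC (/ 4 ^ i) * Rcpow x (- (z + INR i.*2)).
Proof.
move=> Hx.
have Hnz : RtoC x <> 0 by move=> /RtoC_inj; lra.
have -> : - (z + INR i.*2) = - (z - 1) + - (INR i.*2.+1).
  by rewrite S_INR RtoC_plus; ring.
rewrite Rcpow_plus Rcpow_opp_INR; last lra.
have -> : (/ (2 * x) = / 2 * / x)%R by field; lra.
rewrite RtoC_mult Cpow_mult_l -(RtoC_pow_nat (/ 2)) CpowS -tech_pow_Rmult pow_double.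
have -> : (/ 2 * / 2 = / 4)%R by lra.
have -> : (/ 2 * (/ 4) ^ i = / 4 ^ i / 2)%R by rewrite pow_inv; lra.
rewrite /Rdiv RtoC_mult (RtoC_inv 2); last lra.
by field => /RtoC_inj; lra.
Qed.

Lemma gapprox_base a z : (0 <= a)%R -> (2 < Re z)%R -> gapprox a 1 z = gapprox a 0 z.
Proof.
move=> Ha Hz; set w := z - 1.
have Hrho := Cmod_ge_0 w.
have [C0 [H0 HC]] := rising_bound_geom Hrho.
(* Summed over [i], this array gives differences that telescope in [k]; summed over [k], it gives
   zeta values at z + 2 i. The ratio 4/9 below is (4/3)^2 / 4, with 4/3 the growth allowed for
   [rising]. *)
pose m i k := rising w i.*2.+1 * RtoC (/ 4 ^ i)%R * Rcpow (shifted a k) (- (z + INR i.*2)).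
have Hi4 i : (0 < / 4 ^ i)%R by apply: Rinv_0_lt_compat; apply: pow_lt; lra.
have Hrow i K : (rsum (fun k => Cmod (m i k)) K <= C0 * (8 / 3) * (4 / 9) ^ i)%R.
  rewrite (rsum_ext (v := fun k => (Cmod (rising w i.*2.+1) * / 4 ^ i) *
     Cmod (Rcpow (shifted a k) (- (z + INR i.*2))))%R); last first.
    move=> k; rewrite /m !Cmod_mult (Cmod_RtoC_pos (x := (/ 4 ^ i)%R)) //; exact: Rlt_le.
  rewrite rsum_mulr.
  have h1 : (rsum (fun k => Cmod (Rcpow (shifted a k) (- (z + INR i.*2)))) K <= 2)%R.
    by apply: hseries_abs => //; rewrite Re_plus_INR; have := pos_INR i.*2; lra.
  have h2 := Rle_trans _ _ _ (Cmod_rising i.*2.+1 (Rle_refl (Cmod w))) (HC i.*2.+1).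
  have h3 : (C0 * (4 / 3) ^ i.*2.+1 * / 4 ^ i * 2 = C0 * (8 / 3) * (4 / 9) ^ i)%R.
    rewrite -tech_pow_Rmult pow_double.
    have -> : (4 / 9 = (4 / 3 * (4 / 3)) * / 4)%R by lra.
    by rewrite (Rpow_mult_distr (4 / 3 * (4 / 3))) pow_inv; lra.
  rewrite -h3; apply: Rmult_le_compat => //.
  - apply: Rmult_le_pos; [exact: Cmod_ge_0 | exact: Rlt_le].
  - by apply: rsum_ge0 => k; apply: Cmod_ge_0.
  - by apply: Rmult_le_compat_r h2; apply: Rlt_le.
have Hex : ex_series (fun i => C0 * (8 / 3) * (4 / 9) ^ i)%R.
  apply: (ex_series_scal_l (K := R_AbsRing) (V := R_NormedModule)).
  by apply: ex_series_geom; rewrite Rabs_pos_eq; lra.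
have [F1 [F2 _]] := cseries_Fubini Hrow Hex.
have Hcol k : Cseries (fun i => m i k) =
    Rcpow (shifted a k - / 2) (- w) - Rcpow (shifted a k + / 2) (- w).
  apply: Cseries_unique.
  have [h1 [h2 h3]] := shifted_ge k Ha; set x := shifted a k in h1 h2 h3 *.
  have Hx2 : (0 < / (2 * x) <= / 2)%R.
    by split; [apply: Rinv_0_lt_compat; lra | apply: Rinv_le_contravar; lra].
  have := cseries_scal (Rcpow x (- w)) (cseries_binomial_odd w (u := (/ (2 * x))%R)
     ltac:(rewrite Rabs_pos_eq; lra)).
  have -> : Rcpow x (- w) * (Rcpow (1 - / (2 * x)) (- w) - Rcpow (1 + / (2 * x)) (- w)) =
    Rcpow (x - / 2) (- w) - Rcpow (x + / 2) (- w).
    have -> : (x - / 2 = x * (1 - / (2 * x)))%R by field; lra.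
    have -> : (x + / 2 = x * (1 + / (2 * x)))%R by field; lra.
    by rewrite !Rcpow_mult; try lra; ring.
  by apply: cseries_ext => i; rewrite /m /w telescoped_term //; lra.
have Hrowv i : Cseries (m i) = rising w i.*2.+1 * RtoC (/ 4 ^ i)%R * hseries a (z + INR i.*2).
  apply: Cseries_unique; apply: cseries_scal; apply: hseries_cseries => //.
  by rewrite Re_plus_INR; have := pos_INR i.*2; lra.
(* The upper half-step of [k] is the lower one of [k + 1], so only the starting point a + 1/2
   remains; as Re z > 2, the remainder is at most the inverse of its base. *)
have Htel : cseries (fun k => Rcpow (shifted a k - / 2) (- w) - Rcpow (shifted a k + / 2) (- w))
    (Rcpow (a + / 2) (- w)).
  apply/cseries_eps => eps He.
  have [N HN] := INR_unbounded (/ eps).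
  exists N => n Hn.
  have -> : csum (fun k => Rcpow (shifted a k - / 2) (- w) - Rcpow (shifted a k + / 2) (- w)) n -
     Rcpow (a + / 2) (- w) = - Rcpow (shifted a n + / 2) (- w).
    elim: n {Hn} => [|n IH].
      by rewrite csum0 (_ : (shifted a 0 - / 2 = a + / 2)%R); [ring | rewrite /shifted /=; lra].
    rewrite csumS (_ : (shifted a n.+1 - / 2 = shifted a n + / 2)%R); last first.
      by rewrite /shifted (S_INR n.+1); lra.
    have -> : forall x y t : C, x + (y - t) - Rcpow (a + / 2) (- w) =
      (x - Rcpow (a + / 2) (- w)) + (y - t) by move=> x y t; ring.
    by rewrite IH; ring.
  rewrite Cmod_opp Cmod_Rcpow.
  have [h1 [h2 h3]] := shifted_ge n Ha.
  have hn : (0 < INR n.+1)%R := INRS_pos n.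
  have hN : (INR N <= INR n)%R by apply: le_INR; lia.
  have he : (0 < / eps)%R by apply: Rinv_0_lt_compat.
  apply: (Rle_lt_trans _ (Rpower (shifted a n + / 2) (- (1)))).
    apply: Rpower_le_exponent; first lra.
    by rewrite /w (_ : Re (- (z - 1)) = - (Re z - 1))%R //; lra.
  rewrite Rpower_Ropp Rpower_1; last lra.
  rewrite -(Rinv_inv eps); apply: Rinv_lt_contravar.
    by apply: Rmult_lt_0_compat; lra.
  by rewrite S_INR in h2; lra.
have Etot : Rcpow (a + / 2) (- w) = Cseries (fun i => Cseries (m i)).
  by apply: cseries_lim_unique Htel _; apply: cseries_ext F1 => k; rewrite Hcol.
(* The row i = 0 is z - 1 times the zeta value at z itself; taking it out solves for
   [gapprox a 0 z]. *)
have F3 := cseries_behead F2.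
rewrite gapproxS /gstep.
have -> : Cseries (fun i => gcoef i z * gapprox a 0 (z + INR i.+1.*2)) =
   Cseries (fun i => Cseries (m i)) - Cseries (m 0%N).
  apply: Cseries_unique; apply: cseries_ext F3 => i.
  rewrite Hrowv /gcoef risingS -/w.
  have E4 : RtoC (/ (4 ^ i.+1 * INR i.+1.*2.+1)) = RtoC (/ 4 ^ i.+1) / INR i.+1.*2.+1.
    rewrite Rinv_mult RtoC_mult (RtoC_inv (INR _)) //.
    by have := INRS_pos i.+1.*2; lra.
  rewrite E4 gapprox0 /w.
  by field; apply: INRS_neq0.
rewrite -Etot Hrowv (_ : 1 - z = - w); last by rewrite /w; ring.
rewrite /= (_ : z + 0 = z); last ring.
by rewrite Rinv_1 /w; field.
Qed.

(** A step evaluates its argument only at distance 2 or more to the right, so equality of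
    consecutive approximants on a half-plane passes to the next pair on a half-plane wider by 2. No
    identity theorem is involved. *)
Lemma gapprox_stable a M z : (0 <= a)%R -> (2 - 2 * INR M < Re z)%R ->
  gapprox a M.+1 z = gapprox a M z.
Proof.
move=> Ha; elim: M z => [|M IH] z Hz; first by apply: gapprox_base => //; rewrite /= in Hz; lra.
rewrite gapproxS [RHS]gapproxS /gstep.
congr (_ - _); apply: Cseries_ext => i; rewrite IH // Re_plus_INR.
by rewrite S_INR in Hz; rewrite INR_double S_INR; have := pos_INR i; lra.
Qed.

Lemma gapprox_stable_add a M k z : (0 <= a)%R -> (2 - 2 * INR M < Re z)%R ->
  gapprox a (k + M) z = gapprox a M z.
Proof.
move=> Ha Hz; elim: k => [|k IH] //; rewrite addSn gapprox_stable //.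
by rewrite plus_INR; have := pos_INR k; lra.
Qed.

Lemma gapprox_large a M z : (0 <= a)%R -> (2 < Re z)%R ->
  gapprox a M z = (z - 1) * hseries a z.
Proof. by move=> Ha Hz; rewrite -(addn0 M) gapprox_stable_add //= ; lra. Qed.

Lemma majorized_translate s0 r B f (d : C) :
  majorized (s0 + d) r B f -> majorized s0 r B (fun s => f (s + d)).
Proof.
move=> H; have := @majorized_affine s0 r B f 1 d.
rewrite Cmod_1 Rmult_1_l Cmult_1_l => /(_ H); apply: majorized_ext => s _.
by rewrite Cmult_1_l.
Qed.

Lemma analytic_at_translate F (d s0 : C) :
  analytic_at F (s0 + d) -> analytic_at (fun s => F (s + d)) s0.
Proof.
move=> /analytic_at_majorized [r [B [Hr M]]]; apply/analytic_at_majorized.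
by exists r, B; split => //; apply: majorized_translate.
Qed.

Lemma Re_near s s0 r : (Cmod (s - s0) <= r)%R -> (Re s0 - r <= Re s <= Re s0 + r)%R.
Proof.
move=> H; have := Rle_trans _ _ _ (re_le_Cmod (s - s0)) H.
by rewrite (_ : Re (s - s0) = Re s - Re s0)%R // => /Rabs_le_between; lra.
Qed.

Lemma analytic_hseries a s0 : (0 <= a)%R -> (2 < Re s0)%R -> analytic_at (hseries a) s0.
Proof.
move=> Ha Hs; apply/analytic_at_majorized.
have Hr : (0 < Re s0 - 2)%R by lra.
have Hle : (2 + 0 <= Re s0 - (Re s0 - 2))%R by lra.
have [H _] := majorized_hseries Ha Hr (Rle_refl 0) Hle.
by exists (Re s0 - 2)%R; eexists; split; [lra | exact: H].
Qed.

(** [rho] bounds the norm of [s - 1] on the unit disc about [s0]. The condition on [i] moves the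
    shifted disc into the half-plane Re > 2, where [gapprox a M] is given by the series for every
    [M]. *)
Lemma majorized_gstep_term a M s0 : (0 <= a)%R -> exists K, (0 <= K)%R /\
  forall i, (3 < Re s0 + 2 * INR i)%R ->
    majorized s0 1 (K * (4 / 9) ^ i) (fun s => gcoef i s * gapprox a M (s + RtoC (INR i.+1.*2))).
Proof.
move=> Ha.
pose rho := (Cmod (s0 - 1) + 1)%R.
have Hrho : (1 <= rho)%R by have := Cmod_ge_0 (s0 - 1); rewrite /rho; lra.
have [C0 [H0 HC]] := rising_bound_geom (rho := rho) ltac:(lra).
exists (2 * C0 * (rho + 1) * (4 / 9))%R; split.
  by apply: Rmult_le_pos; [apply: Rmult_le_pos; [lra | lra] | lra].
move=> i Hi.
have Hlin : majorized s0 1 rho (fun s => s - 1).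
  have := majorized_translate (majorized_id (s0 + - (1)) Rlt_0_1).
  by apply: majorized_ext.
have Hlin2 := majorized_plus (Rlt_le _ _ Rlt_0_1) Hlin (majorized_const s0 1 (INR i.+1.*2)).
rewrite Cmod_RtoC_pos in Hlin2; last exact: pos_INR.
have HRe : (2 + 0 <= Re (s0 + RtoC (INR i.+1.*2)) - 1)%R.
  by rewrite Re_plus_INR INR_double S_INR; lra.
have [Hh _] := majorized_hseries Ha Rlt_0_1 (Rle_refl 0) HRe.
have Hh' := majorized_translate Hh.
have Hg : majorized s0 1 ((rho + INR i.+1.*2) * 2)
    (fun s => gapprox a M (s + RtoC (INR i.+1.*2))).
  have := majorized_mult Rlt_0_1 Hlin2 Hh'.
  rewrite Ropp_0 Rpower_O ?Rmult_1_r; last lra.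
  apply: majorized_ext => s /Re_near Hs.
  rewrite gapprox_large //; first by congr (_ * _); ring.
  by rewrite Re_plus_INR INR_double S_INR; lra.
have Hc : majorized s0 1 (/ (4 ^ i.+1 * INR i.+1.*2.+1) * rising_bound rho i.+1.*2) (gcoef i).
  have := majorized_scal (RtoC (/ (4 ^ i.+1 * INR i.+1.*2.+1))) (majorized_rising i.+1.*2 Rlt_0_1 Hlin).
  rewrite Cmod_RtoC_pos; last first.
    apply: Rlt_le; apply: Rinv_0_lt_compat; apply: Rmult_lt_0_compat (INRS_pos _).
    by apply: pow_lt; lra.
  by apply: majorized_ext => s _; rewrite /gcoef Cmult_comm.
apply: majorized_le (majorized_mult Rlt_0_1 Hc Hg).
set n := i.+1.*2.
have Hn := pos_INR n.
have h4 : (0 < 4 ^ i.+1)%R by apply: pow_lt; lra.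
have hq : (rising_bound rho n <= C0 * (16 / 9) ^ i.+1)%R.
  have := HC n; rewrite /n pow_double (_ : 4 / 3 * (4 / 3) = 16 / 9)%R //; lra.
have hp : (0 < (16/9) ^ i.+1)%R by apply: pow_lt; lra.
have e9 : ((16 / 9) ^ i.+1 = 4 ^ i.+1 * (4 / 9 * (4 / 9) ^ i))%R.
  by rewrite tech_pow_Rmult -Rpow_mult_distr; f_equal; lra.
have hn : ((rho + INR n) / INR n.+1 <= rho + 1)%R.
  rewrite S_INR; apply: (Rmult_le_reg_r (INR n + 1)); first lra.
  by rewrite /Rdiv Rmult_assoc Rinv_l; nra.
have hn0 : (0 <= (rho + INR n) / INR n.+1)%R.
  by apply: Rle_mult_inv_pos (INRS_pos n); lra.
have -> : (/ (4 ^ i.+1 * INR n.+1) * rising_bound rho n * ((rho + INR n) * 2) =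
   2 * (rising_bound rho n / 4 ^ i.+1) * ((rho + INR n) / INR n.+1))%R.
  by field; split; [have := INRS_pos n |]; lra.
have hr0 := rising_bound_ge0 n (rho := rho) ltac:(lra).
have hr1 : (rising_bound rho n / 4 ^ i.+1 <= C0 * (4 / 9 * (4 / 9) ^ i))%R.
  apply: (Rmult_le_reg_r (4 ^ i.+1)) => //.
  rewrite /Rdiv Rmult_assoc Rinv_l; last lra.
  by move: hq; rewrite e9; lra.
have hr2 : (0 <= rising_bound rho n / 4 ^ i.+1)%R by apply: Rle_mult_inv_pos.
have := Rmult_le_compat _ _ _ _ hr2 hn0 hr1 hn; lra.
Qed.

Lemma analytic_gcoef i s0 : analytic_at (gcoef i) s0.
Proof.
apply: analytic_at_mult; last exact: analytic_at_const.
apply: (analytic_at_rising (f := fun z => z - 1)).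
by apply: analytic_at_minus; [apply: analytic_at_id | apply: analytic_at_const].
Qed.

Lemma geom_ratio_49 : (0 <= 4 / 9 < 1)%R.
Proof. lra. Qed.

Lemma exists_tail_index (x : R) : exists I : nat, forall i, (I <= i)%N -> (3 < x + 2 * INR i)%R.
Proof.
have [I HI] := INR_unbounded (3 - x + Rabs x).
exists I => i Hi; have : (INR I <= INR i)%R by apply: le_INR; lia.
by have := pos_INR i; have := Rabs_pos x; split_Rabs; lra.
Qed.

(** Finitely many terms of a step are analytic by induction, as their arguments lie at least 2 to
    the right; the rest is a majorized tail. *)
Lemma analytic_gapprox a M s0 : (0 <= a)%R -> (2 - 2 * INR M < Re s0)%R ->
  analytic_at (gapprox a M) s0.
Proof.
move=> Ha; elim: M s0 => [|M IH] s0 Hs.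
  rewrite /= in Hs; apply: (analytic_at_mult (F := fun z => z - 1)).
    by apply: analytic_at_minus; [apply: analytic_at_id | apply: analytic_at_const].
  by apply: analytic_hseries => //; lra.
apply: analytic_at_minus.
  apply: (analytic_at_ext (r := 1%R) (F := fun s => Rcpow (a + / 2) (RtoC (-1) * s + 1))); first lra.
    by move=> s _; f_equal; ring.
  apply: (analytic_at_affine (F := Rcpow (a + / 2))); last exact: analytic_at_Rcpow.
  by move=> /RtoC_inj; lra.
have [K [HK Hmaj]] := majorized_gstep_term M s0 Ha.
have [I HI] := exists_tail_index (Re s0).
have [T [HT HTs]] := cseries_split_tail HK geom_ratio_49 (fun i Hi => Hmaj i (HI i Hi)).
apply: (analytic_at_ext Rlt_0_1 (F := fun s => csum (fun i => if (i < I)%N then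
   gcoef i s * gapprox a M (s + RtoC (INR i.+1.*2)) else RtoC 0) I + T s)).
  by move=> s Hsr; symmetry; apply: Cseries_unique; apply: HTs; lra.
apply: analytic_at_plus => //; apply: analytic_at_csum => i _.
case: ltnP => _; last exact: analytic_at_const.
apply: analytic_at_mult; first exact: analytic_gcoef.
apply: analytic_at_translate; apply: IH.
by rewrite Re_plus_INR INR_double S_INR; rewrite S_INR in Hs; have := pos_INR i; lra.
Qed.

(** The entire function (z - 1) zeta(z, 1 + a), glued from the approximants: by [gfunE] any
    admissible [M] gives the same value. *)
Definition gfun (a : R) (z : C) : C :=
  gapprox a (epsilon (inhabits 0%N) (fun M => (2 - 2 * INR M < Re z)%R)) z.

Lemma gfunE a M z : (0 <= a)%R -> (2 - 2 * INR M < Re z)%R -> gfun a z = gapprox a M z.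
Proof.
move=> Ha HM; rewrite /gfun; set M' := epsilon _ _.
have HM' : (2 - 2 * INR M' < Re z)%R by exact: (epsilon_spec (inhabits 0%N) (fun M => (2 - 2 * INR M < Re z)%R) (ex_intro _ M HM)).
by rewrite -(gapprox_stable_add M' Ha HM) addnC gapprox_stable_add.
Qed.

Lemma exists_strip (x : R) : exists M, (2 - 2 * INR M < x)%R.
Proof.
have [M HM] := INR_unbounded (2 + Rabs x).
by exists M; have := Rabs_pos x; split_Rabs; lra.
Qed.

Lemma analytic_gfun a s0 : (0 <= a)%R -> analytic_at (gfun a) s0.
Proof.
move=> Ha; have [M HM] := exists_strip (Re s0 - 1).
apply: (analytic_at_ext Rlt_0_1 (F := gapprox a M)); last by apply: analytic_gapprox; lra.
by move=> s /Rlt_le /Re_near Hs; rewrite (gfunE (M := M)) //; lra.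
Qed.

Lemma rising_0 n : rising 0 n.+1 = 0.
Proof.
elim: n => [|n IH]; rewrite risingS; last by rewrite IH; field; apply: INRS_neq0.
by rewrite /=; field.
Qed.

(** At z = 1 every correction carries a rising factorial of 0, which leaves a zeroth power. The
    value is the residue of the Hurwitz zeta function. *)
Lemma gfun_1 a : (0 <= a)%R -> gfun a 1 = 1.
Proof.
move=> Ha; rewrite (gfunE (M := 1%N)) //; last by rewrite /=; lra.
rewrite gapproxS /gstep (_ : 1 - 1 = 0) ?Rcpow_0; last ring.
have -> : Cseries (fun i => gcoef i 1 * gapprox a 0 (1 + RtoC (INR i.+1.*2))) = 0.
  apply: Cseries_unique; apply: cseries_ext cseries0 => i.
  rewrite /gcoef (_ : 1 - 1 = 0); last ring.
  by rewrite doubleS rising_0; ring.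
ring.
Qed.

(** The value at z = 1 has no meaning; [desingularized] deals with that pole. *)
Definition hfun (a : R) (z : C) : C := gfun a z / (z - 1).

Lemma hfun_large a z : (0 <= a)%R -> (2 < Re z)%R -> hfun a z = hseries a z.
Proof.
move=> Ha Hz; rewrite /hfun (gfunE (M := 0%N)) //; last by rewrite /=; lra.
rewrite gapprox0; field => E.
have : Re (z - 1) = 0%R by rewrite E.
by rewrite (_ : Re (z - 1) = Re z - 1)%R //; lra.
Qed.

Lemma analytic_hfun a (s0 : C) : (0 <= a)%R -> s0 <> 1 -> analytic_at (hfun a) s0.
Proof.
move=> Ha Hs; apply: (analytic_at_mult (F := gfun a) (G := fun z => / (z - 1))).
  exact: analytic_gfun.
exact: analytic_at_inv.
Qed.

Lemma weakly_meromorphic_hfun a (s0 : C) : (0 <= a)%R -> weakly_meromorphic_at (hfun a) s0.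
Proof.
move=> Ha; have [E|N] := excluded_middle_informative (s0 = 1); last first.
  by apply: analytic_weakly_meromorphic; apply: analytic_hfun.
exists 1%N, (gfun a), 1%R; split; first exact: analytic_gfun.
split; first lra.
by move=> s [/Csub_neq0 Hs _]; rewrite /hfun E in Hs *; field.
Qed.

(** * Reality on the real axis *)

Lemma Im_mult_real z w : Im z = 0%R -> Im w = 0%R -> Im (z * w) = 0%R.
Proof. by case: z => a b; case: w => c d /= -> ->; ring. Qed.

Lemma Im_plus_real z w : Im z = 0%R -> Im w = 0%R -> Im (z + w) = 0%R.
Proof. by case: z => a b; case: w => c d /= -> ->; ring. Qed.

Lemma Im_opp_real z : Im z = 0%R -> Im (- z) = 0%R.
Proof. by case: z => a b /= ->; ring. Qed.

Lemma Im_sub1_real z : Im z = 0%R -> Im (z - 1) = 0%R.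
Proof. by move=> Hz; apply: Im_plus_real => //; apply: Im_opp_real. Qed.

Lemma Im_inv_real z : Im z = 0%R -> Im (/ z) = 0%R.
Proof. by case: z => a b /= ->; rewrite Ropp_0 /Rdiv Rmult_0_l. Qed.

Lemma Im_Cseries_real (f : nat -> C) : (forall n, Im (f n) = 0%R) -> Im (Cseries f) = 0%R.
Proof.
move=> H; rewrite /= (Series_ext _ (fun _ => 0%R)) //.
apply: is_series_unique; apply/rseries_eps => eps He; exists 0%N => n _.
by rewrite (_ : rsum _ n = 0%R) ?Rminus_0_r ?Rabs_R0 //; elim: n => [|n IH]; rewrite ?rsum0 ?rsumS ?IH; lra.
Qed.

Lemma Im_Rcpow_real x s : Im s = 0%R -> Im (Rcpow x s) = 0%R.
Proof. by move=> Hs; rewrite /Rcpow /Cexp /= (_ : (_ + _ = 0)%R) ?sin_0; rewrite ?[s.2]Hs; ring. Qed.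

Lemma Im_rising_real s n : Im s = 0%R -> Im (rising s n) = 0%R.
Proof.
move=> Hs; elim: n => [|n IH] //; rewrite risingS.
apply: Im_mult_real; last by apply: Im_inv_real.
by apply: Im_mult_real => //; apply: Im_plus_real.
Qed.

Lemma Im_gapprox_real a M z : Im z = 0%R -> Im (gapprox a M z) = 0%R.
Proof.
elim: M z => [|M IH] z Hz.
  apply: Im_mult_real; first exact: Im_sub1_real.
  by apply: Im_Cseries_real => n; apply: Im_Rcpow_real; apply: Im_opp_real.
rewrite gapproxS; apply: Im_plus_real.
  by apply: Im_Rcpow_real; apply: Im_plus_real => //; apply: Im_opp_real.
apply: Im_opp_real; apply: Im_Cseries_real => i.
apply: Im_mult_real; last by apply: IH; apply: Im_plus_real.
by apply: Im_mult_real => //; apply: Im_rising_real; apply: Im_sub1_real.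
Qed.

(** Makes the zeta derivatives of the final formula real, as is needed for the determinant to be a
    positive real number. *)
Lemma Im_hfun_real a z : Im z = 0%R -> Im (hfun a z) = 0%R.
Proof.
move=> Hz; apply: Im_mult_real; first exact: Im_gapprox_real.
by apply: Im_inv_real; apply: Im_sub1_real.
Qed.

(** * Coefficients of the anomaly *)

(* [1 + s fcoef s n] is the product of [1 + s / i] for [1 <= i <= n]. *)
Definition fcoef (s : C) : nat -> C :=
  fix q n := match n with 0 => RtoC 0 | m.+1 => q m + rising (s + 1) m / INR m.+1 end.

Definition fcoef_bound (rho : R) : nat -> R :=
  fix q n := match n with 0 => 0%R | m.+1 => (q m + rising_bound (rho + 1) m / INR m.+1)%R end.

Lemma fcoefS s n : fcoef s n.+1 = fcoef s n + rising (s + 1) n / INR n.+1.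
Proof. by []. Qed.

Lemma fcoef_boundS rho n :
  fcoef_bound rho n.+1 = (fcoef_bound rho n + rising_bound (rho + 1) n / INR n.+1)%R.
Proof. by []. Qed.

Lemma rising_succ_fcoef s n : rising (s + 1) n = 1 + s * fcoef s n.
Proof.
elim: n => [|n IH]; first by rewrite /=; ring.
rewrite risingS fcoefS IH S_INR RtoC_plus.
have H : RtoC (INR n) + 1 <> 0 by rewrite -RtoC_plus -S_INR; apply: INRS_neq0.
by field.
Qed.

Lemma rising_shift s n : rising s n.+1 = s / INR n.+1 * rising (s + 1) n.
Proof.
elim: n => [|n IH]; first by rewrite /=; field.
rewrite risingS IH [rising (s + 1) n.+1]risingS.
rewrite (_ : s + INR n.+1 = s + 1 + INR n); last by rewrite S_INR RtoC_plus; ring.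
by field; split; apply: INRS_neq0.
Qed.

Lemma rising_fcoef s n : rising s n.+1 = s / INR n.+1 * (1 + s * fcoef s n).
Proof. by rewrite rising_shift rising_succ_fcoef. Qed.

Definition dcoef (i : nat) (s : C) : C :=
  (fcoef s i - 2 * fcoef (2 * s) i.*2.+1) / INR i.+1.

(* The first order terms in [s] cancel: this is why the anomaly is local. *)
Lemma rising_sub_double s i :
  rising s i.+1 - rising (2 * s) i.+1.*2 = s * s * dcoef i s.
Proof.
rewrite doubleS !rising_fcoef /dcoef.
have -> : RtoC (INR i.*2.+2) = 2 * INR i.+1.
  by rewrite -doubleS INR_double RtoC_mult.
by field; apply: INRS_neq0.
Qed.

(** The product of 1 + s / i over i <= n has derivative H_n at 0; this is where the harmonic numbers
    of the formula come from. *)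
Lemma fcoef_0 n : fcoef 0 n = RtoC (harmonic n).
Proof.
have H1 k : rising 1 k = 1.
  elim: k => [|k IH] //; rewrite risingS IH S_INR RtoC_plus; field.
  by rewrite -RtoC_plus -S_INR; apply: INRS_neq0.
rewrite /harmonic; elim: n => [|n IH].
  by rewrite sum_n_m_zero //; lia.
rewrite fcoefS IH (_ : 0 + 1 = 1); last ring.
rewrite H1 sum_n_Sm; last lia.
rewrite (_ : forall x y : R, plus x y = (x + y)%R) // RtoC_plus RtoC_inv; last   by have := INRS_pos n; lra.
by rewrite /Cdiv Cmult_1_l.
Qed.

Lemma dcoef_0 i : dcoef i 0 = RtoC ((harmonic i - 2 * harmonic i.*2.+1) / INR i.+1).
Proof.
rewrite /dcoef Cmult_0_r !fcoef_0 RtoC_div; last by have := INRS_pos i; lra.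
by rewrite RtoC_minus RtoC_mult.
Qed.

Lemma majorized_fcoef s0 r rho f n : (0 < r)%R ->
  majorized s0 r rho f -> majorized s0 r (fcoef_bound rho n) (fun s => fcoef (f s) n).
Proof.
move=> Hr Hf; elim: n => [|n IH].
  by have := majorized_const s0 r 0; rewrite Cmod_0.
have Hf1 := majorized_plus (Rlt_le _ _ Hr) Hf (majorized_const s0 r 1); rewrite Cmod_1 in Hf1.
have := majorized_plus (Rlt_le _ _ Hr) IH
  (majorized_scal (/ RtoC (INR n.+1)) (majorized_rising n Hr Hf1)).
rewrite Cmod_inv; last exact: INRS_neq0.
rewrite Cmod_RtoC_pos; last exact: pos_INR.
rewrite fcoef_boundS (Rmult_comm (/ _)).
by apply: majorized_ext => s _; rewrite fcoefS /Cdiv; ring.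
Qed.

Lemma fcoef_bound_geom rho w : (0 <= rho)%R -> (1 < w)%R ->
  exists K, (0 <= K)%R /\ forall n, (fcoef_bound rho n <= K * w ^ n)%R.
Proof.
move=> Hr Hw.
have Hv : (0 < / w < 1)%R.
  by split; [apply: Rinv_0_lt_compat; lra | rewrite -Rinv_1; apply: Rinv_lt_contravar; lra].
have Hr1 : (0 <= rho + 1)%R by lra.
have [C0 [H0 HC]] := rising_bound_subexp Hr1 Hv; rewrite Rinv_inv in HC.
(* The increments are at most [C0 * w ^ n], which are exactly the increments of
   [C0 / (w - 1) * w ^ n]. *)
have HK : (0 <= C0 / (w - 1))%R by apply: Rle_mult_inv_pos; lra.
exists (C0 / (w - 1))%R; split => // n.
elim: n => [|n IH]; first by rewrite /=; lra.
rewrite fcoef_boundS.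
have hw : (0 < w ^ n)%R by apply: pow_lt; lra.
have h1 : (rising_bound (rho + 1) n / INR n.+1 <= C0 * w ^ n)%R.
  have hn : (1 <= INR n.+1)%R by rewrite S_INR; have := pos_INR n; lra.
  apply: Rle_trans (HC n); apply: (Rmult_le_reg_r (INR n.+1)); first lra.
  rewrite /Rdiv Rmult_assoc Rinv_l; last lra.
  by have := rising_bound_ge0 n Hr1; nra.
have -> : (C0 / (w - 1) * w ^ n.+1 = C0 / (w - 1) * w ^ n + C0 * w ^ n)%R.
  by rewrite /=; field; lra.
lra.
Qed.

(** [w] stays free above 1 because it has to be compensated by a / (1 + a), which approaches 1 as
    the dimension grows. The square comes from the index 2 i + 1. *)
Lemma majorized_dcoef s0 w : (1 < w)%R -> exists K, (0 <= K)%R /\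
  forall i, majorized s0 1 (K * (w * w) ^ i) (dcoef i).
Proof.
move=> Hw.
have Hid := majorized_id s0 Rlt_0_1.
have Hid2 := majorized_scal 2 Hid.
have Hrho : (0 <= Cmod s0 + 1)%R by have := Cmod_ge_0 s0; lra.
have Hrho2 : (0 <= Cmod 2 * (Cmod s0 + 1))%R by apply: Rmult_le_pos => //; apply: Cmod_ge_0.
have [K1 [H1 HK1]] := fcoef_bound_geom Hrho Hw.
have [K2 [H2 HK2]] := fcoef_bound_geom Hrho2 Hw.
exists (K1 + 2 * (K2 * w))%R; split.
  by have : (0 <= K2 * w)%R; [apply: Rmult_le_pos; lra | lra].
move=> i.
have := majorized_scal (/ RtoC (INR i.+1)) (majorized_plus (Rlt_le _ _ Rlt_0_1)
  (majorized_fcoef i Rlt_0_1 Hid) (majorized_scal (- (2)) (majorized_fcoef i.*2.+1 Rlt_0_1 Hid2))).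
rewrite Cmod_opp Cmod_inv; last exact: INRS_neq0.
rewrite (Cmod_RtoC_pos (x := INR i.+1)); last exact: pos_INR.
move=> H; have {H} H : majorized s0 1 (/ INR i.+1 * (fcoef_bound (Cmod s0 + 1) i +
  Cmod 2 * fcoef_bound (Cmod 2 * (Cmod s0 + 1)) i.*2.+1)) (dcoef i).
  by apply: majorized_ext H => s _; rewrite /dcoef; field; apply: INRS_neq0.
apply: majorized_le H.
have E2 : Cmod 2 = 2%R by rewrite Cmod_RtoC_pos; lra.
rewrite {1}E2.
have h1 := HK1 i; have h2 := HK2 i.*2.+1.
rewrite -tech_pow_Rmult pow_double in h2.
have hw : (1 <= w ^ i)%R by apply: pow_R1_Rle; lra.
have hww : (w ^ i <= (w * w) ^ i)%R by rewrite Rpow_mult_distr; nra.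
have hn : (/ INR i.+1 <= 1)%R.
  by rewrite -Rinv_1; apply: Rinv_le_contravar; [lra | rewrite S_INR; have := pos_INR i; lra].
have hn0 : (0 < / INR i.+1)%R by apply: Rinv_0_lt_compat; apply: INRS_pos.
set X := (fcoef_bound _ i + _)%R.
have hX : (X <= (K1 + 2 * (K2 * w)) * (w * w) ^ i)%R.
  rewrite /X; have : (K1 * w ^ i <= K1 * (w * w) ^ i)%R by apply: Rmult_le_compat_l.
  lra.
have hB : (0 <= (K1 + 2 * (K2 * w)) * (w * w) ^ i)%R.
  apply: Rmult_le_pos; last by lra.
  by have : (0 <= K2 * w)%R; [apply: Rmult_le_pos; lra | lra].
nra.
Qed.

Lemma analytic_dcoef i s0 : analytic_at (dcoef i) s0.
Proof.
have Hw : (1 < 2)%R by lra.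
have [K [HK H]] := majorized_dcoef s0 Hw.
by apply/analytic_at_majorized; exists 1%R; eexists; split; [lra | exact: (H i)].
Qed.

(** * Continuation of the hemisphere zeta function *)

Definition poly_val (p : nat -> R) (D : nat) (x : R) : R := rsum (fun m => p m * x ^ m)%R D.

Definition zeta_comb (c : nat -> R) (D : nat) (s : C) : C :=
  csum (fun m => RtoC (c m) * hfun 0 (s - RtoC (INR m))) D.

(** The correction of index j = i + 1, with its factor s^2 taken out. *)
Definition anomaly_term (a : R) (p : nat -> R) (D i : nat) (s : C) : C :=
  RtoC (a ^ i.+1.*2) * dcoef i s *
  csum (fun m => RtoC (p m) * hfun a (2 * s + RtoC (INR i.+1.*2 - INR m))) D.

(* The continuation of [sum_x P(x) (x^2 - a^2)^(-s)] over [x = k + a], where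
   [al] and [be] are the coefficients of [P] in powers of [x - a] and [x + a]. *)
Definition continued (a : R) (p al be : nat -> R) (D : nat) (s : C) : C :=
  (zeta_comb al D (2 * s) + zeta_comb be D (2 * s)) / 2 +
  s * s * Cseries (fun i => anomaly_term a p D i s).

Lemma majorized_csum s0 r (B : nat -> R) (f : nat -> C -> C) D : (0 <= r)%R ->
  (forall m, (m <= D)%N -> majorized s0 r (B m) (f m)) ->
  majorized s0 r (rsum B D) (fun s => csum (fun m => f m s) D).
Proof.
move=> Hr; elim: D => [|D IH] H.
  by rewrite rsum0; apply: majorized_ext (H 0%N _) => // s _; rewrite csum0.
rewrite rsumS; apply: majorized_ext (majorized_plus Hr (IH _) (H D.+1 _)) => //.
  by move=> s _; rewrite csumS.
by move=> m Hm; apply: H; lia.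
Qed.

Lemma Re_2s (s : C) : Re (2 * s) = (2 * Re s)%R.
Proof. exact: re_scal_l. Qed.

Lemma Re_plus_RtoC (s : C) (x : R) : Re (s + RtoC x) = (Re s + x)%R.
Proof. by []. Qed.

Lemma Rpower_opp_INR x n : (0 < x)%R -> Rpower x (- INR n) = ((/ x) ^ n)%R.
Proof. by move=> Hx; rewrite Rpower_Ropp Rpower_pow // pow_inv. Qed.

Lemma majorized_anomaly_term a p D s0 : (0 <= a)%R ->
  exists K q I, (0 <= K)%R /\ (0 <= q < 1)%R /\ forall i, (I <= i)%N ->
    majorized s0 1 (K * q ^ i) (anomaly_term a p D i).
Proof.
move=> Ha.
(* Chosen so that w a / (1 + a) = 2 a / (1 + 2 a), the [X] below, is still less than 1: the growth
   of [dcoef] does not spoil the decay of a^(2 i) (1 + a)^(-2 i). *)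
pose w := ((2 + 2 * a) / (1 + 2 * a))%R.
have Hw : (1 < w)%R.
  by apply: (Rmult_lt_reg_r (1 + 2 * a)); rewrite /w /Rdiv ?Rmult_assoc ?Rinv_l; lra.
have [K3 [HK3 Hd]] := majorized_dcoef s0 Hw.
(* For s in the unit disc about [s0], whose image under doubling has radius 2, all arguments have
   real part at least 2 + c0 + 2 i. *)
pose c0 := (2 * Re s0 - INR D - 2)%R.
pose Pm := rsum (fun m => Rabs (p m)) D.
have HP : (0 <= Pm)%R by apply: rsum_ge0 => m; apply: Rabs_pos.
pose X := (2 * a / (1 + 2 * a))%R.
have HX0 : (0 <= X)%R by apply: Rle_mult_inv_pos; lra.
have HX1 : (X < 1)%R.
  by apply: (Rmult_lt_reg_r (1 + 2 * a)); rewrite /X /Rdiv ?Rmult_assoc ?Rinv_l; lra.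
have [I HI] := exists_tail_index (c0 + 3).
pose Rp := Rpower (1 + a) (- c0).
have HRp : (0 < Rp)%R by apply: exp_pos.
exists (a ^ 2 * K3 * (Pm * (2 * Rp)))%R, (X * X)%R, I; split.
  by repeat apply: Rmult_le_pos; try exact: pow2_ge_0; lra.
split; first by nra.
move=> i Hi; have HIi := HI i Hi.
pose y := (c0 + INR i.*2)%R.
have Hy' : (0 < y)%R by rewrite /y INR_double; lra.
have Hy := Rlt_le _ _ Hy'.
have Hh m : (m <= D)%N -> majorized s0 1 (Rabs (p m) * (2 * Rpower (1 + a) (- y)))
    (fun s => RtoC (p m) * hfun a (2 * s + RtoC (INR i.+1.*2 - INR m))).
  move=> Hm; rewrite -(Cmod_R (p m)); apply: majorized_scal.
  apply: majorized_affine.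
  rewrite Cmod_RtoC_pos ?Rmult_1_r; last lra.
  have hmD : (INR m <= INR D)%R by apply: le_INR; lia.
  have Hre : (2 + y <= Re (2 * s0 + RtoC (INR i.+1.*2 - INR m)) - 2)%R.
    by rewrite Re_plus_RtoC Re_2s /y /c0 !INR_double S_INR; lra.
  have [H _] := majorized_hseries Ha Rlt_0_2 Hy Hre.
  apply: majorized_ext H => s /Re_near Hs; symmetry; apply: hfun_large => //; lra.
have := majorized_mult Rlt_0_1 (majorized_scal (RtoC (a ^ i.+1.*2)) (Hd i))
  (majorized_csum (Rlt_le _ _ Rlt_0_1) Hh).
apply: majorized_le; rewrite Cmod_RtoC_pos; last exact: Rpow_ge0.
rewrite (rsum_ext (v := fun m => 2 * Rpower (1 + a) (- y) * Rabs (p m))%R); last by move=> m; ring.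
rewrite rsum_mulr -/Pm /y Ropp_plus_distr Rpower_plus Rpower_opp_INR; last lra.
rewrite -/Rp !doubleS !pow_double -!tech_pow_Rmult pow_double.
have -> : (X * X = a * a * (w * w) * (/ (1 + a) * / (1 + a)))%R.
  by rewrite /X /w; field; lra.
by rewrite !Rpow_mult_distr; apply: Req_le; ring.
Qed.

(** The cut may be placed at any large index, so that it can also be moved beyond the last term with
    a pole at the origin. *)
Lemma anomaly_split a p D s0 : (0 <= a)%R -> exists I0, forall I, (I0 <= I)%N ->
  exists T, analytic_at T s0 /\ forall s, (Cmod (s - s0) <= 1)%R ->
    Cseries (fun i => anomaly_term a p D i s) =
    csum (fun i => if (i < I)%N then anomaly_term a p D i s else RtoC 0) I + T s.
Proof.
move=> Ha; have [K [q [I0 [HK [Hq Hm]]]]] := majorized_anomaly_term p D s0 Ha.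
exists I0 => I HI.
have [T [HT HTs]] := cseries_split_tail HK Hq (fun i Hi => Hm i (leq_trans HI Hi)).
by exists T; split => // s Hs; apply: Cseries_unique; apply: HTs.
Qed.

Lemma two_neq0 : RtoC 2 <> 0.
Proof. by move=> /RtoC_inj; lra. Qed.

Lemma weakly_meromorphic_zeta_comb c D (s0 : C) :
  weakly_meromorphic_at (fun s => zeta_comb c D (2 * s)) s0.
Proof.
apply: (weakly_meromorphic_csum (F := fun m s => RtoC (c m) * hfun 0 (2 * s - RtoC (INR m)))) => m _.
apply: (weakly_meromorphic_mult (F := fun _ => RtoC (c m))); first exact: analytic_at_const.
apply: (weakly_meromorphic_affine (F := hfun 0)); first exact: two_neq0.
by apply: weakly_meromorphic_hfun; lra.
Qed.

Lemma analytic_zeta_comb c D (s0 : C) :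
  (forall m, (m <= D)%N -> s0 - RtoC (INR m) <> 1) -> analytic_at (zeta_comb c D) s0.
Proof.
move=> H.
apply: (analytic_at_csum (F := fun m s => RtoC (c m) * hfun 0 (s - RtoC (INR m)))) => m Hm.
apply: (analytic_at_mult (F := fun _ => RtoC (c m))); first exact: analytic_at_const.
apply: (analytic_at_translate (F := hfun 0)).
by apply: analytic_hfun; [lra | apply: H].
Qed.

Lemma analytic_zeta_comb2 c D (s0 : C) :
  (forall m, (m <= D)%N -> 2 * s0 - RtoC (INR m) <> 1) ->
  analytic_at (fun s => zeta_comb c D (2 * s)) s0.
Proof.
move=> H.
apply: (analytic_at_ext Rlt_0_1 (F := fun s => zeta_comb c D (2 * s + 0))).
  by move=> s _; f_equal; ring.
apply: (analytic_at_affine (F := zeta_comb c D)); first exact: two_neq0.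
apply: analytic_zeta_comb => m Hm; rewrite (_ : 2 * s0 + 0 = 2 * s0); [exact: H | ring].
Qed.

Lemma weakly_meromorphic_continued a p al be D (s0 : C) : (0 <= a)%R ->
  weakly_meromorphic_at (continued a p al be D) s0.
Proof.
move=> Ha; have [I HI] := anomaly_split p D s0 Ha.
have [T [HT HTs]] := HI I (leqnn I).
apply: (weakly_meromorphic_ext (F := fun s =>
  (/ 2 * zeta_comb al D (2 * s) + / 2 * zeta_comb be D (2 * s)) +
  s * s * (csum (fun i => if (i < I)%N then anomaly_term a p D i s else RtoC 0) I + T s))).
  exists 1%R; split; first lra.
  move=> s Hs; rewrite /continued HTs; last lra.
  by rewrite /Cdiv; ring.
have Hc : analytic_at (fun _ => / 2) s0 by apply: analytic_at_const.
apply: weakly_meromorphic_plus.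
  by apply: weakly_meromorphic_plus; apply: (weakly_meromorphic_mult Hc);
    apply: weakly_meromorphic_zeta_comb.
apply: (weakly_meromorphic_mult (F := fun s => s * s)).
  by apply: analytic_at_mult; apply: analytic_at_id.
apply: weakly_meromorphic_plus; last exact: analytic_weakly_meromorphic.
apply: (weakly_meromorphic_csum
  (F := fun i s => if (i < I)%N then anomaly_term a p D i s else RtoC 0)) => i _.
case: ltnP => _; last by apply: analytic_weakly_meromorphic; apply: analytic_at_const.
apply: (weakly_meromorphic_mult (F := fun s => RtoC (a ^ i.+1.*2) * dcoef i s)).
  by apply: analytic_at_mult; [apply: analytic_at_const | apply: analytic_dcoef].
apply: (weakly_meromorphic_csum
  (F := fun m s => RtoC (p m) * hfun a (2 * s + RtoC (INR i.+1.*2 - INR m)))) => m _.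
apply: (weakly_meromorphic_mult (F := fun _ => RtoC (p m))); first exact: analytic_at_const.
apply: (weakly_meromorphic_affine (F := hfun a)); first exact: two_neq0.
exact: weakly_meromorphic_hfun.
Qed.

Lemma Re_neq1 (z : C) : (2 < Re z)%R -> z <> 1.
Proof. by move=> H E; move: H; rewrite E /=; lra. Qed.

Lemma analytic_continued_right a p al be D (s0 : C) : (0 <= a)%R -> (INR D + 2 < Re s0)%R ->
  analytic_at (continued a p al be D) s0.
Proof.
move=> Ha Hs; have [I HI] := anomaly_split p D s0 Ha.
have [T [HT HTs]] := HI I (leqnn I).
have HD := pos_INR D.
have HmD m : (m <= D)%N -> (INR m <= INR D)%R by move=> Hm; apply: le_INR; lia.
apply: (analytic_at_ext Rlt_0_1 (F := fun s =>
  (/ 2 * zeta_comb al D (2 * s) + / 2 * zeta_comb be D (2 * s)) +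
  s * s * (csum (fun i => if (i < I)%N then anomaly_term a p D i s else RtoC 0) I + T s))).
  move=> s Hsr; rewrite /continued HTs; last lra.
  by rewrite /Cdiv; ring.
have Hz c : analytic_at (fun s => / 2 * zeta_comb c D (2 * s)) s0.
  apply: (analytic_at_mult (F := fun _ => / 2)); first exact: analytic_at_const.
  apply: analytic_zeta_comb2 => m Hm; apply: Re_neq1.
  rewrite (_ : Re (2 * s0 - RtoC (INR m)) = Re (2 * s0) - INR m)%R // Re_2s.
  by have := HmD m Hm; lra.
apply: analytic_at_plus; first by apply: analytic_at_plus; apply: Hz.
apply: (analytic_at_mult (F := fun s => s * s)).
  by apply: analytic_at_mult; apply: analytic_at_id.
apply: analytic_at_plus => //.
apply: (analytic_at_csum
  (F := fun i s => if (i < I)%N then anomaly_term a p D i s else RtoC 0)) => i _.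
case: ltnP => _; last exact: analytic_at_const.
apply: (analytic_at_mult (F := fun s => RtoC (a ^ i.+1.*2) * dcoef i s)).
  by apply: analytic_at_mult; [apply: analytic_at_const | apply: analytic_dcoef].
apply: (analytic_at_csum
  (F := fun m s => RtoC (p m) * hfun a (2 * s + RtoC (INR i.+1.*2 - INR m)))) => m Hm.
apply: (analytic_at_mult (F := fun _ => RtoC (p m))); first exact: analytic_at_const.
apply: (analytic_at_affine (F := hfun a)); first exact: two_neq0.
apply: analytic_hfun => //; apply: Re_neq1.
by rewrite Re_plus_RtoC Re_2s; have := HmD m Hm; have := pos_INR i.+1.*2; lra.
Qed.

(** * Derivatives at the origin *)

(** Differentiability in factored form with an analytic quotient: sums, affine substitutions and the
    removal of a factor [s] become algebra. *)
Definition has_cderiv (F : C -> C) (s0 l : C) : Prop :=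
  exists g r, analytic_at g s0 /\ g s0 = l /\ (0 < r)%R /\
    forall s, (Cmod (s - s0) < r)%R -> F s = F s0 + (s - s0) * g s.

Lemma has_cderiv_ext F G s0 l (r : R) : (0 < r)%R ->
  (forall s, (Cmod (s - s0) < r)%R -> F s = G s) -> has_cderiv F s0 l -> has_cderiv G s0 l.
Proof.
move=> Hr E [g [r' [Hg [Hl [Hr' Ef]]]]]; exists g, (Rmin r r').
do 2 split => //; split; first exact: Rmin_pos.
move=> s Hs; have := Rmin_l r r'; have := Rmin_r r r' => h1 h2.
have E0 : F s0 = G s0 by apply: E; rewrite Cmod_subxx.
by rewrite -E0 -E ?(Ef s) //; lra.
Qed.

Lemma analytic_has_cderiv F s0 : analytic_at F s0 -> exists l, has_cderiv F s0 l.
Proof.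
move=> /analytic_divide [g [r [Hg [Hr E]]]]; exists (g s0), g, r.
by do 2 split => //; split => // s Hs; apply: E; lra.
Qed.

Lemma has_cderiv_plus F G s0 l m : has_cderiv F s0 l -> has_cderiv G s0 m ->
  has_cderiv (fun s => F s + G s) s0 (l + m).
Proof.
move=> [g [r [Hg [<- [Hr E]]]]] [g' [r' [Hg' [<- [Hr' E']]]]].
exists (fun s => g s + g' s), (Rmin r r'); split; first exact: analytic_at_plus.
split => //; split; first exact: Rmin_pos.
move=> s Hs; have := Rmin_l r r'; have := Rmin_r r r' => h1 h2.
by rewrite (E s) ?(E' s); [ring | lra | lra].
Qed.

Lemma has_cderiv_scal F (c s0 l : C) : has_cderiv F s0 l ->
  has_cderiv (fun s => c * F s) s0 (c * l).
Proof.
move=> [g [r [Hg [<- [Hr E]]]]]; exists (fun s => c * g s), r.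
split; first by apply: analytic_at_mult => //; apply: analytic_at_const.
by split => //; split => // s Hs; rewrite E //; ring.
Qed.

Lemma has_cderiv_csum (F : nat -> C -> C) s0 (l : nat -> C) D :
  (forall m, has_cderiv (F m) s0 (l m)) ->
  has_cderiv (fun s => csum (fun m => F m s) D) s0 (csum l D).
Proof.
move=> H; elim: D => [|D IH].
  by rewrite csum0; apply: (has_cderiv_ext Rlt_0_1) (H 0%N) => s _; rewrite csum0.
rewrite csumS; apply: (has_cderiv_ext Rlt_0_1) (has_cderiv_plus IH (H D.+1)) => s _.
by rewrite csumS.
Qed.

Lemma has_cderiv_affine F (c d s0 l : C) : c <> 0 ->
  has_cderiv F (c * s0 + d) l -> has_cderiv (fun s => F (c * s + d)) s0 (c * l).
Proof.
move=> Hc [g [r [Hg [<- [Hr E]]]]].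
have Hp := proj1 (Cmod_gt_0 c) Hc.
exists (fun s => c * g (c * s + d)), (r / Cmod c)%R; split.
  by apply: analytic_at_mult; [apply: analytic_at_const | apply: analytic_at_affine].
split => //; split; first exact: Rdiv_lt_0_compat.
move=> s Hs.
have Ed : c * s + d - (c * s0 + d) = c * (s - s0) by ring.
rewrite E Ed; first ring.
rewrite Cmod_mult; have : (r / Cmod c * Cmod c = r)%R by field; lra.
nra.
Qed.

Lemma has_cderiv_mul_id W : analytic_at W 0 -> has_cderiv (fun s => s * W s) 0 (W 0).
Proof.
move=> HW; exists W, 1%R; split => //; split => //; split; first lra.
by move=> s _; ring.
Qed.

Lemma has_cderiv_is_derive F s0 l : has_cderiv F s0 l ->
  @is_derive C_AbsRing C_NormedModule F s0 l.
Proof.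
move=> [g [r [Hg [El [Hr E]]]]]; split; first exact: is_linear_scal_l.
move=> x Hx.
have {Hx} <- : s0 = x.
  exact: (is_filter_lim_locally_unique (V := AbsRing_NormedModule C_AbsRing) s0 x Hx).
move=> eps.
have [r' [Hr' Hc]] := analytic_continuous Hg (cond_pos eps).
have Hm := Rmin_pos _ _ Hr Hr'.
exists (mkposreal _ Hm) => y Hy.
have Hy' : (Cmod (y - s0) < Rmin r r')%R := Hy.
have := Rmin_l r r'; have := Rmin_r r r' => h1 h2.
change (Cmod ((F y - F s0) - (y - s0) * l) <= eps * Cmod (y - s0))%R.
rewrite E; last lra.
rewrite (_ : F s0 + (y - s0) * g y - F s0 - (y - s0) * l = (g y - g s0) * (y - s0)); last first.
  by rewrite El; ring.
rewrite Cmod_mult; apply: Rmult_le_compat_r; first exact: Cmod_ge_0.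
by apply: Rlt_le; apply: Hc; lra.
Qed.

Lemma has_cderiv_C_derive F s0 l : has_cderiv F s0 l -> C_derive F s0 = l.
Proof. by move=> H; apply: is_C_derive_unique; apply: has_cderiv_is_derive. Qed.

(** Difference quotients in the real direction are real, and the quotient function is continuous at
    [s0]. *)
Lemma has_cderiv_real F s0 l : has_cderiv F s0 l -> Im s0 = 0%R ->
  (forall s, Im s = 0%R -> Im (F s) = 0%R) -> Im l = 0%R.
Proof.
move=> [g [r [Hg [<- [Hr E]]]]] Hs0 HF.
apply: NNPP => Hn; have Hp := Rabs_pos_lt _ Hn.
have [r' [Hr' Hc]] := analytic_continuous Hg Hp.
have Hm := Rmin_pos _ _ Hr Hr'.
have h1 := Rmin_l r r'; have h2 := Rmin_r r r'.
pose h := (Rmin r r' / 2)%R.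
have Hh : (0 < h)%R by rewrite /h; lra.
have Eh : s0 + h - s0 = h by ring.
have Ch : Cmod (s0 + h - s0) = h by rewrite Eh Cmod_RtoC_pos; lra.
have Hhnz : RtoC h <> 0 by move=> /RtoC_inj; lra.
have Hg0 : Im (g (s0 + h)) = 0%R.
  have -> : g (s0 + h) = (F (s0 + h) - F s0) * / h.
    rewrite (E (s0 + h)); last by rewrite Ch /h; lra.
    by rewrite Eh; field.
  apply: Im_mult_real; last exact: Im_inv_real.
  apply: Im_plus_real; last by apply: Im_opp_real; apply: HF.
  by apply: HF; apply: Im_plus_real.
have := Hc (s0 + h) ltac:(rewrite Ch /h; lra).
have := im_le_Cmod (g (s0 + h) - g s0).
rewrite (_ : Im (g (s0 + h) - g s0) = Rminus (Im (g (s0 + h))) (Im (g s0))) // Hg0.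
by rewrite Rminus_0_l Rabs_Ropp; lra.
Qed.

Lemma has_cderiv_zeta_comb c D (dz : nat -> C) :
  (forall m, has_cderiv (hfun 0) (- RtoC (INR m)) (dz m)) ->
  has_cderiv (fun s => zeta_comb c D (2 * s)) 0 (2 * csum (fun m => RtoC (c m) * dz m) D).
Proof.
move=> H.
rewrite -csum_mulr.
apply: (has_cderiv_csum (F := fun m s => RtoC (c m) * hfun 0 (2 * s - RtoC (INR m)))
   (l := fun m => 2 * (RtoC (c m) * dz m))) => m.
rewrite (_ : 2 * (RtoC (c m) * dz m) = RtoC (c m) * (2 * dz m)); last ring.
apply: (has_cderiv_scal (F := fun s => hfun 0 (2 * s - RtoC (INR m)))).
apply: (has_cderiv_affine (F := hfun 0)); first exact: two_neq0.
by rewrite (_ : 2 * 0 + - RtoC (INR m) = - RtoC (INR m)); [apply: H | ring].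
Qed.

(* [s h(2 s + 2 (i + 1) - m)] with the singularity at [s = 0] removed. *)
Definition desingularized (a : R) (i m : nat) (s : C) : C :=
  if m == i.*2.+1 then gfun a (2 * s + 1) / 2
  else s * hfun a (2 * s + RtoC (INR i.+1.*2 - INR m)).

Lemma desingularized_eq a i m s :
  s * s * hfun a (2 * s + RtoC (INR i.+1.*2 - INR m)) = s * desingularized a i m s.
Proof.
rewrite /desingularized; case: eqP => [->|_]; last ring.
rewrite doubleS (S_INR i.*2.+1) (_ : INR i.*2.+1 + 1 - INR i.*2.+1 = 1)%R; last ring.
rewrite /hfun (_ : 2 * s + 1 - 1 = 2 * s); last ring.
(* At s = 0 both sides vanish, whatever value [hfun] takes at its pole. *)
have [->|Hs] := excluded_middle_informative (s = 0); first ring.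
by field.
Qed.

Lemma analytic_desingularized a i m : (0 <= a)%R -> analytic_at (desingularized a i m) 0.
Proof.
move=> Ha; rewrite /desingularized; case: eqP => [_|Hm].
  apply: (analytic_at_mult (F := fun s => gfun a (2 * s + 1)) (G := fun _ => / 2)).
    by apply: (analytic_at_affine (F := gfun a)); [apply: two_neq0 | apply: analytic_gfun].
  exact: analytic_at_const.
apply: (analytic_at_mult (F := fun s => s)); first exact: analytic_at_id.
apply: (analytic_at_affine (F := hfun a)); first exact: two_neq0.
apply: analytic_hfun => //.
rewrite (_ : 2 * 0 + RtoC (INR i.+1.*2 - INR m) = RtoC (INR i.+1.*2 - INR m)); last ring.
move=> /RtoC_inj E; apply: Hm; apply: INR_eq.
by move: E; rewrite doubleS (S_INR i.*2.+1); lra.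
Qed.

(** The 1/2 is the residue of [hfun a (2 * s + 1)] at the origin: the residue 1 of [hfun a] divided
    by the slope 2. *)
Lemma desingularized_0 a i m : (0 <= a)%R ->
  desingularized a i m 0 = if m == i.*2.+1 then RtoC (/ 2) else RtoC 0.
Proof.
move=> Ha; rewrite /desingularized; case: eqP => _; last ring.
rewrite (_ : 2 * 0 + 1 = 1) ?gfun_1 // ?RtoC_inv; last ring; last lra.
by field.
Qed.

(** The limit at the origin of s times the [i]-th anomaly term: only the coefficient of x^(2 i + 1)
    meets the pole. *)
Definition anomaly_value (a : R) (p : nat -> R) (i : nat) : R :=
  (a ^ i.+1.*2 * ((harmonic i - 2 * harmonic i.*2.+1) / INR i.+1) * (p i.*2.+1 / 2))%R.

Lemma csum_single (b : nat -> C) (j D : nat) : (j <= D)%N ->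
  csum (fun m => b m * (if m == j then RtoC (/ 2) else RtoC 0)) D = b j * / 2.
Proof.
have Hlt n : (n < j)%N -> csum (fun m => b m * (if m == j then RtoC (/ 2) else RtoC 0)) n = 0.
  elim: n => [|n IH] Hn; first by rewrite csum0; case: eqP => [|_]; [lia | ring].
  by rewrite csumS IH; last lia; case: eqP => [|_]; [lia | ring].
have E2 : RtoC (/ 2) = / 2 by apply: RtoC_inv; lra.
elim: D => [|D IH] Hj.
  by have -> : j = 0%N by [lia]; rewrite csum0 eqxx E2.
rewrite csumS; have [E|E] : j = D.+1 \/ (j <= D)%N by lia.
  by rewrite Hlt; [rewrite E eqxx E2; ring | lia].
by rewrite IH //; case: eqP => [|_]; [lia | ring].
Qed.

(** Near 0 the continuation is the half-sum of the zeta combinations plus [s * W s] with [W]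
    analytic, so the correction contributes [W 0]; the chain rule factor 2 cancels the half. *)
Lemma has_cderiv_continued a p al be D (dz : nat -> C) (n : nat) : (0 <= a)%R ->
  (forall m, has_cderiv (hfun 0) (- RtoC (INR m)) (dz m)) ->
  (forall m, (D < m)%N -> p m = 0%R) -> (forall i, (n < i)%N -> p i.*2.+1 = 0%R) ->
  has_cderiv (continued a p al be D) 0
    (csum (fun m => RtoC (al m + be m) * dz m) D + RtoC (rsum (anomaly_value a p) n)) /\
  analytic_at (continued a p al be D) 0.
Proof.
move=> Ha Hdz HpD Hpn.
have [I0 HI0] := anomaly_split p D 0 Ha.
(* The cut lies beyond [n], so the head contains every term with a nonzero value at the origin; in
   [W] the tail carries a factor [s] and drops out at 0. *)
have [T [HT HTs]] := HI0 (I0 + n.+1)%N (leq_addr _ _).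
set I := (I0 + n.+1)%N in HTs.
pose U i s := RtoC (a ^ i.+1.*2) * dcoef i s *
  csum (fun m => RtoC (p m) * desingularized a i m s) D.
pose W s := csum (fun i => if (i < I)%N then U i s else RtoC 0) I + s * T s.
have HU i : analytic_at (U i) 0.
  apply: (analytic_at_mult (F := fun s => RtoC (a ^ i.+1.*2) * dcoef i s)).
    by apply: analytic_at_mult; [apply: analytic_at_const | apply: analytic_dcoef].
  apply: (analytic_at_csum (F := fun m s => RtoC (p m) * desingularized a i m s)) => m _.
  apply: (analytic_at_mult (F := fun _ => RtoC (p m))); first exact: analytic_at_const.
  exact: analytic_desingularized.
have HW : analytic_at W 0.
  apply: analytic_at_plus.
    apply: (analytic_at_csum (F := fun i s => if (i < I)%N then U i s else RtoC 0)) => i _.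
    by case: ltnP => _; [apply: HU | apply: analytic_at_const].
  by apply: (analytic_at_mult (F := fun s => s)) => //; apply: analytic_at_id.
have EU i s : s * s * anomaly_term a p D i s = s * U i s.
  rewrite /anomaly_term /U.
  have -> : forall x y : C, s * s * (x * y) = x * (s * s * y) by move=> x y; ring.
  have -> : forall x y : C, s * (x * y) = x * (s * y) by move=> x y; ring.
  congr (_ * _).
  apply: (eq_trans (esym (csum_mulr _ _ _))); apply: (eq_trans _ (csum_mulr _ _ _)).
  apply: csum_ext => m.
  have -> : s * (RtoC (p m) * desingularized a i m s) = RtoC (p m) * (s * desingularized a i m s) by ring.
  by rewrite -desingularized_eq; ring.
have EW s : (Cmod (s - 0) < 1)%R -> continued a p al be D s =
    (/ 2 * zeta_comb al D (2 * s) + / 2 * zeta_comb be D (2 * s)) + s * W s.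
  move=> Hs; rewrite /continued HTs; last lra.
  have -> : s * s * (csum (fun i => if (i < I)%N then anomaly_term a p D i s else RtoC 0) I + T s) =
     s * W s; last by rewrite /Cdiv; ring.
  have Edist : forall x y z : C, s * s * x = s * y -> s * s * (x + z) = s * (y + s * z).
    by move=> x y z E; rewrite Cmult_plus_distr_l E; ring.
  apply: Edist.
  apply: (eq_trans (esym (csum_mulr _ _ _))); apply: (eq_trans _ (csum_mulr _ _ _)).
  by apply: csum_ext => i; case: ltnP => _; [apply: EU | ring].
have HW0 : W 0 = RtoC (rsum (anomaly_value a p) n).
  have EU0 i : U i 0 = RtoC (anomaly_value a p i).
    rewrite /U /anomaly_value dcoef_0 (csum_ext (b := fun m => RtoC (p m) *
       (if m == i.*2.+1 then RtoC (/ 2) else RtoC 0))); last first.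
      by move=> m; rewrite desingularized_0.
    have [Hi|Hi] := leqP i.*2.+1 D.
      by rewrite csum_single // /Rdiv !RtoC_mult (RtoC_inv 2) //; lra.
    rewrite HpD // (csum_ext (b := fun _ => RtoC 0)); last first.
      by move=> m; case: eqP => [->|_]; [rewrite HpD //; ring | ring].
    rewrite (_ : csum (fun _ => RtoC 0) D = 0); last by elim: D {HpD Hi EW EU HU HW U W HTs HI0} => [|D IH]; rewrite ?csum0 ?csumS ?IH //; ring.
    by rewrite (_ : 0 / 2 = 0)%R ?Rmult_0_r; [ring | lra].
  rewrite /W Cmult_0_l Cplus_0_r.
  have Hz i : (n < i)%N -> anomaly_value a p i = 0%R.
    by move=> Hi; rewrite /anomaly_value Hpn // /Rdiv Rmult_0_l Rmult_0_r.
  have : forall k, (n <= k)%N -> csum (fun i => if (i < I)%N then U i 0 else RtoC 0) k = RtoC (rsum (anomaly_value a p) n).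
    elim=> [|k IH] Hk.
      have -> : n = 0%N by lia.
      by rewrite csum0 rsum0 /I addnS /= EU0.
    have [E|E] : n = k.+1 \/ (n <= k)%N by lia.
      have Hgen j : (j < I)%N -> csum (fun i => if (i < I)%N then U i 0 else RtoC 0) j = RtoC (rsum (anomaly_value a p) j).
        elim: j => [|j IHj] Hj; first by rewrite csum0 rsum0 Hj EU0.
        by rewrite csumS rsumS IHj; [rewrite Hj EU0 RtoC_plus | lia].
      by rewrite -E Hgen // /I; lia.
    rewrite csumS IH // EU0 Hz; last lia.
    by case: ltnP => _; ring.
  by apply; rewrite /I; lia.
have Hder : has_cderiv (fun s => (/ 2 * zeta_comb al D (2 * s) + / 2 * zeta_comb be D (2 * s)) + s * W s) 0
   (csum (fun m => RtoC (al m + be m) * dz m) D + RtoC (rsum (anomaly_value a p) n)).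
  have := has_cderiv_plus (has_cderiv_plus (has_cderiv_scal (/ 2) (has_cderiv_zeta_comb al D Hdz))
     (has_cderiv_scal (/ 2) (has_cderiv_zeta_comb be D Hdz))) (has_cderiv_mul_id HW).
  rewrite HW0 (_ : / 2 * (2 * csum (fun m => RtoC (al m) * dz m) D) +
    / 2 * (2 * csum (fun m => RtoC (be m) * dz m) D) = csum (fun m => RtoC (al m + be m) * dz m) D) //.
  rewrite (csum_ext (a := fun m => RtoC (al m + be m) * dz m)
    (b := fun m => RtoC (al m) * dz m + RtoC (be m) * dz m)); last first.
    by move=> m; rewrite RtoC_plus; ring.
  by rewrite csum_plus; field; apply: two_neq0.
split; first by apply: (has_cderiv_ext Rlt_0_1) Hder => s Hs; rewrite EW.
apply: (analytic_at_ext Rlt_0_1) (_ : analytic_at (fun s => (/ 2 * zeta_comb al D (2 * s) + / 2 * zeta_comb be D (2 * s)) + s * W s) 0).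
  by move=> s Hs; rewrite EW.
have Hz c : analytic_at (fun s => / 2 * zeta_comb c D (2 * s)) 0.
  apply: (analytic_at_mult (F := fun _ => / 2)); first exact: analytic_at_const.
  apply: analytic_zeta_comb2 => m Hm.
  rewrite (_ : 2 * 0 - RtoC (INR m) = RtoC (- INR m)); last by rewrite RtoC_opp; ring.
  by move=> /RtoC_inj; have := pos_INR m; lra.
apply: analytic_at_plus; first by apply: analytic_at_plus; apply: Hz.
by apply: (analytic_at_mult (F := fun s => s)) => //; apply: analytic_at_id.
Qed.

(** * Convergence to the Dirichlet series *)

Lemma RtoC_poly_val p D x :
  RtoC (poly_val p D x) = csum (fun m => RtoC (p m) * RtoC x ^ m) D.
Proof.
rewrite /poly_val; elim: D => [|D IH]; first by rewrite rsum0 csum0 RtoC_mult RtoC_pow_nat.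
by rewrite rsumS csumS RtoC_plus IH RtoC_mult RtoC_pow_nat.
Qed.

Lemma csum_mull (c : C) (a : nat -> C) n : csum (fun i => a i * c) n = csum a n * c.
Proof. by rewrite Cmult_comm -csum_mulr; apply: csum_ext => i; ring. Qed.

Lemma poly_val_Rcpow p D x (z : C) : (0 < x)%R ->
  RtoC (poly_val p D x) * Rcpow x (- z) =
  csum (fun m => RtoC (p m) * Rcpow x (- (z - RtoC (INR m)))) D.
Proof.
move=> Hx; rewrite RtoC_poly_val -csum_mull; apply: csum_ext => m.
rewrite (_ : - (z - RtoC (INR m)) = RtoC (INR m) + - z); last ring.
by rewrite Rcpow_plus Rcpow_INR //; ring.
Qed.

Lemma cseries_csum_le (a : nat -> nat -> C) (l : nat -> C) K :
  (forall k, (k <= K)%N -> cseries (fun n => a n k) (l k)) ->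
  cseries (fun n => csum (a n) K) (csum l K).
Proof.
elim: K => [|K IH] H.
  by rewrite csum0; apply: cseries_ext (H 0%N _) => // n; rewrite csum0.
rewrite csumS; apply: cseries_ext (cseries_plus (IH _) (H K.+1 _)) => // [n|k Hk].
  by rewrite csumS.
by apply: H; lia.
Qed.

Lemma poly_hseries a p D z : (0 <= a)%R -> (INR D + 2 < Re z)%R ->
  cseries (fun k => RtoC (poly_val p D (shifted a k)) * Rcpow (shifted a k) (- z))
    (csum (fun m => RtoC (p m) * hfun a (z - RtoC (INR m))) D).
Proof.
move=> Ha Hz.
have H := @cseries_csum_le
  (fun k m => RtoC (p m) * Rcpow (shifted a k) (- (z - RtoC (INR m))))
  (fun m => RtoC (p m) * hfun a (z - RtoC (INR m))) D.
apply: cseries_ext (H _) => [k|m Hm].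
  by rewrite poly_val_Rcpow //; have [h1 [h2 h3]] := shifted_ge k Ha; lra.
have hmD : (INR m <= INR D)%R by apply: le_INR; lia.
have Hre : (2 < Re (z - RtoC (INR m)))%R.
  by rewrite (_ : Re (z - RtoC (INR m)) = Re z - INR m)%R //; lra.
by rewrite hfun_large //; apply: cseries_scal; apply: hseries_cseries => //; lra.
Qed.

Lemma zeta_comb_series c D s : (INR D + 2 < Re s)%R ->
  cseries (fun k => RtoC (poly_val c D (INR k.+1)) * Rcpow (INR k.+1) (- s)) (zeta_comb c D s).
Proof.
move=> Hs; apply: cseries_ext (poly_hseries c (Rle_refl 0) Hs) => k.
by rewrite /shifted Rplus_0_r.
Qed.

(** Re-indexes the series in powers of x + a, which effectively starts at b + 1. *)
Lemma cseries_drop_zeros (t : nat -> C) (l : C) b : (forall i, (i < b)%N -> t i = 0) ->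
  cseries t l -> cseries (fun k => t (k + b)%N) l.
Proof.
elim: b t => [|b IH] t Hz Ht; first by apply: cseries_ext Ht => k; rewrite addn0.
have := cseries_behead Ht; rewrite Hz // (_ : l - 0 = l); last ring.
move=> Ht'; have := IH (fun k => t k.+1) _ Ht'.
move=> /(_ (fun i Hi => Hz i.+1 Hi)); apply: cseries_ext => k.
by rewrite addnS.
Qed.

(* Term by term, the difference of the two binomial expansions in [a / x]. *)
Lemma anomaly_pointwise a x s : (0 <= a)%R -> (a < x)%R ->
  cseries (fun i => s * s * (RtoC (a ^ i.+1.*2) * dcoef i s * Rcpow x (- (2 * s + RtoC (INR i.+1.*2)))))
    (Rcpow ((x - a) * (x + a)) (- s) -
      / 2 * (Rcpow (x - a) (- (2 * s)) + Rcpow (x + a) (- (2 * s)))).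
Proof.
move=> Ha Hx; pose u := (a / x)%R.
have Hu0 : (0 <= u)%R by apply: Rle_mult_inv_pos; lra.
have Hu1 : (u < 1)%R.
  by apply: (Rmult_lt_reg_r x); rewrite /u /Rdiv ?Rmult_assoc ?Rinv_l; lra.
have Hu : (Rabs u < 1)%R by rewrite Rabs_pos_eq.
have Huu : (Rabs (u * u) < 1)%R by rewrite Rabs_pos_eq; nra.
have Ex1 : (x - a = x * (1 - u))%R by rewrite /u; field; lra.
have Ex2 : (x + a = x * (1 + u))%R by rewrite /u; field; lra.
have Ex3 : ((x - a) * (x + a) = x * x * (1 - u * u))%R by rewrite /u; field; lra.
have H1 := cseries_binomial s Huu.
have H2 := cseries_scal (/ 2) (cseries_binomial_even (2 * s) Hu).
(* Both expansions start with the constant 1, so dropping the term of index 0 does not change the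
   sum; it leaves [rising s] of order i + 1 against [rising (2 * s)] of order 2 i + 2. *)
have := cseries_scal (Rcpow x (- (2 * s))) (cseries_behead (cseries_minus H1 H2)).
have E2s : Rcpow x (- (2 * s)) = Rcpow x (- s) * Rcpow x (- s).
  by rewrite -Rcpow_plus; f_equal; ring.
have h2 : RtoC 2 <> 0 := two_neq0.
have -> : Rcpow x (- (2 * s)) * (Rcpow (1 - u * u) (- s) -
    / 2 * (Rcpow (1 - u) (- (2 * s)) + Rcpow (1 + u) (- (2 * s))) -
    (rising s 0 * RtoC (u * u) ^ 0 - / 2 * (2 * rising (2 * s) 0.*2 * RtoC u ^ 0.*2))) =
  Rcpow ((x - a) * (x + a)) (- s) -
      / 2 * (Rcpow (x - a) (- (2 * s)) + Rcpow (x + a) (- (2 * s))).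
  have hxx : (0 < x * x)%R by nra.
  have huu : (0 < 1 - u * u)%R by nra.
  rewrite Ex3 Ex1 Ex2 (Rcpow_mult _ hxx huu) !Rcpow_mult; try lra.
  rewrite E2s /=; field; exact: two_neq0.
apply: cseries_ext => i.
rewrite (_ : - (2 * s + RtoC (INR i.+1.*2)) = - (2 * s) + - RtoC (INR i.+1.*2)); last ring.
rewrite Rcpow_plus Rcpow_opp_INR; last lra.
have Eu : RtoC u ^ i.+1.*2 = RtoC (a ^ i.+1.*2) * RtoC (/ x) ^ i.+1.*2.
  by rewrite -!RtoC_pow_nat -RtoC_mult -Rpow_mult_distr.
have -> : RtoC (u * u) ^ i.+1 = RtoC u ^ i.+1.*2.
  by rewrite -!RtoC_pow_nat pow_double.
have -> : forall A B E : C, A * E - / 2 * (2 * B * E) = (A - B) * E.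
  by move=> A B E; field; exact: two_neq0.
by rewrite rising_sub_double Eu; ring.
Qed.

(** Interchanges the sum over the spectrum with the sum over [i]. The moduli are summable with the
    ratio [X * X] of [majorized_anomaly_term], on a half-plane where all Hurwitz values are given by
    their series. *)
Lemma anomaly_series a p D s : (0 <= a)%R -> (INR D + 2 < Re s)%R ->
  cseries (fun k => RtoC (poly_val p D (shifted a k)) *
      (Rcpow ((shifted a k - a) * (shifted a k + a)) (- s) -
      / 2 * (Rcpow (shifted a k - a) (- (2 * s)) + Rcpow (shifted a k + a) (- (2 * s)))))
    (s * s * Cseries (fun i => anomaly_term a p D i s)).
Proof.
move=> Ha Hs.
have HD := pos_INR D.
pose m i k := RtoC (a ^ i.+1.*2) * dcoef i s *
  (RtoC (poly_val p D (shifted a k)) * Rcpow (shifted a k) (- (2 * s + RtoC (INR i.+1.*2)))).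
pose w := ((2 + 2 * a) / (1 + 2 * a))%R.
have Hw : (1 < w)%R.
  by apply: (Rmult_lt_reg_r (1 + 2 * a)); rewrite /w /Rdiv ?Rmult_assoc ?Rinv_l; lra.
have [K3 [HK3 Hd]] := majorized_dcoef s Hw.
pose X := (2 * a / (1 + 2 * a))%R.
have HX0 : (0 <= X)%R by apply: Rle_mult_inv_pos; lra.
have HX1 : (X < 1)%R.
  by apply: (Rmult_lt_reg_r (1 + 2 * a)); rewrite /X /Rdiv ?Rmult_assoc ?Rinv_l; lra.
pose Pm := rsum (fun m => Rabs (p m)) D.
have HP : (0 <= Pm)%R by apply: rsum_ge0 => j; apply: Rabs_pos.
have Hrow i K : (rsum (fun k => Cmod (m i k)) K <= a ^ 2 * K3 * (Pm * 2) * (X * X) ^ i)%R.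
  pose cst := (a ^ i.+1.*2 * (K3 * (w * w) ^ i))%R.
  have Hcst : (0 <= cst)%R.
    by apply: Rmult_le_pos; [apply: Rpow_ge0 | apply: Rmult_le_pos => //; apply: Rpow_ge0; nra].
  have Hk k : (Cmod (m i k) <= cst * (Pm * Rpower (1 + a) (- INR i.*2)) * / INR k.+1 ^ 2)%R.
    have [h1 [h2 h3]] := shifted_ge k Ha.
    rewrite /m (Cmod_mult (RtoC (a ^ i.+1.*2) * dcoef i s)) (Cmod_mult (RtoC (a ^ i.+1.*2))).
    rewrite (Cmod_RtoC_pos (x := (a ^ i.+1.*2)%R)); last exact: Rpow_ge0.
    rewrite (Rmult_assoc cst); apply: Rmult_le_compat; try exact: Cmod_ge_0.
    - by apply: Rmult_le_pos; [apply: Rpow_ge0 | apply: Cmod_ge_0].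
    - apply: Rmult_le_compat_l; first exact: Rpow_ge0.
      by apply: (majorized_bound (Hd i)); rewrite Cmod_subxx; lra.
    rewrite poly_val_Rcpow; last lra.
    apply: Rle_trans (Cmod_csum _ _) _.
    rewrite Rmult_assoc Rmult_comm -rsum_mulr.
    have Hm j : (j <= D)%N -> (Cmod (RtoC (p j) * Rcpow (shifted a k)
        (- (2 * s + RtoC (INR i.+1.*2) - RtoC (INR j)))) <=
        Rpower (1 + a) (- INR i.*2) * / INR k.+1 ^ 2 * Rabs (p j))%R.
      move=> Hj; rewrite Cmod_mult Cmod_R Rmult_comm; apply: Rmult_le_compat_r; first exact: Rabs_pos.
      apply: Rle_trans (Rpower_shifted k Ha (pos_INR i.*2)).
      rewrite Cmod_Rcpow; apply: Rpower_le_exponent => //.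
      rewrite (_ : Re (- (2 * s + RtoC (INR i.+1.*2) - RtoC (INR j))) =
        - (Re (2 * s) + INR i.+1.*2 - INR j))%R //.
      have hj : (INR j <= INR D)%R by apply: le_INR; lia.
      by rewrite Re_2s !INR_double S_INR; lra.
    elim: (D) Hm => [|D' IH] Hm; first by rewrite !rsum0; apply: Hm.
    rewrite !rsumS; apply: Rplus_le_compat; last exact: Hm.
    by apply: IH => j Hj; apply: Hm; lia.
  apply: Rle_trans (rsum_le _ Hk) _; rewrite rsum_mulr.
  have -> : (a ^ 2 * K3 * (Pm * 2) * (X * X) ^ i = cst * (Pm * Rpower (1 + a) (- INR i.*2)) * 2)%R.
    rewrite Rpower_opp_INR; last lra.
    rewrite /cst doubleS !pow_double -!tech_pow_Rmult pow_double.
    have -> : (X * X = a * a * (w * w) * (/ (1 + a) * / (1 + a)))%R.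
      by rewrite /X /w; field; lra.
    by rewrite !Rpow_mult_distr; ring.
  apply: Rmult_le_compat_l; last exact: inv_square_partial.
  apply: Rmult_le_pos => //; apply: Rmult_le_pos => //.
  by apply: Rlt_le; apply: exp_pos.
have Hex : ex_series (fun i => a ^ 2 * K3 * (Pm * 2) * (X * X) ^ i)%R.
  apply: (ex_series_scal_l (K := R_AbsRing) (V := R_NormedModule)).
  by apply: ex_series_geom; rewrite Rabs_pos_eq; nra.
have [F1 _] := cseries_Fubini Hrow Hex.
have -> : Cseries (fun i => anomaly_term a p D i s) = Cseries (fun i => Cseries (m i)).
  apply: Cseries_ext => i; symmetry; apply: Cseries_unique; rewrite /anomaly_term.
  apply: cseries_scal.
  rewrite (csum_ext (b := fun j => RtoC (p j) * hfun a (2 * s + RtoC (INR i.+1.*2) - RtoC (INR j)))).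
    apply: poly_hseries => //; rewrite Re_plus_RtoC Re_2s; have := pos_INR i.+1.*2; lra.
  by move=> j; rewrite RtoC_minus; do 2 f_equal; ring.
apply: cseries_ext (cseries_scal (s * s) F1) => k.
have [h1 [h2 h3]] := shifted_ge k Ha.
have Hax : (a < shifted a k)%R by lra.
rewrite -(Cseries_unique (cseries_scal (RtoC (poly_val p D (shifted a k))) (anomaly_pointwise s Ha Hax))).
have [_ [_ F3]] := cseries_Fubini Hrow Hex.
rewrite -(Cseries_unique (cseries_scal (s * s) (F3 k))).
by apply: Cseries_ext => i; rewrite /m; ring.
Qed.

(** With a = b / 2 the variable x = k + 1 + a has x - a = k + 1 and x + a = k + 1 + b. The zeros of
    [be] at 1, ..., b reconcile the second sum with a series over all positive integers. *)
Lemma continued_series a (b : nat) p al be D s : a = (INR b / 2)%R ->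
  (forall k, poly_val al D (INR k.+1) = poly_val p D (shifted a k)) ->
  (forall k, poly_val be D (INR (k + b).+1) = poly_val p D (shifted a k)) ->
  (forall k, (k < b)%N -> poly_val be D (INR k.+1) = 0%R) ->
  (INR D + 2 < Re s)%R ->
  cseries (fun k => RtoC (poly_val p D (shifted a k)) *
      Rcpow (INR (k.+1 * (k.+1 + b))) (- s))
    (continued a p al be D s).
Proof.
move=> Eab Hal Hbe Hbe0 Hs.
have Ha : (0 <= a)%R by rewrite Eab; have := pos_INR b; lra.
have H2s : (INR D + 2 < Re (2 * s))%R by rewrite Re_2s; have := pos_INR D; lra.
have SA := zeta_comb_series al H2s.
have SB := cseries_drop_zeros (b := b) _ (zeta_comb_series be H2s).
have {SB} SB := SB (fun i Hi => eq_trans (f_equal (fun x => RtoC x * _) (Hbe0 i Hi)) (Cmult_0_l _)).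
have := cseries_plus (cseries_scal (/ 2) (cseries_plus SA SB)) (anomaly_series p Ha Hs).
rewrite (_ : / 2 * (zeta_comb al D (2 * s) + zeta_comb be D (2 * s)) +
  s * s * Cseries (fun i => anomaly_term a p D i s) = continued a p al be D s); last first.
  by rewrite /continued /Cdiv; ring.
apply: cseries_ext => k.
have E1 : (shifted a k - a = INR k.+1)%R by rewrite /shifted; ring.
have E2 : (shifted a k + a = INR (k + b).+1)%R.
  by rewrite /shifted Eab !S_INR plus_INR; lra.
rewrite Hal Hbe E1 E2 (_ : INR k.+1 * INR (k + b).+1 = INR (k.+1 * (k.+1 + b)))%R; last first.
  by rewrite -mult_INR -addSn.
by ring.
Qed.

(** * Stirling and central factorial numbers *)

(** A common form for falling factorials and the generating products of both kinds of central
    factorial numbers, with [f] listing the roots. *)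
Definition node_prod (f : nat -> R) (y : R) : nat -> R :=
  fix q n := match n with 0 => 1%R | m.+1 => (q m * (y - f m))%R end.

Lemma node_prodS f y n : node_prod f y n.+1 = (node_prod f y n * (y - f n))%R.
Proof. by []. Qed.

Section PolynomialValues.
Import GRing.Theory.
Local Open Scope ring_scope.

Lemma rsum_big (f : nat -> R) K : rsum f K = \sum_(i < K.+1) f i.
Proof.
elim: K => [|K IH]; first by rewrite rsum0 big_ord_recr big_ord0 /= add0r.
by rewrite rsumS big_ord_recr /= -IH.
Qed.

Lemma poly_val_horner (p : {poly R}) K (y : R) : (size p <= K.+1)%N ->
  poly_val (fun k => p`_k) K y = p.[y].
Proof.
move=> Hs; rewrite (horner_coef_wide y Hs) /poly_val rsum_big.
by apply: eq_bigr => i _; rewrite RpowE.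
Qed.

Lemma size_node_poly (f : nat -> R) n : size (\prod_(i < n) ('X - (f i)%:P) : {poly R}) = n.+1.
Proof. by rewrite size_prod_XsubC -[index_enum _]filter_predT -/(enum _) size_enum_ord. Qed.

Lemma horner_node_poly (f : nat -> R) n y :
  (\prod_(i < n) ('X - (f i)%:P) : {poly R}).[y] = node_prod f y n.
Proof.
rewrite horner_prod; elim: n => [|n IH]; first by rewrite big_ord0.
by rewrite big_ord_recr /= IH hornerXsubC.
Qed.

Lemma stirling1_val n K y : (n <= K)%N -> poly_val (stirling1 n) K y = node_prod INR y n.
Proof.
move=> Hn; rewrite -(horner_node_poly INR).
rewrite -(@poly_val_horner _ K) ?size_node_poly //.
rewrite /poly_val; apply: rsum_ext => k; congr (Rmult _ _); rewrite /stirling1.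
by congr ((polyseq _)`_k); apply: eq_bigr => i _; rewrite INRE.
Qed.

Lemma central_u_val n K y : (n <= K)%N ->
  poly_val (central_u n) K y = node_prod (fun i => (INR i ^ 2)%R) y n.
Proof.
move=> Hn; rewrite -(horner_node_poly (fun i => (INR i ^ 2)%R)).
rewrite -(@poly_val_horner _ K) ?(size_node_poly (fun i => (INR i ^ 2)%R)) //.
rewrite /poly_val; apply: rsum_ext => k; congr (Rmult _ _); rewrite /central_u.
by congr ((polyseq _)`_k); apply: eq_bigr => i _; rewrite RpowE INRE natrX.
Qed.

Lemma central_u_0 n k : (n < k)%N -> central_u n k = 0.
Proof.
move=> Hk; rewrite /central_u nth_default //.
rewrite (eq_bigr (fun i : 'I_n => 'X - ((fun j : nat => (j ^ 2)%:R : R) i)%:P)) //.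
by rewrite (size_node_poly (fun j => (j ^ 2)%:R)).
Qed.

(** The index shift removes the leading factor x of the generating polynomial; what remains has odd
    squares as its roots. *)
Lemma central_v_shift n k : central_v n.+1 k.+1 =
  (\prod_(i < n) ('X - ((INR i.*2.+1 ^ 2)%R)%:P) : {poly R})`_k.
Proof.
rewrite /central_v coefXM big_add1 big_mkord [k.+1 == 0%N]/=.
congr ((polyseq _)`_k); apply: eq_bigr => i _; rewrite RpowE INRE -natrX.
by rewrite (_ : (2 * i.+1 - 1 = i.*2.+1)%N) //; lia.
Qed.

Lemma central_v_val n K y : (n <= K)%N ->
  poly_val (fun k => central_v n.+1 k.+1) K y = node_prod (fun i => (INR i.*2.+1 ^ 2)%R) y n.
Proof.
move=> Hn; rewrite -(horner_node_poly (fun i => (INR i.*2.+1 ^ 2)%R)).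
rewrite -(@poly_val_horner _ K) ?(size_node_poly (fun i => (INR i.*2.+1 ^ 2)%R)) //.
by rewrite /poly_val; apply: rsum_ext => k; rewrite central_v_shift.
Qed.

Lemma central_v_0 n k : (n < k)%N -> central_v n.+1 k.+1 = 0.
Proof.
by move=> Hk; rewrite central_v_shift nth_default // (size_node_poly (fun i => (INR i.*2.+1 ^ 2)%R)).
Qed.

End PolynomialValues.

Lemma poly_val_scal c p D x : poly_val (fun m => c * p m)%R D x = (c * poly_val p D x)%R.
Proof. by rewrite /poly_val -rsum_mulr; apply: rsum_ext => m; ring. Qed.

Lemma poly_val_opp p D x : poly_val (fun m => (-1) ^ m * p m)%R D x = poly_val p D (- x).
Proof.
rewrite /poly_val; apply: rsum_ext => m.
by rewrite (_ : - x = -1 * x)%R ?Rpow_mult_distr; [ring | ring].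
Qed.

Lemma rsum_shift (f : nat -> R) K : rsum f K.+1 = (f 0%N + rsum (fun i => f i.+1) K)%R.
Proof.
elim: K => [|K IH]; first by rewrite rsumS !rsum0.
by rewrite rsumS IH [in RHS]rsumS; ring.
Qed.

Lemma rsum_pair (f : nat -> R) K : rsum f K.*2.+1 = rsum (fun i => f i.*2 + f i.*2.+1)%R K.
Proof.
elim: K => [|K IH]; first by rewrite rsumS !rsum0.
by rewrite doubleS rsumS rsumS IH [RHS]rsumS doubleS; ring.
Qed.

Lemma INR_fact_pos n : (0 < INR n`!)%R.
Proof. by apply: lt_0_INR; have := fact_gt0 n; lia. Qed.

Lemma INR_factS n : INR n.+1`! = (INR n.+1 * INR n`!)%R.
Proof. by rewrite factS mult_INR. Qed.

Lemma hemisphere_mult_fact b k :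
  hemisphere_mult b.+1 k.+1 = (INR (b + k)`! / INR k`! / INR b`!)%R.
Proof.
rewrite /hemisphere_mult (_ : (b.+1 + k.+1 - 2 = b + k)%N); last lia.
rewrite subn1 /=.
have H := bin_fact (leq_addl b k); rewrite addnK in H.
have {H} H : (INR 'C(b + k, k) * (INR k`! * INR b`!) = INR (b + k)`!)%R.
  by rewrite -!mult_INR -H.
by have h1 := INR_fact_pos k; have h2 := INR_fact_pos b; rewrite -H; field; lra.
Qed.

Lemma node_prod_rising b k :
  (node_prod INR (- INR k.+1) b = (-1) ^ b * (INR (b + k)`! / INR k`!))%R.
Proof.
have hk := INR_fact_pos k.
elim: b => [|b IH]; first by rewrite add0n /=; field; lra.
rewrite node_prodS IH addSn INR_factS S_INR -tech_pow_Rmult (S_INR (b + k)) plus_INR; field; lra.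
Qed.

Lemma node_prod_falling b k :
  (node_prod INR (INR (k + b)) b = INR (k + b)`! / INR k`!)%R.
Proof.
have H j : (j <= b)%N -> (node_prod INR (INR (k + b)) j = INR (k + b)`! / INR (k + b - j)`!)%R.
  elim: j => [|j IH] Hj.
    by rewrite subn0 /=; have := INR_fact_pos (k + b); move=> h; field; lra.
  rewrite node_prodS IH; last lia.
  have h := INR_fact_pos (k + b - j.+1).
  rewrite (_ : (k + b - j = (k + b - j.+1).+1)%N); last lia.
  rewrite INR_factS.
  have -> : (INR (k + b) - INR j = INR (k + b - j.+1).+1)%R.
    by rewrite -minus_INR; [f_equal; lia | lia].
  by have := INRS_pos (k + b - j.+1); move=> h'; field; lra.
by rewrite H // addnK.
Qed.

(** With b = N - 1 the multiplicity is k (k + 1) ... (k + b - 1) / b!, up to sign a falling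
    factorial at -k; hence the sign (-1)^(b + m). *)
Definition alpha_coef (b m : nat) : R := ((-1) ^ (b + m) * stirling1 b m / INR b`!)%R.
(** In terms of y = k + b the multiplicity is (y - 1) ... (y - b) / b!, a falling factorial of order
    b + 1 divided by y b!; the division by y shifts the index of the Stirling numbers. *)
Definition beta_coef (b m : nat) : R := (stirling1 b.+1 m.+1 / INR b`!)%R.

Lemma alpha_coef_val b D k : (b <= D)%N ->
  poly_val (alpha_coef b) D (INR k.+1) = hemisphere_mult b.+1 k.+1.
Proof.
move=> HD.
have -> : poly_val (alpha_coef b) D (INR k.+1) =
   ((-1) ^ b / INR b`! * poly_val (stirling1 b) D (- INR k.+1))%R.
  rewrite -poly_val_opp -poly_val_scal; apply: rsum_ext => m.
  by rewrite /alpha_coef pow_add; field; have := INR_fact_pos b; lra.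
rewrite stirling1_val // node_prod_rising hemisphere_mult_fact.
have -> : ((-1) ^ b / INR b`! * ((-1) ^ b * (INR (b + k)`! / INR k`!)) =
  ((-1) ^ b * (-1) ^ b) * (INR (b + k)`! / INR k`! / INR b`!))%R.
  by field; have := INR_fact_pos b; have := INR_fact_pos k; lra.
by rewrite -Rpow_mult_distr (_ : -1 * -1 = 1)%R ?pow1; ring.
Qed.

Lemma stirling1_S0 b : stirling1 b.+1 0 = 0%R.
Proof.
have E n : node_prod INR 0 n.+1 = 0%R.
  by elim: n => [|n IH]; [rewrite /=; ring | rewrite node_prodS IH; ring].
have H := stirling1_val 0 (leqnn b.+1).
rewrite E /poly_val rsum_shift (rsum_ext (v := fun _ => 0 * 0)%R) in H; last first.
  by move=> i; rewrite -tech_pow_Rmult; ring.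
by rewrite rsum_mulr pow_O in H; lra.
Qed.

Lemma beta_coef_val b D y : (b <= D)%N ->
  (y * poly_val (beta_coef b) D y = node_prod INR y b.+1 / INR b`!)%R.
Proof.
move=> HD; rewrite -(@stirling1_val b.+1 D.+1); last lia.
rewrite /poly_val rsum_shift stirling1_S0 -rsum_mulr Rmult_0_l Rplus_0_l.
rewrite /Rdiv Rmult_comm -rsum_mulr; apply: rsum_ext => m.
by rewrite /beta_coef /=; field; have := INR_fact_pos b; lra.
Qed.

Lemma beta_coef_val_shift b D k : (b <= D)%N ->
  poly_val (beta_coef b) D (INR (k + b).+1) = hemisphere_mult b.+1 k.+1.
Proof.
move=> HD; have hp := INRS_pos (k + b).
apply: (Rmult_eq_reg_l (INR (k + b).+1)); last lra.
rewrite beta_coef_val // -addnS node_prod_falling hemisphere_mult_fact addnS INR_factS addnC.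
rewrite /Rdiv; ring.
Qed.

Lemma node_prod_INR_eq0 j n : (j < n)%N -> node_prod INR (INR j) n = 0%R.
Proof.
elim: n => [|n IH] // Hj; rewrite node_prodS.
have [->|E] : j = n \/ (j < n)%N by lia.
  by ring.
by rewrite IH //; ring.
Qed.

Lemma beta_coef_val0 b D k : (b <= D)%N -> (k < b)%N ->
  poly_val (beta_coef b) D (INR k.+1) = 0%R.
Proof.
move=> HD Hk; have hp := INRS_pos k.
apply: (Rmult_eq_reg_l (INR k.+1)); last lra.
by rewrite beta_coef_val // node_prod_INR_eq0 // /Rdiv; ring.
Qed.

(** * The multiplicity in powers of the symmetric variable *)

Definition interleave (ev od : nat -> R) (m : nat) : R := if odd m then od m./2 else ev m./2.

Lemma interleave_odd ev od i : interleave ev od i.*2.+1 = od i.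
Proof. by rewrite /interleave /= odd_double /= uphalf_double. Qed.

Lemma interleave_even ev od i : interleave ev od i.*2 = ev i.
Proof. by rewrite /interleave odd_double doubleK. Qed.

Lemma interleave_val ev od K x :
  poly_val (interleave ev od) K.*2.+1 x =
  (poly_val ev K (x * x) + x * poly_val od K (x * x))%R.
Proof.
rewrite /poly_val rsum_pair -rsum_mulr.
elim: K => [|K IH]; last rewrite !rsumS IH.
  by rewrite !rsum0 interleave_odd /interleave /=; ring.
rewrite interleave_odd interleave_even -(pow_double x K.+1) -tech_pow_Rmult; ring.
Qed.

Lemma interleave_gt0 ev od K m : (forall i, (K < i)%N -> ev i = 0%R) ->
  (forall i, (K < i)%N -> od i = 0%R) -> (K.*2.+1 < m)%N -> interleave ev od m = 0%R.
Proof.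
move=> He Ho Hm; have Em := odd_double_half m.
by rewrite /interleave; case: (odd m) Em => Em; [apply: Ho | apply: He]; lia.
Qed.

(** Each difference of squares splits into X + 1 - i and X + 1 + i, and the two kinds of factors
    build up two quotients of factorials. *)
Lemma node_prod_squares X j : (j <= X)%N ->
  node_prod (fun i => (INR i ^ 2)%R) (INR X.+1 * INR X.+1) j =
  (INR X.+1`! / INR (X.+1 - j)`! * (INR (X + j)`! / INR X`!))%R.
Proof.
elim: j => [|j IH] Hj.
  rewrite subn0 addn0 [node_prod _ _ 0]/=.
  by have h1 := INR_fact_pos X.+1; have h2 := INR_fact_pos X; field; lra.
rewrite node_prodS IH; last lia.
rewrite (_ : (X.+1 - j = (X.+1 - j.+1).+1)%N); last lia.
rewrite addnS !INR_factS.
have E1 : (INR (X.+1 - j.+1).+1 = INR X.+1 - INR j)%R.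
  by rewrite -minus_INR; [f_equal; lia | lia].
have E2 : (INR (X + j).+1 = INR X.+1 + INR j)%R by rewrite -plus_INR; f_equal.
have h0 := INRS_pos (X.+1 - j.+1); rewrite E1 in h0.
rewrite E1 E2.
by have h1 := INR_fact_pos (X.+1 - j.+1); have h2 := INR_fact_pos X; field; lra.
Qed.

Lemma node_prod_odd_squares Y j : (j <= Y)%N ->
  node_prod (fun i => (INR i.*2.+1 ^ 2)%R) (INR Y.*2.+1 * INR Y.*2.+1) j =
  (4 ^ j * (INR (Y + j)`! / INR (Y - j)`!))%R.
Proof.
elim: j => [|j IH] Hj.
  rewrite subn0 addn0 [node_prod _ _ 0]/= pow_O.
  by have h1 := INR_fact_pos Y; field; lra.
rewrite node_prodS IH; last lia.
rewrite (_ : (Y - j = (Y - j.+1).+1)%N); last lia.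
rewrite addnS !INR_factS -(tech_pow_Rmult 4).
have E1 : (INR (Y - j.+1).+1 = INR Y - INR j)%R.
  by rewrite -minus_INR; [f_equal; lia | lia].
have h0 := INRS_pos (Y - j.+1); rewrite E1 in h0.
rewrite E1 !S_INR !INR_double plus_INR.
by have h1 := INR_fact_pos (Y - j.+1); field; lra.
Qed.

(* The multiplicity in powers of [x = k + a]: with [U] and [V] the generating
   polynomials of the central factorial numbers, it is [(x - a) U(x^2) / x] in odd
   dimension and [(x - a) V(4 x^2) / (4 x^2)] in even dimension, up to constants. *)
Definition odd_dim_coef (c : nat) : nat -> R :=
  interleave (fun i => central_u c i / INR c.*2`!)%R
    (fun i => - INR c * central_u c i.+1 / INR c.*2`!)%R.

Definition even_dim_coef (c : nat) : nat -> R :=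
  interleave
    (fun i => - (INR c.*2.+1 / 2) * (central_v c.+1 i.+1 * 4 ^ i / (4 ^ c * INR c.*2.+1`!)))%R
    (fun i => central_v c.+1 i.+1 * 4 ^ i / (4 ^ c * INR c.*2.+1`!))%R.

(** For c > 0 the generating polynomial has the root 0, which makes U(x^2) / x a polynomial; for c =
    0 it is the constant 1, and the factor [INR c] covers this case. *)
Lemma central_u_at0 c : (INR c * central_u c 0 = 0)%R.
Proof.
case: c => [|c]; first by rewrite /=; ring.
have := central_u_val 0 (leqnn c.+1).
have -> : node_prod (fun i => (INR i ^ 2)%R) 0 c.+1 = 0%R.
  by elim: c => [|c IH]; [rewrite /=; ring | rewrite node_prodS IH; ring].
rewrite /poly_val rsum_shift (rsum_ext (v := fun _ => 0 * 0)%R).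
  by rewrite rsum_mulr pow_O => H; have -> : central_u c.+1 0 = 0%R by [lra]; ring.
by move=> i; rewrite -tech_pow_Rmult; ring.
Qed.

Lemma odd_dim_coef_val c k :
  poly_val (odd_dim_coef c) c.*2.+1 (shifted (INR c.*2 / 2) k) = hemisphere_mult c.*2.+1 k.+1.
Proof.
have Ex : shifted (INR c.*2 / 2) k = INR (k + c).+1.
  by rewrite /shifted INR_double !S_INR plus_INR; lra.
rewrite Ex interleave_val hemisphere_mult_fact.
set x := INR (k + c).+1; have hx : (0 < x)%R := INRS_pos (k + c).
have hb := INR_fact_pos c.*2.
have hk := INR_fact_pos k; have hk1 := INRS_pos k; have hkc := INR_fact_pos (k + c).
pose U := node_prod (fun i => (INR i ^ 2)%R) (x * x) c.
have EU : U = (x * INR (c.*2 + k)`! / (INR k.+1 * INR k`!))%R.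
  rewrite /U node_prod_squares ?leq_addl //.
  rewrite (_ : ((k + c).+1 - c = k.+1)%N); last lia.
  rewrite (_ : (k + c + c = c.*2 + k)%N); last by rewrite -addnn; lia.
  by rewrite !INR_factS -/x; field; lra.
have Eev : poly_val (fun i => central_u c i / INR c.*2`!)%R c (x * x) = (U / INR c.*2`!)%R.
  rewrite /U -(central_u_val _ (leqnn c)) /Rdiv Rmult_comm -poly_val_scal.
  by apply: rsum_ext => i; ring.
have Eod : (x * x * poly_val (fun i => - INR c * central_u c i.+1 / INR c.*2`!) c (x * x) =
    - INR c * U / INR c.*2`!)%R.
  have := central_u_val (x * x) (leqnSn c); rewrite -/U /poly_val rsum_shift pow_O Rmult_1_r => HU.
  have -> : (- INR c * U / INR c.*2`! = (- INR c / INR c.*2`!) *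
     rsum (fun i => central_u c i.+1 * (x * x) ^ i.+1) c)%R.
    have -> : rsum (fun i => central_u c i.+1 * (x * x) ^ i.+1)%R c = (U - central_u c 0)%R by lra.
    have E0 := central_u_at0 c.
    have -> : (- INR c / INR c.*2`! * (U - central_u c 0) =
       (- INR c * U + INR c * central_u c 0) / INR c.*2`!)%R by field; lra.
    by rewrite E0 Rplus_0_r.
  rewrite -!rsum_mulr; apply: rsum_ext => i.
  by rewrite -tech_pow_Rmult /Rdiv; ring.
(* The odd part is -c U(x^2) / x, so the identity is checked after multiplication by x, where the
   left side becomes (x - c) U(x^2) up to the factorial. *)
rewrite Eev; apply: (Rmult_eq_reg_l x); last lra.
rewrite Rmult_plus_distr_l -(Rmult_assoc x x) Eod.
have -> : (x * (U / INR c.*2`!) + - INR c * U / INR c.*2`! = (x - INR c) * U / INR c.*2`!)%R.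
  by field; lra.
have -> : (x - INR c = INR k.+1)%R by rewrite /x !S_INR plus_INR; ring.
by rewrite EU; field; lra.
Qed.

Lemma even_dim_coef_val c k :
  poly_val (even_dim_coef c) c.*2.+1 (shifted (INR c.*2.+1 / 2) k) = hemisphere_mult c.*2.+2 k.+1.
Proof.
set a := (INR c.*2.+1 / 2)%R; set x := shifted a k.
have hk := INR_fact_pos k; have hk1 := INRS_pos k; have hb := INR_fact_pos c.*2.+1.
have h4 : (0 < 4 ^ c)%R by apply: pow_lt; lra.
have Exa : (x - a = INR k.+1)%R by rewrite /x /shifted; ring.
(* Here x is half an odd integer, so 4 x^2 is an odd square and V(4 x^2) a product of differences of
   odd squares. *)
have E2x : (4 * (x * x) = INR (k + c).+1.*2.+1 * INR (k + c).+1.*2.+1)%R.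
  have -> : INR (k + c).+1.*2.+1 = (2 * x)%R; last ring.
  by rewrite /x /shifted /a S_INR INR_double !S_INR INR_double plus_INR; field.
pose V := poly_val (fun i => central_v c.+1 i.+1) c (4 * (x * x))%R.
have EV : V = (4 ^ c * (INR (c.*2.+1 + k)`! / (INR k.+1 * INR k`!)))%R.
  rewrite /V central_v_val // E2x node_prod_odd_squares; last lia.
  rewrite (_ : ((k + c).+1 + c = c.*2.+1 + k)%N); last by rewrite -addnn; lia.
  rewrite (_ : ((k + c).+1 - c = k.+1)%N); last lia.
  by rewrite (INR_factS k).
have Ew : poly_val (fun i => central_v c.+1 i.+1 * 4 ^ i / (4 ^ c * INR c.*2.+1`!))%R c (x * x) =
    (V / (4 ^ c * INR c.*2.+1`!))%R.
  rewrite /V /Rdiv (Rmult_comm (poly_val _ _ _)) -poly_val_scal; apply: rsum_ext => i.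
  by rewrite (Rpow_mult_distr 4); ring.
rewrite interleave_val poly_val_scal Ew hemisphere_mult_fact.
have -> : forall y : R, (- a * y + x * y = (x - a) * y)%R by move=> y; ring.
by rewrite Exa EV; field; lra.
Qed.

(** * Transfer to the zeta functions of the statement *)

Lemma riemann_zeta_hfun m : exists r, (0 < r)%R /\
  forall s, (Cmod (s - (- RtoC (INR m))) < r)%R -> riemann_zeta s = hfun 0 s.
Proof.
have H0 := Rle_refl 0.
apply: (dirichlet_function_eq (sigma := 2)).
- by move=> s; apply: weakly_meromorphic_hfun.
- by move=> s Hs; apply: analytic_hfun => //; apply: Re_neq1.
- move=> s Hs; rewrite hfun_large //.
  apply: cseries_ext (hseries_cseries H0 (Rlt_le _ _ Hs)) => k.
  by rewrite /shifted Rplus_0_r; ring.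
apply: analytic_hfun => //.
by rewrite -RtoC_opp => /RtoC_inj; have := pos_INR m; lra.
Qed.

Lemma has_cderiv_hfun_zeta m :
  has_cderiv (hfun 0) (- RtoC (INR m)) (C_derive riemann_zeta (- RtoC (INR m))).
Proof.
have [l Hl] : exists l, has_cderiv (hfun 0) (- RtoC (INR m)) l.
  apply: analytic_has_cderiv; apply: analytic_hfun; first lra.
  by rewrite -RtoC_opp => /RtoC_inj; have := pos_INR m; lra.
have [r [Hr E]] := riemann_zeta_hfun m.
have Hz := has_cderiv_ext Hr (fun s Hs => esym (E s Hs)) Hl.
by rewrite (has_cderiv_C_derive Hz).
Qed.

Lemma C_derive_zeta_real m : Im (C_derive riemann_zeta (- RtoC (INR m))) = 0%R.
Proof.
apply: has_cderiv_real (has_cderiv_hfun_zeta m) _ _.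
  by apply: Im_opp_real.
by move=> s; apply: Im_hfun_real.
Qed.

(** Both parities are padded to degree 2 c + 1, the exact degree for b = 2 c + 1; with c = n - 1
    this is why both sums of zeta derivatives end at 2 n - 1. *)
Lemma hemisphere_zeta_cderiv (b c : nat) (p : nat -> R) : (b <= c.*2.+1)%N ->
  (forall k, poly_val p c.*2.+1 (shifted (INR b / 2) k) = hemisphere_mult b.+1 k.+1) ->
  (forall m, (c.*2.+1 < m)%N -> p m = 0%R) ->
  has_cderiv (hemisphere_zeta b.+1) 0
    (csum (fun m => RtoC (alpha_coef b m + beta_coef b m) *
        C_derive riemann_zeta (- RtoC (INR m))) c.*2.+1
     + RtoC (rsum (anomaly_value (INR b / 2) p) c)).
Proof.
move=> Hb Hp Hp0; set a := (INR b / 2)%R.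
have Ha : (0 <= a)%R by rewrite /a; have := pos_INR b; lra.
have Hp1 i : (c < i)%N -> p i.*2.+1 = 0%R by move=> Hi; apply: Hp0; lia.
have [Hd Han] := has_cderiv_continued (alpha_coef b) (beta_coef b) Ha has_cderiv_hfun_zeta Hp0 Hp1.
have [r [Hr E]] : exists r, (0 < r)%R /\ forall s, (Cmod (s - 0) < r)%R ->
    hemisphere_zeta b.+1 s = continued a p (alpha_coef b) (beta_coef b) c.*2.+1 s.
  apply: (dirichlet_function_eq (sigma := (INR c.*2.+1 + 2)%R)) => //.
  - by move=> s; apply: weakly_meromorphic_continued.
  - by move=> s; apply: analytic_continued_right.
  move=> s Hs.
  have H := @continued_series a b p (alpha_coef b) (beta_coef b) c.*2.+1 s (erefl _) _ _ _ Hs.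
  apply: cseries_ext (H _ _ _) => k.
  - by rewrite Hp /hemisphere_eigenvalue (_ : (k.+1 + b.+1 - 1 = k.+1 + b)%N) //; lia.
  - by rewrite alpha_coef_val // Hp.
  - by rewrite beta_coef_val_shift // Hp.
  - by move=> Hk; rewrite beta_coef_val0.
exact: (has_cderiv_ext Hr (fun s Hs => esym (E s Hs)) Hd).
Qed.

(** The determinant is exp (-l), so for real [l] it is positive and its real logarithm returns
    -l. *)
Lemma hemisphere_zeta_conclusion N l : has_cderiv (hemisphere_zeta N) 0 l -> Im l = 0%R ->
  (exists d : R, (0 < d)%R /\ hemisphere_det N = RtoC d /\
      RtoC (- ln d)%R = C_derive (hemisphere_zeta N) 0) /\
  @is_derive C_AbsRing C_NormedModule (hemisphere_zeta N) (RtoC 0) l.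
Proof.
move=> Hl Hr; split; last exact: has_cderiv_is_derive.
have Ed := has_cderiv_C_derive Hl.
have El : l = RtoC (Re l) by case: l Hr {Hl Ed} => x y /= ->.
exists (exp (- Re l)); split; first exact: exp_pos.
rewrite /hemisphere_det Ed ln_exp Ropp_involutive -El; split => //.
by rewrite El -RtoC_opp /Cexp /= cos_0 sin_0 Rmult_1_r Rmult_0_r.
Qed.

Lemma Im_csum_real (f : nat -> C) n : (forall i, Im (f i) = 0%R) -> Im (csum f n) = 0%R.
Proof.
move=> H; elim: n => [|n IH]; first by rewrite csum0.
by rewrite csumS; apply: Im_plus_real.
Qed.

Lemma sum_n_m_rsum (f : nat -> R) c : sum_n_m f 1 c.+1 = rsum (fun i => f i.+1) c.
Proof.
elim: c => [|c IH]; first by rewrite sum_n_n rsum0.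
by rewrite sum_n_Sm ?IH ?rsumS //; lia.
Qed.

Lemma odd_anomaly c :
  rsum (anomaly_value (INR c.*2 / 2) (odd_dim_coef c)) c =
  Ropp (sum_n_m (fun i => central_ubar c i * (INR c ^ (2 * i + 1) / INR (2 * i))
                    * (harmonic (i - 1) / 2 - harmonic (2 * i - 1)))%R 1 c).
Proof.
set f := fun i => _.
(* The left side of the lemma has c + 1 terms; the term added here contains u(c, c + 1) = 0. *)
have -> : sum_n_m f 1 c = sum_n_m f 1 c.+1.
  rewrite sum_n_Sm; last lia.
  rewrite (_ : f c.+1 = zero) ?plus_zero_r //.
  by rewrite /f /central_ubar central_u_0 // Rmult_0_r !Rmult_0_l.
rewrite sum_n_m_rsum (_ : Ropp _ = -1 * rsum (fun i => f i.+1) c)%R; last ring.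
rewrite -rsum_mulr; apply: rsum_ext => i.
rewrite /anomaly_value /f /central_ubar /odd_dim_coef interleave_odd subn1 succnK.
rewrite !mul2n (_ : (i.+1.*2 - 1 = i.*2.+1)%N); last lia.
rewrite addn1 -tech_pow_Rmult !INR_double.
rewrite (_ : 2 * INR c / 2 = INR c)%R; last field.
have h1 := INR_fact_pos c.*2; have h2 := INRS_pos i.
by field; lra.
Qed.

(** Here a = (2 c + 1) / 2: the 4^(-(i + 1)) from a^(2 i + 2) meets the 4^i of the coefficient,
    which leaves the 4 in the denominator. *)
Lemma even_anomaly c :
  rsum (anomaly_value (INR c.*2.+1 / 2) (even_dim_coef c)) c =
  sum_n_m (fun i => central_vbar c.+1 i * (INR (2 * c.+1 - 1) ^ (2 * i) / INR (4 * i))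
                    * (harmonic (i - 1) / 2 - harmonic (2 * i - 1)))%R 1 c.+1.
Proof.
rewrite sum_n_m_rsum; apply: rsum_ext => i.
have e1 : (2 * c.+1 - 1 = c.*2.+1)%N by lia.
have e2 : (2 * i.+1 - 1 = i.*2.+1)%N by lia.
rewrite /anomaly_value /central_vbar /even_dim_coef interleave_odd e1 e2 mul2n.
rewrite (_ : (i.+1 - 1 = i)%N); last by rewrite subn1.
rewrite (_ : (c.+1 - 1 = c)%N); last by rewrite subn1.
rewrite (_ : INR (4 * i.+1) = 4 * INR i.+1)%R; last first.
  by rewrite mult_INR; congr (Rmult _ _); rewrite /=; lra.
rewrite /Rdiv Rpow_mult_distr (pow_double (/ 2)).
rewrite (_ : (/ 2 * / 2) = / 4)%R; last lra.
rewrite -(tech_pow_Rmult (/ 4)) pow_inv.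
have h1 := INR_fact_pos c.*2.+1; have h2 := INRS_pos i.
have h3 : (0 < 4 ^ i)%R by apply: pow_lt; lra.
have h4 : (0 < 4 ^ c)%R by apply: pow_lt; lra.
by field; lra.
Qed.

Lemma pow_m1_double c : ((-1) ^ c.*2 = 1)%R.
Proof. by rewrite pow_double (_ : -1 * -1 = 1)%R ?pow1 //; ring. Qed.

(** [sg] is (-1)^(b + k) reduced by the parity of [b], the source of the different signs in odd and
    even dimension. *)
Lemma zeta_sum_factor b c (sg : nat -> R) (f : nat -> C) :
  (forall k, (-1) ^ (b + k) = sg k)%R ->
  csum (fun m => RtoC (alpha_coef b m + beta_coef b m) * f m) c =
  / RtoC (INR b`!) * csum (fun k => f k * RtoC (stirling1 b.+1 (k + 1) + sg k * stirling1 b k)%R) c.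
Proof.
move=> Hsg; have hb := INR_fact_pos b.
rewrite -csum_mulr; apply: csum_ext => k.
rewrite /alpha_coef /beta_coef Hsg addn1 -RtoC_inv; last lra.
rewrite (_ : (sg k * stirling1 b k / INR b`! + stirling1 b.+1 k.+1 / INR b`! =
  / INR b`! * (stirling1 b.+1 k.+1 + sg k * stirling1 b k))%R).
  by rewrite RtoC_mult; ring.
by field; lra.
Qed.

Lemma Im_zeta_sum b (w : nat -> R) c : Im (/ RtoC (INR b`!) *
  csum (fun k => C_derive riemann_zeta (- RtoC (INR k)) * RtoC (w k)) c) = 0%R.
Proof.
apply: Im_mult_real; first exact: Im_inv_real.
by apply: Im_csum_real => k; apply: Im_mult_real => //; apply: C_derive_zeta_real.
Qed.

Unset Implicit Arguments.
Set Strict Implicit.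
Set Printing Implicit Defensive.

Theorem theorem3p2 (n : nat) (hn : (1 <= n)%N) :
  ((exists d : R, (0 < d)%R /\ hemisphere_det (2 * n - 1) = RtoC d /\
      RtoC (- ln d)%R = C_derive (hemisphere_zeta (2 * n - 1)) 0) /\
   @is_derive C_AbsRing C_NormedModule (hemisphere_zeta (2 * n - 1)) (RtoC 0)
     (/ INR (2 * n - 2)`! *
        sum_n_m (G := C_AbelianMonoid)
          (fun k => C_derive riemann_zeta (- INR k) *
             RtoC (stirling1 (2 * n - 1) (k + 1)
                   + (-1) ^ k * stirling1 (2 * n - 2) k)%R)
          0 (2 * n - 1)
      - RtoC (sum_n_m
          (fun i => central_ubar (n - 1) i * (INR (n - 1) ^ (2 * i + 1) / INR (2 * i))
                    * (harmonic (i - 1) / 2 - harmonic (2 * i - 1)))%R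
          1 (n - 1))))
  /\
  ((exists d : R, (0 < d)%R /\ hemisphere_det (2 * n) = RtoC d /\
      RtoC (- ln d)%R = C_derive (hemisphere_zeta (2 * n)) 0) /\
   @is_derive C_AbsRing C_NormedModule (hemisphere_zeta (2 * n)) (RtoC 0)
     (/ INR (2 * n - 1)`! *
        sum_n_m (G := C_AbelianMonoid)
          (fun k => C_derive riemann_zeta (- INR k) *
             RtoC (stirling1 (2 * n) (k + 1)
                   + (-1) ^ (k + 1) * stirling1 (2 * n - 1) k)%R)
          0 (2 * n - 1)
      + RtoC (sum_n_m
          (fun i => central_vbar n i * (INR (2 * n - 1) ^ (2 * i) / INR (4 * i))
                    * (harmonic (i - 1) / 2 - harmonic (2 * i - 1)))%R
          1 n))).
Proof.
case: n hn => [//|c _].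
have e1 : (2 * c.+1 - 1 = c.*2.+1)%N by lia.
have e2 : (2 * c.+1 - 2 = c.*2)%N by lia.
have e3 : (2 * c.+1 = c.*2.+2)%N by lia.
have e4 : (c.+1 - 1 = c)%N by lia.
have Hodd m : (c.*2.+1 < m)%N -> odd_dim_coef c m = 0%R.
  by apply: interleave_gt0 => i Hi; rewrite central_u_0 /Rdiv ?Rmult_0_r ?Rmult_0_l //; lia.
have Heven m : (c.*2.+1 < m)%N -> even_dim_coef c m = 0%R.
  by apply: interleave_gt0 => i Hi; rewrite central_v_0 // /Rdiv !Rmult_0_l ?Rmult_0_r.
(* The dimensions are b + 1 with b = 2 c and b = 2 c + 1, where c = n - 1. *)
have Dodd := hemisphere_zeta_cderiv (leqnSn c.*2) (odd_dim_coef_val c) Hodd.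
have Deven := hemisphere_zeta_cderiv (leqnn c.*2.+1) (even_dim_coef_val c) Heven.
rewrite odd_anomaly RtoC_opp (@zeta_sum_factor _ _ (fun k => (-1) ^ k)%R) in Dodd; last first.
  by move=> k; rewrite pow_add pow_m1_double Rmult_1_l.
rewrite even_anomaly (@zeta_sum_factor _ _ (fun k => (-1) ^ (k + 1))%R) in Deven; last first.
  by move=> k; rewrite addn1 addSnnS pow_add pow_m1_double Rmult_1_l.
split.
  rewrite e1 e2 e4; apply: (hemisphere_zeta_conclusion Dodd).
  by apply: Im_plus_real; [apply: Im_zeta_sum | apply: Im_opp_real].
rewrite e1 e3; rewrite e1 in Deven.
apply: (hemisphere_zeta_conclusion Deven).
by apply: Im_plus_real; first exact: Im_zeta_sum.
Qed.
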